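(* Let $n\ge 2$ be an integer and let $c_1,c_2>0$. There exists $\delta_0>0$, depending only on $n,c_1,c_2$, such that for every $\delta\in(0,1)$ with $\delta<\delta_0$ and every $c_\delta>0$ there exist constants $D_0,\Delta_0,C>0$, depending only on $n,c_1,c_2,c_\delta$ (and, for $D_0$, on the growth of $K$ as a function of $D$), for which the following holds. Let $K=K(D)\ge2$ be such that $\varepsilon_K:=K\log^n(K)/D^n$ satisfies $\lim_{D\to\infty}\varepsilon_K=0$. Let $D>D_0$ and assume that $a_1,\dots,a_K\in\mathbb{S}^{D-1}$ satisfy, with $A=[a_1|\dots|a_K]\in\mathbb{R}^{D\times K}$: (A1) $A$ is $(\lceil c_\delta D/\log K\rceil,\delta)$-RIP; (A2) $\max_{i\ne j}\langle a_i,a_j\rangle^2\le c_1\log(K)/D$; (A3) the matrix $G_n\in\mathbb{R}^{K\times K}$, $(G_n)_{ij}=\langle a_i,a_j\rangle^n$, is invertible with $\|G_n^{-1}\|_2\le c_2$. Let $\mathcal{A}=\operatorname{Span}\{a_i^{\otimes n}:i\in[K]\}$ and let $\hat{\mathcal{A}}\subseteq\operatorname{Sym}((\mathbb{R}^D)^{\otimes n})$ be a linear subspace with $\Delta_{\mathcal{A}}:=\|P_{\mathcal{A}}-P_{\hat{\mathcal{A}}}\|_{F\to F}\le\Delta_0$. Then the program $\max_{x\in\mathbb{S}^{D-1}}F_{\hat{\mathcal{A}}}(x)$ has exactly $2K$ second-order critical points in the superlevel set $$\{x\in\mathbb{S}^{D-1}:F_{\hat{\mathcal{A}}}(x)\ge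 C\varepsilon_K+5\Delta_{\mathcal{A}}\}.$$ Each of these critical points is a strict local maximizer of $F_{\hat{\mathcal{A}}}$ on $\mathbb{S}^{D-1}$. Further, for each such point $x^*$ there exist unique $i\in[K]$ and $s\in\{-1,1\}$ such that $$\|x^*-sa_i\|_2^2\le\frac{2\Delta_{\mathcal{A}}}{n}.$$ In particular, in the noiseless case ($\Delta_{\mathcal{A}}=0$), the second-order critical points in this superlevel set are exactly the global maximizers $sa_i$ ($i\in[K]$, $s\in\{-1,1\}$).
   Context: $[K]=\{1,\dots,K\}$. $(\mathbb{R}^D)^{\otimes n}$ is the space of real tensors of size $D^{\times n}$ with Frobenius inner product and norm $\|\cdot\|_F$; $\operatorname{Sym}((\mathbb{R}^D)^{\otimes n})$ is the subspace of symmetric tensors. For a linear subspace $\mathcal{B}$ of tensors, $P_{\mathcal{B}}$ is the orthogonal projector onto $\mathcal{B}$, and $F_{\mathcal{B}}(x):=\|P_{\mathcal{B}}(x^{\otimes n})\|_F^2$. $\|\cdot\|_{F\to F}$ is the operator norm induced by the Frobenius norm; $\|\cdot\|_2$ of a matrix is the spectral norm. A matrix $A\in\mathbb{R}^{D\times K}$ is $(p,\delta)$-RIP, for an integer $1\le p\le K$ and $\delta\in(0,1)$, if every $D\times p$ submatrix $A_p$ of $A$ satisfies $\|A_p^\top A_p-\operatorname{Id}_p\|_2\le\delta$. A point $x\in\mathbb{S}^{D-1}$ is second-order critical for $\max_{\mathbb{S}^{D-1}}F$ if the Riemannian gradient of $F|_{\mathbb{S}^{D-1}}$ vanishes at $x$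 and the Riemannian Hessian at $x$ is negative semidefinite on $\{z:z\perp x\}$. *)

(* Defs.v *)
From HB Require Import structures.
From mathcomp Require Import all_boot all_order all_algebra all_fingroup.
From mathcomp Require Import all_classical all_reals all_analysis.
From mathcomp Require Import zify.

Set Implicit Arguments.
Unset Strict Implicit.
Unset Printing Implicit Defensive.

Import Order.TTheory GRing.Theory Num.Theory.
Import numFieldNormedType.Exports.

Local Open Scope classical_set_scope.
Local Open Scope ring_scope.

Section Euclidean.
Context {R : realType}.

Definition edot m (x y : 'cV[R]_m) : R := \sum_i x i 0 * y i 0.

(* The norm `|x| of the library on matrices is the max-norm, hence a separate
   Euclidean norm. Both induce the same topology, so nbhs and 'D_v below are
   the usual ones. *)
Definition enorm m (x : 'cV[R]_m) : R := Num.sqrt (edot x x).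

Definition sphere m : set 'cV[R]_m := [set x | enorm x = 1].

Definition specnorm p q (M : 'M[R]_(p, q)) : R :=
  sup [set enorm (M *m v) | v in [set v | enorm v <= 1]].

(* A D x p submatrix is colsub f A for f increasing. *)
Definition RIP D K (p : nat) (delta : R) (A : 'M[R]_(D, K)) : Prop :=
  [/\ (1 <= p <= K)%N, 0 < delta < 1 &
      forall f : 'I_p -> 'I_K, {homo f : i j / (i < j)%N} ->
        specnorm ((colsub f A)^T *m colsub f A - 1%:M) <= delta].

End Euclidean.

Section Sphere.
Context {R : realType} {D : nat}.
Implicit Types (F : 'cV[R]_D -> R) (x v z : 'cV[R]_D).

(* Orthogonal projection onto the tangent space of the sphere at x, |x| = 1. *)
Definition tproj x v : 'cV[R]_D := v - edot x v *: x.

Definition egrad F x : 'cV[R]_D := \col_i 'D_(delta_mx i 0) F x.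

Definition rgrad F x : 'cV[R]_D := tproj x (egrad F x).

(* The Levi-Civita connection of the sphere is the tangential part of the
   ambient derivative; rgrad F is used as an ambient extension of the
   Riemannian gradient field. *)
Definition rhess F x z : 'cV[R]_D := tproj x ('D_z (rgrad F) x).

Definition second_order_critical F x : Prop :=
  [/\ sphere x, rgrad F x = 0 &
      forall z, edot x z = 0 -> edot z (rhess F x z) <= 0].

Definition strict_local_max F x : Prop :=
  sphere x /\ \forall y \near x, sphere y -> y != x -> F y < F x.

Definition global_max F x : Prop :=
  sphere x /\ forall y, sphere y -> F y <= F x.

End Sphere.

(* (R^D)^{(x) n}: arrays of reals indexed by multi-indices in [D]^n. *)
Notation tensor R D n := {ffun {ffun 'I_n -> 'I_D} -> R^o}.

Section Tensor.
Context {R : realType} {D n : nat}.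
Local Notation V := (tensor R D n).
Implicit Types (S T : V) (B : {vspace V}).

Definition fdot S T : R := \sum_i S i * T i.

Definition fnorm T : R := Num.sqrt (fdot T T).

Definition symmetric_tensor T : Prop :=
  forall (s : 'S_n) (i : {ffun 'I_n -> 'I_D}), T [ffun k => i (s k)] = T i.

Definition opnorm (L : 'End(V)) : R :=
  sup [set fnorm (L T) | T in [set T | fnorm T <= 1]].

Definition tpow (x : 'cV[R]_D) : V :=
  [ffun i : {ffun 'I_n -> 'I_D} => \prod_(k < n) x (i k) 0].

Definition orthov B : {vspace V} :=
  (\bigcap_(b <- vbasis B) lker (linfun (fdot b : V -> R^o)))%VS.

Definition orthoproj B : 'End(V) := daddv_pi B (orthov B).

Fact fdot_is_linear S : linear (fdot S : V -> R^o).
Proof.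
move=> a T U; rewrite /fdot scaler_sumr -big_split /=; apply: eq_bigr => i _.
by rewrite !ffunE mulrDr mulrCA.
Qed.

HB.instance Definition _ S :=
  GRing.isLinear.Build R V R^o *:%R (fdot S) (fdot_is_linear S).

Lemma fdotC S T : fdot S T = fdot T S.
Proof. by apply: eq_bigr => i _; rewrite mulrC. Qed.

Lemma orthovP B T :
  reflect (forall S, S \in B -> fdot S T = 0) (T \in orthov B).
Proof.
have memB (s : seq V) :
    T \in (\bigcap_(b <- s) lker (linfun (fdot b : V -> R^o)))%VS =
    all (fun b => fdot b T == 0) s.
  elim: s => [|b s IH]; first by rewrite big_nil memvf.
  by rewrite big_cons memv_cap IH memv_ker lfunE.
rewrite /orthov memB; apply: (iffP allP) => [h S SB|h S /vbasis_mem/h ->//].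
rewrite fdotC (coord_vbasis SB) linear_sum big1// => i _.
rewrite linearZ /= fdotC; apply/eqP; rewrite scaler_eq0; apply/orP; right.
by apply: h; rewrite mem_nth ?size_tuple.
Qed.

Lemma fdot_eq0 T : fdot T T = 0 -> T = 0.
Proof.
move=> /eqP; rewrite psumr_eq0 => [/allP h|i _]; last by rewrite -expr2 sqr_ge0.
apply/ffunP => i; rewrite ffunE; apply/eqP.
by have := h i (mem_index_enum i); rewrite mulf_eq0 orbb.
Qed.

Lemma orthov_disjoint B : (B :&: orthov B = 0)%VS.
Proof.
apply/eqP; rewrite -subv0; apply/subvP => T; rewrite memv_cap memv0.
by move=> /andP[TB /orthovP/(_ _ TB)/fdot_eq0 ->].
Qed.

Lemma orthoproj_mem B T : orthoproj B T \in B.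
Proof. exact: memv_pi. Qed.

Lemma addv_orthov B : (B + orthov B = fullv)%VS.
Proof.
apply/eqP; rewrite eqEdim subvf dimv_disjoint_sum ?orthov_disjoint//.
suff bnd (s : seq V) : (\dim {:V} <= size s +
    \dim (\bigcap_(b <- s) lker (linfun (fdot b : V -> R^o))))%N.
  by have := bnd (vbasis B); rewrite size_tuple.
elim: s => [|b s IH]; first by rewrite big_nil.
rewrite big_cons capvC; set U := (\bigcap_(j <- s) _)%VS in IH *.
have := limg_ker_dim (linfun (fdot b : V -> R^o)) U.
have : (\dim (linfun (fdot b : V -> R^o) @: U) <= 1)%N.
  by rewrite (leq_trans (dimvS (subvf _)))// dimvf.
by move: IH; rewrite /=; lia.
Qed.

Lemma orthoproj_ortho B S T : S \in B -> fdot S (T - orthoproj B T) = 0.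
Proof.
move=> SB; have TBB : T \in (B + orthov B)%VS by rewrite addv_orthov memvf.
rewrite -[X in X - _](daddv_pi_add (orthov_disjoint B) TBB) addrAC subrr add0r.
by apply: orthovP SB; exact: memv_pi.
Qed.

Definition Fproj B (x : 'cV[R]_D) : R := fnorm (orthoproj B (tpow x)) ^+ 2.

Definition power_span K (A : 'M[R]_(D, K)) : {vspace V} :=
  (<<[seq tpow (col i A) | i : 'I_K]>>)%VS.

End Tensor.

Definition gram {R : realType} (n : nat) {D K} (A : 'M[R]_(D, K)) : 'M[R]_K :=
  \matrix_(i, j) edot (col i A) (col j A) ^+ n.

Definition eps {R : realType} (n : nat) (K : nat -> nat) (D : nat) : R :=
  (K D)%:R * ln (K D)%:R ^+ n / D%:R ^+ n.

(* Main.v *)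
Require Import Defs.
From mathcomp Require Import all_boot all_order all_algebra all_fingroup.
From mathcomp Require Import all_classical all_reals all_analysis.
From mathcomp Require Import ring lra zify.

Set Implicit Arguments.
Unset Strict Implicit.
Unset Printing Implicit Defensive.

Import Order.TTheory GRing.Theory Num.Theory.
Import numFieldNormedType.Exports.

Local Open Scope classical_set_scope.
Local Open Scope ring_scope.

(**
  Write z_j = <a_j, x>, G for the Gram matrix G_n, L = log K / D, and P for the
  projection onto the span of the a_j^n.  Then P x^n = sum_j s_j a_j^n with
  G s = (z_j^n)_j.  RIP bounds the sum of z_j^2 over the indices where z_j^2
  exceeds a constant times L, while the remaining z_j^(2n) sum up to O(eps);
  together with the incoherence this gives s_j = z_j^n + O(sqrt eps) in l^2.

  Far from the a_i: let x be second-order critical at a level >= C eps + 5 Delta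
  and let |z_i| be maximal.  Testing the Hessian in the direction a_i - z_i x
  bounds z_i^2 below by an absolute constant, and testing the gradient in the
  same direction then forces 1 - z_i^2 to be small.

  Near b = +-a_i: every second-order term of F_Ahat at x other than
  -n F_Ahat(x) |d|^2 is small, so a first-order critical point of a fixed cap
  around b strictly dominates all other points of the cap.  This yields
  uniqueness and strict local maximality.  The maximum over the cap is interior,
  which yields existence, and comparing <P x^n, x^(n-1) z> with its noisy version
  for z = b - <b, x> x yields the distance bound.
*)

(** The level [C eps + 5 Delta] may itself be tiny, so nothing bounds m = max z_j^2 from below at
    the start, and errors that are merely small in absolute terms are useless. Every error in the
    Hessian test is therefore measured against mu = m^(n-1): the level forces eps <= q mu with q as
    small as [C] is large, and of the 5 Delta one is lost in passing to the noiseless F, which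
    leaves Delta <= F/4. Only when this test has produced m > 1/4 do the absolute bounds on [Delta]
    come into play. A second pass of the Hessian test gives m > 3/5. The gradient test needs this,
    because it ends in a comparison of m t with (t + delta)^2, where t = 1 - m, and that decides
    nothing unless t is safely below 1/2.

    The two regimes meet in the cap radius [r], which depends on n and [c2] alone. The part 15 delta
    of the final gap 1 - z_i^2 has to fit into a cap, and this fixes [delta0] before [cdelta] is
    known. *)

Lemma le_of_sqr_le (R : realType) (x y : R) : 0 <= y -> x ^+ 2 <= y ^+ 2 -> x <= y.
Proof.
move=> y0; case: (lerP 0 x) => [x0|/ltW x0 _]; last exact: le_trans y0.
by rewrite ler_pXn2r.
Qed.

(** * Inner products, for vectors and tensors alike *)

Record inner_product (R : realType) (V : lmodType R) (dot : V -> V -> R) : Prop :=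
  InnerProduct {
    ip_sym : forall u v, dot u v = dot v u;
    ip_lin : forall a u v w, dot (a *: u + v) w = a * dot u w + dot v w;
    ip_ge0 : forall u, 0 <= dot u u }.

Section InnerProductTheory.
Context {R : realType} {V : lmodType R} {dot : V -> V -> R}.
Hypothesis dotP : inner_product dot.
Local Notation N v := (Num.sqrt (dot v v)).

Lemma ipDl u v w : dot (u + v) w = dot u w + dot v w.
Proof. by rewrite -[u]scale1r (ip_lin dotP) scale1r mul1r. Qed.

Lemma ip0l w : dot 0 w = 0.
Proof. by apply: (addrI (dot 0 w)); rewrite -ipDl !addr0. Qed.

Lemma ipZl a u w : dot (a *: u) w = a * dot u w.
Proof. by rewrite -[a *: u]addr0 (ip_lin dotP) ip0l addr0. Qed.

Lemma ipDr u v w : dot w (u + v) = dot w u + dot w v.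
Proof. by rewrite !(ip_sym dotP w) ipDl. Qed.

Lemma ipZr a u w : dot w (a *: u) = a * dot w u.
Proof. by rewrite !(ip_sym dotP w) ipZl. Qed.

Lemma ip0r w : dot w 0 = 0. Proof. by rewrite (ip_sym dotP) ip0l. Qed.

Lemma ipNl u w : dot (- u) w = - dot u w.
Proof. by rewrite -scaleN1r ipZl mulN1r. Qed.

Lemma ipNr u w : dot w (- u) = - dot w u.
Proof. by rewrite -scaleN1r ipZr mulN1r. Qed.

Lemma ipBl u v w : dot (u - v) w = dot u w - dot v w.
Proof. by rewrite ipDl ipNl. Qed.

Lemma ipBr u v w : dot w (u - v) = dot w u - dot w v.
Proof. by rewrite ipDr ipNr. Qed.

Lemma ip_suml (I : Type) (r : seq I) (P : pred I) (F : I -> V) w :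
  dot (\sum_(i <- r | P i) F i) w = \sum_(i <- r | P i) dot (F i) w.
Proof. exact: (big_morph (dot^~ w) (fun u v => ipDl u v w) (ip0l w)). Qed.

Lemma ip_sumr (I : Type) (r : seq I) (P : pred I) (F : I -> V) w :
  dot w (\sum_(i <- r | P i) F i) = \sum_(i <- r | P i) dot w (F i).
Proof. by rewrite (ip_sym dotP) ip_suml; apply: eq_bigr => i _; apply: ip_sym. Qed.

Lemma ip_norm_sqr v : N v ^+ 2 = dot v v.
Proof. by rewrite sqr_sqrtr ?(ip_ge0 dotP). Qed.

(** The quadratic |u - t v|^2 in t is nonnegative; evaluate it at its minimiser <u,v>/<v,v>. As
    [dot] is only semidefinite, <v,v> = 0 does not give v = 0; there the quadratic is affine in t,
    so its slope must vanish. *)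
Lemma ip_cauchy u v : dot u v ^+ 2 <= dot u u * dot v v.
Proof.
have uv t : 0 <= dot u u - 2 * t * dot u v + t ^+ 2 * dot v v.
  have := ip_ge0 dotP (u - t *: v).
  by rewrite !(ipBl, ipBr, ipZl, ipZr) (ip_sym dotP v u); nra.
have [v0|vN0] := eqVneq (dot v v) 0.
  have {}uv t : 2 * t * dot u v <= dot u u.
    by have := uv t; rewrite v0 mulr0 addr0 subr_ge0.
  have [->|uvN0] := eqVneq (dot u v) 0; first by rewrite v0 mulr0 expr0n.
  have := uv ((dot u u + 1) / (2 * dot u v)).
  rewrite (_ : 2 * _ * _ = dot u u + 1); last by field.
  by rewrite gerDl ler10.
have v_gt0 : 0 < dot v v by rewrite lt_def vN0 (ip_ge0 dotP).
have := uv (dot u v / dot v v).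
rewrite (_ : _ + _ = dot u u - dot u v ^+ 2 / dot v v); last by field.
by rewrite subr_ge0 ler_pdivrMr.
Qed.

Lemma ip_cauchy_norm u v : `|dot u v| <= N u * N v.
Proof.
apply: le_of_sqr_le; first by rewrite mulr_ge0 ?sqrtr_ge0.
by rewrite exprMn !ip_norm_sqr real_normK ?num_real// ip_cauchy.
Qed.

Lemma ip_le_norm u v : dot u v <= N u * N v.
Proof. exact: le_trans (ler_norm _) (ip_cauchy_norm u v). Qed.

Lemma ip_normD u v : N (u + v) <= N u + N v.
Proof.
apply: le_of_sqr_le; first by rewrite addr_ge0 ?sqrtr_ge0.
rewrite ip_norm_sqr sqrrD !ip_norm_sqr !(ipDl, ipDr) (ip_sym dotP v u).
by have := ip_le_norm u v; rewrite -mulr_natl; lra.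
Qed.

Lemma ip_norm0 : N 0 = 0. Proof. by rewrite ip0l sqrtr0. Qed.

Lemma ip_normZ a u : N (a *: u) = `|a| * N u.
Proof. by rewrite ipZl ipZr mulrA -expr2 sqrtrM ?sqr_ge0// sqrtr_sqr. Qed.

Lemma ip_normN u : N (- u) = N u.
Proof. by rewrite ipNl ipNr opprK. Qed.

Lemma ip_norm_sum (I : Type) (r : seq I) (P : pred I) (F : I -> V) :
  N (\sum_(i <- r | P i) F i) <= \sum_(i <- r | P i) N (F i).
Proof.
apply: (big_rec2 (fun v y => N v <= y)) => [|i v y _ le_xy].
  by rewrite ip_norm0.
by rewrite (le_trans (ip_normD _ _))// lerD2l.
Qed.

End InnerProductTheory.

Lemma edot_ip (R : realType) m : inner_product (@edot R m).
Proof.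
split=> [u v|a u v w|u].
- by apply: eq_bigr => i _; rewrite mulrC.
- rewrite /edot mulr_sumr -big_split; apply: eq_bigr => i _ /=.
  by rewrite !mxE mulrDl mulrA.
- by apply: sumr_ge0 => i _; rewrite -expr2 sqr_ge0.
Qed.

Lemma edot_eq0 (R : realType) m (u : 'cV[R]_m) : edot u u = 0 -> u = 0.
Proof.
move=> /eqP; rewrite psumr_eq0 => [/allP u0|j _]; last by rewrite -expr2 sqr_ge0.
apply/colP => j; rewrite mxE; apply/eqP.
by have := u0 j (mem_index_enum j); rewrite mulf_eq0 orbb.
Qed.

Lemma fdot_ip (R : realType) D n : inner_product (@fdot R D n).
Proof.
split=> [u v|a u v w|u]; first exact: fdotC.
- rewrite fdotC linearP /= fdotC (fdotC w v) //.
- by apply: sumr_ge0 => i _; rewrite -expr2 sqr_ge0.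
Qed.

Lemma sum_cauchy (R : realType) (I : finType) (P : pred I) (f g : I -> R) :
  (\sum_(i | P i) f i * g i) ^+ 2 <=
  (\sum_(i | P i) f i ^+ 2) * (\sum_(i | P i) g i ^+ 2).
Proof.
pose h (f : I -> R) : 'cV[R]_#|I| :=
  \col_k (if P (enum_val k) then f (enum_val k) else 0).
have hE f1 g1 : edot (h f1) (h g1) = \sum_(i | P i) f1 i * g1 i.
  rewrite [RHS](reindex_onto (@enum_val _ I) enum_rank) /=; last first.
    by move=> i _; rewrite enum_rankK.
  rewrite /edot [RHS]big_mkcond; apply: eq_bigr => k _.
  by rewrite !mxE enum_valK eqxx andbT; case: ifP => // _; rewrite mul0r.
by rewrite -!hE (ip_cauchy (edot_ip R _)).
Qed.

(** * Powers of vectors on a line *)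

Section SlotTensors.
Context {R : realType} {D n : nat}.
Local Notation V := (tensor R D n).
Local Notation cV := 'cV[R]_D.

(** The elementary (rank-one) tensor with [u k] in slot k; inner products of such tensors factor
    over the slots. *)
Definition slot_tensor (u : 'I_n -> cV) : V := 
  [ffun i : {ffun 'I_n -> 'I_D} => \prod_k u k (i k) 0].

Lemma fdot_slot u v : fdot (slot_tensor u) (slot_tensor v) = \prod_k edot (u k) (v k).
Proof.
rewrite /fdot /edot bigA_distr_bigA /=; apply: eq_bigr => i _.
by rewrite !ffunE -big_split.
Qed.

Lemma tpow_slot (x : cV) : tpow x = slot_tensor (fun=> x).
Proof. by apply/ffunP => i; rewrite !ffunE. Qed.

(* The coefficient of t^k in (x + t d)^{(x) n}. *)
Definition tmix (k : nat) (x d : cV) : V :=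
  \sum_(B : {set 'I_n} | #|B| == k) slot_tensor (fun j => if j \in B then d else x).

(** A binomial theorem for tensor powers: distributing the product chooses the set of slots taken by
    [d], and these sets are grouped by cardinality. *)
Lemma tpow_line (x d : cV) (t : R) :
  tpow (x + t *: d) = \sum_(k < n.+1) t ^+ k *: tmix k x d.
Proof.
apply/ffunP => i; rewrite ffunE sum_ffunE.
under eq_bigr do rewrite !mxE addrC.
rewrite bigA_distr /= (partition_big (fun B : {set 'I_n} => inord #|B| : 'I_n.+1) predT) //=.
apply: eq_bigr => k _; rewrite !ffunE sum_ffunE scaler_sumr.
apply: eq_big => [B|B /eqP <-].
  by rewrite -val_eqE /= inordK // ltnS -[X in (_ <= X)%N]card_ord max_card.
rewrite ffunE inordK; last by rewrite ltnS -[X in (_ <= X)%N]card_ord max_card.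
rewrite (bigID (fun j => j \in B)) /= /GRing.scale /=.
rewrite [in RHS](bigID (fun j => j \in B)) /= mulrA; congr (_ * _).
- by rewrite -prodr_const -big_split; apply: eq_bigr => j jB /=; rewrite jB.
- by apply: eq_bigr => j /negbTE ->.
Qed.

Lemma card_subsets_ord k : #|[pred B : {set 'I_n} | #|B| == k]| = 'C(n, k).
Proof.
by rewrite -[in RHS](card_ord n) -card_draws; apply: eq_card => B; rewrite !inE.
Qed.

Lemma card_notin_ord (B : {set 'I_n}) : #|[pred j | j \notin B]| = (n - #|B|)%N.
Proof.
have -> : #|[pred j | j \notin B]| = #|~: B|.
  by apply: eq_card => j; rewrite !inE.
by have := cardsC B; rewrite card_ord => Bn; lia.
Qed.

Lemma fdot_slot_mix (a x d : cV) (B : {set 'I_n}) :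
  fdot (tpow a) (slot_tensor (fun j => if j \in B then d else x)) =
  edot a x ^+ (n - #|B|) * edot a d ^+ #|B|.
Proof.
rewrite tpow_slot fdot_slot (bigID (fun j => j \in B)) /= mulrC; congr (_ * _).
  rewrite (eq_bigr (fun=> edot a x)) => [|j /negbTE -> //].
  by rewrite prodr_const card_notin_ord.
by rewrite -prodr_const; apply: eq_bigr => j ->.
Qed.

Lemma fdot_tpow_mix (a x d : cV) k :
  fdot (tpow a) (tmix k x d) = 'C(n, k)%:R * (edot a x ^+ (n - k) * edot a d ^+ k).
Proof.
rewrite (ip_sumr (fdot_ip R D n)).
rewrite (eq_bigr (fun=> edot a x ^+ (n - k) * edot a d ^+ k)).
  by rewrite sumr_const card_subsets_ord mulr_natl.
by move=> B /eqP <-; apply: fdot_slot_mix.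
Qed.

Lemma fnorm_slot_mix (x d : cV) (B : {set 'I_n}) :
  fnorm (slot_tensor (fun j => if j \in B then d else x)) =
  enorm x ^+ (n - #|B|) * enorm d ^+ #|B|.
Proof.
rewrite /fnorm /enorm fdot_slot -[LHS]ger0_norm ?sqrtr_ge0//.
rewrite (bigID (fun j => j \in B)) /= mulrC.
rewrite (eq_bigr (fun=> edot x x)) => [|j /negbTE -> //].
rewrite (eq_bigr (fun=> edot d d) (P := fun j => j \in B)) => [|j -> //].
rewrite !prodr_const card_notin_ord.
have xx0 := ip_ge0 (edot_ip R D).
rewrite sqrtrM ?exprn_ge0// ger0_norm ?mulr_ge0 ?sqrtr_ge0//.
have sqrtX (a : R) k : 0 <= a -> Num.sqrt (a ^+ k) = Num.sqrt a ^+ k.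
  by move=> a0; elim: k => [|k IH]; rewrite ?sqrtr1 // !exprS sqrtrM // IH.
by rewrite !sqrtX.
Qed.

Lemma fnorm_tmix (x d : cV) k :
  fnorm (tmix k x d) <= 'C(n, k)%:R * (enorm x ^+ (n - k) * enorm d ^+ k).
Proof.
rewrite (le_trans (ip_norm_sum (fdot_ip R D n) _ _ _))//.
rewrite (eq_bigr (fun=> enorm x ^+ (n - k) * enorm d ^+ k)).
  by rewrite sumr_const card_subsets_ord mulr_natl.
by move=> B /eqP <-; apply: fnorm_slot_mix.
Qed.

Lemma fdot_tpow (x y : cV) : fdot (tpow x : V) (tpow y) = edot x y ^+ n.
Proof. by rewrite !tpow_slot fdot_slot prodr_const card_ord. Qed.

Lemma tmix0 (x d : cV) : tmix 0 x d = tpow x :> V.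
Proof.
rewrite /tmix (big_pred1 finset.set0) => [|B]; last by rewrite /= cards_eq0.
by apply/ffunP => i; rewrite !ffunE; apply: eq_bigr => j _; rewrite finset.in_set0.
Qed.

Lemma tmix1E (x d : cV) :
  tmix 1 x d = \sum_(j < n) slot_tensor (fun l => if l == j then d else x).
Proof.
rewrite /tmix big_cards1.
apply: eq_bigr => j _.
by apply/ffunP => i; rewrite !ffunE; apply: eq_bigr => l _; rewrite finset.in_set1.
Qed.

Lemma slot_tensor_lin (u : 'I_n -> cV) j a v w :
  slot_tensor (fun l => if l == j then a *: v + w else u l) =
  a *: slot_tensor (fun l => if l == j then v else u l) +
       slot_tensor (fun l => if l == j then w else u l).
Proof.
apply/ffunP => i; rewrite !ffunE.
have E z : \prod_k (if k == j then z else u k) (i k) 0 =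
    z (i j) 0 * \prod_(k | k != j) u k (i k) 0.
  rewrite (bigD1 j) //= eqxx; congr (_ * _).
  by apply: eq_bigr => k /negbTE ->.
by rewrite !E !mxE mulrDl -mulrA.
Qed.

Lemma tmix1_lin (x : cV) a v w : tmix 1 x (a *: v + w) = a *: tmix 1 x v + tmix 1 x w.
Proof.
rewrite !tmix1E scaler_sumr -big_split; apply: eq_bigr => j _.
exact: slot_tensor_lin.
Qed.

(** Euler's identity for a map homogeneous of degree n. *)
Lemma tmix1_self (x : cV) : tmix 1 x x = n%:R *: tpow x.
Proof.
rewrite tmix1E (eq_bigr (fun=> tpow x)) => [|j _].
  by rewrite sumr_const card_ord scaler_nat.
by rewrite tpow_slot; apply/ffunP => i; rewrite !ffunE; apply: eq_bigr => l _; case: eqP.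
Qed.

End SlotTensors.

(** * Projections onto spans of powers *)

(** A real [sup] says something only about a set bounded above, so some bound [M] has to be supplied
    first; any will do. Homogeneity then carries the estimate from the unit ball to all vectors. *)
Lemma le_sup_unit_ball (R : realType) (V : lmodType R) (dot : V -> V -> R)
    (dotP : inner_product dot) (g : V -> R) (M : R) :
  (forall a v, g (a *: v) = `|a| * g v) ->
  (forall v, g v <= M * Num.sqrt (dot v v)) ->
  forall v, g v <= sup [set g v | v in [set v | Num.sqrt (dot v v) <= 1]] *
                   Num.sqrt (dot v v).
Proof.
move=> gZ gM v; set N := Num.sqrt (dot v v).
have [N0|NN0] := eqVneq N 0; first by have := gM v; rewrite -/N N0 !mulr0.
have N_gt0 : 0 < N by rewrite lt_def NN0 sqrtr_ge0.
have iN0 : 0 <= N^-1 by rewrite invr_ge0 ltW.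
rewrite -ler_pdivrMr// mulrC -[X in X * _]ger0_norm// -gZ.
apply: ub_le_sup.
  exists `|M| => _ [w /= w1 <-]; rewrite (le_trans (gM w))//.
  rewrite (le_trans (ler_wpM2r (sqrtr_ge0 _) (ler_norm M)))//.
  by rewrite ler_piMr.
exists (N^-1 *: v) => //=.
by rewrite (ip_normZ dotP) ger0_norm// mulVf.
Qed.

Lemma enorm_le_specnorm (R : realType) p q (M : 'M[R]_(p, q)) (v : 'cV_q) :
  enorm (M *m v) <= specnorm M * enorm v.
Proof.
apply: (le_sup_unit_ball (edot_ip R q) (M := \sum_j enorm (col j M))) => [a w|w].
  by rewrite -scalemxAr /enorm (ip_normZ (edot_ip R p)).
have -> : M *m w = \sum_j w j 0 *: col j M.
  apply/colP => i; rewrite !mxE summxE; apply: eq_bigr => j _.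
  by rewrite !mxE mulrC.
rewrite (le_trans (ip_norm_sum (edot_ip R p) _ _ _))// mulr_suml.
apply: ler_sum => j _; rewrite (ip_normZ (edot_ip R p)) mulrC.
rewrite ler_wpM2l ?sqrtr_ge0//; apply: le_of_sqr_le; rewrite ?sqrtr_ge0//.
rewrite real_normK ?num_real// (ip_norm_sqr (edot_ip R q)) /edot (bigD1 j)//= -expr2.
by rewrite lerDl sumr_ge0// => i _; rewrite -expr2 sqr_ge0.
Qed.

Section Projections.
Context {R : realType} {D n : nat}.
Local Notation V := (tensor R D n).
Local Notation ip := (fdot_ip R D n).
Implicit Types (S T : V) (B : {vspace V}).

Definition delta_tensor (i : {ffun 'I_n -> 'I_D}) : V := [ffun j => (j == i)%:R].

Lemma tensor_sum_delta S : S = \sum_i S i *: delta_tensor i.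
Proof.
apply/ffunP => i; rewrite sum_ffunE (bigD1 i)//= !ffunE eqxx big1 => [|j ji].
  by rewrite /GRing.scale /= mulr1 addr0.
by rewrite !ffunE eq_sym (negbTE ji) /GRing.scale /= mulr0.
Qed.

Lemma fnorm_le_opnorm (L : 'End(V)) T : fnorm (L T) <= opnorm L * fnorm T.
Proof.
pose e : {ffun 'I_n -> 'I_D} -> V := delta_tensor.
apply: (le_sup_unit_ball ip (g := fun T => fnorm (L T))
   (M := \sum_i fnorm (L (e i)))) => [a S|S].
  by rewrite linearZ /fnorm (ip_normZ ip).
rewrite [in leLHS](tensor_sum_delta S) linear_sum (le_trans (ip_norm_sum ip _ _ _))// mulr_suml.
apply: ler_sum => i _; rewrite linearZ (ip_normZ ip) mulrC.
rewrite ler_wpM2l ?sqrtr_ge0//; apply: le_of_sqr_le; rewrite ?sqrtr_ge0//.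
rewrite real_normK ?num_real// (ip_norm_sqr ip) /fdot (bigD1 i)//= -expr2.
by rewrite lerDl sumr_ge0// => j _; rewrite -expr2 sqr_ge0.
Qed.

Lemma orthoprojZ B a T : orthoproj B (a *: T) = a *: orthoproj B T.
Proof. exact: linearZ. Qed.

Lemma orthoprojB B S T : orthoproj B (S - T) = orthoproj B S - orthoproj B T.
Proof. exact: linearB. Qed.

Lemma orthoprojD B S T : orthoproj B (S + T) = orthoproj B S + orthoproj B T.
Proof. exact: linearD. Qed.

Lemma orthoproj_sum B (I : Type) (r : seq I) (Q : pred I) (E : I -> V) :
  orthoproj B (\sum_(i <- r | Q i) E i) = \sum_(i <- r | Q i) orthoproj B (E i).
Proof. exact: linear_sum. Qed.

Lemma fdot_proj B S T : fdot (orthoproj B S) T = fdot (orthoproj B S) (orthoproj B T).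
Proof.
apply/eqP; rewrite -subr_eq0 -(ipBr ip); apply/eqP.
exact/orthoproj_ortho/orthoproj_mem.
Qed.

Lemma fdot_projC B S T : fdot (orthoproj B S) T = fdot S (orthoproj B T).
Proof. by rewrite fdot_proj [RHS]fdotC [RHS]fdot_proj fdotC. Qed.

Lemma orthoproj_id B T : T \in B -> orthoproj B T = T.
Proof.
move=> TB; apply/esym/eqP; rewrite -subr_eq0; apply/eqP/fdot_eq0.
by apply: (@orthoproj_ortho _ _ _ B); rewrite memvB ?orthoproj_mem.
Qed.

Lemma orthoproj_le B T :
  fdot (orthoproj B T) (orthoproj B T) <= fdot T T.
Proof.
have := ip_ge0 ip (T - orthoproj B T).
by rewrite !(ipBl ip, ipBr ip) -(fdotC T) !(fdotC T) fdot_proj; lra.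
Qed.

Lemma fnorm_proj_le B T : fnorm (orthoproj B T) <= fnorm T.
Proof. by rewrite ler_wsqrtr// orthoproj_le. Qed.

Lemma FprojE B x : Fproj B x = fdot (orthoproj B (tpow x)) (tpow x).
Proof. by rewrite /Fproj (ip_norm_sqr ip) -fdot_proj. Qed.

End Projections.

Section PowerSpan.
Context {R : realType} {D n K : nat} (A : 'M[R]_(D, K)) (c2 : R).
Local Notation V := (tensor R D n).
Local Notation ip := (fdot_ip R D n).
Hypothesis Gunit : gram n A \in unitmx.
Hypothesis Gc2 : specnorm (invmx (gram n A)) <= c2.
Local Notation P := (orthoproj (power_span A : {vspace V})).

Lemma power_mem i : (tpow (col i A) : V) \in power_span A.
Proof. by apply/memv_span/map_f; rewrite mem_enum. Qed.

(** Testing P T against the generators a_j^n gives the linear system G s = w with w_j = <a_j^n, T>;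
    inverting G bounds s by [c2] times w in l^2. *)
Lemma power_span_coord (T : V) : exists s : 'I_K -> R,
  [/\ P T = \sum_j s j *: tpow (col j A),
      forall j, \sum_k s k * edot (col j A) (col k A) ^+ n = fdot (tpow (col j A)) T &
      \sum_j s j ^+ 2 <= c2 ^+ 2 * \sum_j fdot (tpow (col j A)) T ^+ 2].
Proof.
have PT := orthoproj_mem (power_span A) T.
have [s Ps] : exists s : 'I_K -> R, P T = \sum_j s j *: tpow (col j A).
  pose X := [tuple of [seq (tpow (col i A) : V) | i <- ord_tuple K]].
  have XE : (<<X>>)%VS = power_span A.
    by congr (<<_>>)%VS; rewrite /X /=; apply: eq_map.
  move: PT; rewrite -XE => /coord_span ->.
  exists (fun j => coord X j (P T)); apply: eq_bigr => j _; congr (_ *: _).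
  by rewrite -tnth_nth tnth_map tnth_ord_tuple.
have Gs j : \sum_k s k * edot (col j A) (col k A) ^+ n = fdot (tpow (col j A)) T.
  rewrite -[in RHS](orthoproj_id (power_mem j)) fdot_projC Ps (ip_sumr ip).
  by apply: eq_bigr => k _; rewrite (ipZr ip) fdot_tpow.
exists s; split=> //.
pose sv : 'cV[R]_K := \col_j s j; pose w : 'cV[R]_K := \col_j fdot (tpow (col j A)) T.
have Gsw : gram n A *m sv = w.
  by apply/colP => j; rewrite !mxE -Gs; apply: eq_bigr => k _; rewrite !mxE mulrC.
have := enorm_le_specnorm (invmx (gram n A)) w.
rewrite -Gsw mulKmx // Gsw => /le_trans/(_ (ler_wpM2r (sqrtr_ge0 _) Gc2)) le_sw.
have c20 : 0 <= c2 * enorm w by exact: le_trans (sqrtr_ge0 _) le_sw.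
have : enorm sv ^+ 2 <= (c2 * enorm w) ^+ 2 by rewrite ler_pXn2r ?nnegrE ?sqrtr_ge0.
rewrite exprMn !(ip_norm_sqr (edot_ip R K)) /edot.
by under eq_bigr do rewrite !mxE -expr2; under [in leRHS]eq_bigr do rewrite !mxE -expr2.
Qed.

(** |P T|^2 equals <s, w>, so Cauchy-Schwarz and the bound on s give [c2] to the first power only.
    This is why sqrt c2 appears in the radius of the caps. *)
Lemma proj_power_span_le (T : V) : 0 <= c2 ->
  fdot (P T) (P T) <= c2 * \sum_j fdot (tpow (col j A)) T ^+ 2.
Proof.
move=> c20; have [s [Ps _ sw]] := power_span_coord T.
have PT : fdot (P T) (P T) = \sum_j s j * fdot (tpow (col j A)) T.
  by rewrite -fdot_proj Ps (ip_suml ip); apply: eq_bigr => j _; rewrite (ipZl ip).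
have W0 : 0 <= \sum_j fdot (tpow (col j A)) T ^+ 2.
  by rewrite sumr_ge0// => j _; rewrite sqr_ge0.
apply: le_of_sqr_le; first by rewrite mulr_ge0.
rewrite PT (le_trans (sum_cauchy _ _ _))//.
by rewrite exprMn [in leRHS]expr2 mulrA ler_wpM2r.
Qed.

End PowerSpan.

(** * First and second derivatives of F on the sphere *)

Section PolynomialsOnLines.
Context {R : realType}.

Lemma ge0_of_linear_ge0 (e q a : R) :
  0 < e -> (forall t, 0 < t <= e -> 0 <= q + a * t) -> 0 <= q.
Proof.
move=> e0 qa; rewrite leNgt; apply/negP => q0.
have a1 : 0 < `|a| + 1 by rewrite ltr_pwDr.
have t0 : 0 < - q / (2 * (`|a| + 1)) by rewrite divr_gt0 ?oppr_gt0// mulr_gt0.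
set t := Num.min e (- q / (2 * (`|a| + 1))).
have tp : 0 < t by rewrite lt_min e0.
have := qa t; rewrite tp ge_min lexx => /(_ isT).
have : t <= - q / (2 * (`|a| + 1)) by rewrite ge_min lexx orbT.
rewrite ler_pdivlMr ?mulr_gt0// => tq.
have := ler_wpM2r (ltW tp) (ler_norm a).
by have := mulr_ge0 (normr_ge0 a) (ltW tp); nra.
Qed.

(** Dividing by t and letting t tend to 0 from both sides kills the linear coefficient; dividing by
    t^2 then gives the sign of the quadratic one. The higher terms are at most M |t|^3 in absolute
    value for |t| <= 1. *)
Lemma poly_local_min_coef (Q : {poly R}) (e : R) :
  0 < e -> Q`_0 = 0 -> (forall t, `|t| <= e -> 0 <= Q.[t]) ->
  Q`_1 = 0 /\ 0 <= Q`_2.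
Proof.
move=> e0 Q0 Qge0.
pose r := drop_poly 3 Q.
have QE t : Q.[t] = Q`_1 * t + Q`_2 * t ^+ 2 + r.[t] * t ^+ 3.
  rewrite -[in LHS](poly_take_drop 3 Q) hornerD hornerM hornerXn.
  rewrite /take_poly horner_poly !big_ord_recr big_ord0 /= Q0; ring.
pose M := \sum_(i < size r) `|r`_i|.
have rM t : `|t| <= 1 -> `|r.[t]| <= M.
  move=> t1; rewrite horner_coef (le_trans (ler_norm_sum _ _ _))//.
  apply: ler_sum => i _; rewrite normrM normrX ler_piMr//.
  by rewrite exprn_ile1.
pose e1 := Num.min e 1.
have e1_gt0 : 0 < e1 by rewrite lt_min e0 ltr01.
have M0 : 0 <= M by rewrite sumr_ge0.
have small t : 0 < t <= e1 -> [/\ 0 <= Q`_1 + (`|Q`_2| + M) * t,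
    0 <= - Q`_1 + (`|Q`_2| + M) * t & 0 <= Q.[t] /\ r.[t] <= M].
  move=> /andP[t0]; rewrite le_min => /andP[te t1].
  have tn : `|t| = t by rewrite ger0_norm// ltW.
  have := Qge0 t; rewrite tn => /(_ te) Qt.
  have := Qge0 (- t); rewrite normrN tn => /(_ te) QNt.
  have rt : r.[t] <= M by rewrite (le_trans (ler_norm _))// rM ?tn.
  have rNt : - r.[- t] <= M.
    by rewrite (le_trans _ (rM (- t) _)) ?normrN ?tn// -normrN ler_norm.
  move: (Qt) (QNt); rewrite !QE => Qt' QNt'.
  have Q2n := ler_norm Q`_2.
  have t2 : 0 < t ^+ 2 by rewrite exprn_gt0.
  have key c s : 0 <= c * t + Q`_2 * t ^+ 2 + s * t ^+ 3 -> s <= M ->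
      0 <= c + (`|Q`_2| + M) * t.
    move=> h sM; rewrite -(pmulr_lge0 _ t0).
    apply: (le_trans h); rewrite -subr_ge0.
    have -> : (c + (`|Q`_2| + M) * t) * t - (c * t + Q`_2 * t ^+ 2 + s * t ^+ 3)
       = ((`|Q`_2| - Q`_2) + (M - s * t)) * t ^+ 2 by ring.
    apply: mulr_ge0; last exact: ltW.
    apply: addr_ge0; first by rewrite subr_ge0.
    rewrite subr_ge0; have [s0|s0] := lerP 0 s.
      by apply: le_trans sM; rewrite ler_piMr.
    by rewrite (le_trans _ M0)// nmulr_rle0// ltW.
  split=> //; first exact: key Qt' rt.
  apply: key rNt; move: QNt'; rewrite sqrrN exprNn; lra.
have Q1 : Q`_1 = 0.
  apply/eqP; rewrite eq_le -oppr_ge0; apply/andP; split.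
    by apply: (ge0_of_linear_ge0 (a := `|Q`_2| + M) e1_gt0) => t /small[].
  by apply: (ge0_of_linear_ge0 (a := `|Q`_2| + M) e1_gt0) => t /small[].
split=> //; apply: (ge0_of_linear_ge0 (a := M) e1_gt0) => t tE.
have [_ _ []] := small t tE; rewrite QE Q1 mul0r add0r => h rt.
have {tE}/andP[t0 _] := tE.
rewrite -(pmulr_lge0 _ (exprn_gt0 2 t0)) (le_trans h)// mulrDl -mulrA -exprS.
by rewrite lerD2l ler_wpM2r// exprn_ge0// ltW.
Qed.

Lemma coef_line_norm (c : R) n :
  let p := (1 + c *: 'X^2) ^+ n : {poly R} in
  [/\ p`_0 = 1, p`_1 = 0 & p`_2 = n%:R * c].
Proof.
elim: n => [|n [IH0 IH1 IH2]] /=; first by rewrite expr0 !coef1 mul0r.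
rewrite exprS mulrDl mul1r -scalerAl mulrC !coefD !coefZ !coefMXn /= IH0 IH1 IH2.
by split; [ring | ring | rewrite -natr1; ring].
Qed.

Variables (V : normedModType R).

(** Along the line the difference quotients of f are literally those of p, so both existence and
    value of the derivative come from the polynomial. *)
Lemma derive_on_line (f : V -> R) (x v : V) (p : {poly R}) (h : R) :
  (forall t, f (x + t *: v) = p.[t]) ->
  derivable f (x + h *: v) v /\ 'D_v f (x + h *: v) = p^`().[h].
Proof.
move=> fp.
have E : (fun s : R => s^-1 *: (f (s *: v + (x + h *: v)) - f (x + h *: v))) =
         (fun s : R => s^-1 *: (p.[s *: 1 + h] - p.[h])).
  apply/funext => s; rewrite addrCA -scalerDl !fp.
  by rewrite /GRing.scale /= mulr1.
have [dp ep] := is_derive_poly p h.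
by split; [rewrite /derivable E; exact: dp | rewrite /derive E; exact: ep].
Qed.

Lemma derive_on_line0 (f : V -> R) (x v : V) (p : {poly R}) :
  (forall t, f (x + t *: v) = p.[t]) ->
  derivable f x v /\ 'D_v f x = p`_1.
Proof.
move=> fp; have := derive_on_line 0 fp.
by rewrite scale0r addr0 horner_coef0 coef_deriv mulr1n.
Qed.

End PolynomialsOnLines.

(** The closure properties of this class show that the Riemannian gradient is polynomial along lines
    without its polynomial being written down, which settles differentiability. *)
Definition polyfun (R : realType) (f : R -> R) := exists p : {poly R}, forall t, f t = p.[t].

Section PolyFun.
Context {R : realType}.
Implicit Types f g : R -> R.

Lemma polyfun_cst (c : R) : polyfun (fun=> c).
Proof. by exists c%:P => t; rewrite hornerC. Qed.

Lemma polyfun_id : polyfun (@id R).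
Proof. by exists 'X => t; rewrite hornerX. Qed.

Lemma polyfunD f g : polyfun f -> polyfun g -> polyfun (fun t => f t + g t).
Proof. by move=> [p fp] [q gq]; exists (p + q) => t; rewrite hornerD fp gq. Qed.

Lemma polyfunM f g : polyfun f -> polyfun g -> polyfun (fun t => f t * g t).
Proof. by move=> [p fp] [q gq]; exists (p * q) => t; rewrite hornerM fp gq. Qed.

Lemma polyfun_sum (I : Type) (r : seq I) (P : pred I) (F : I -> R -> R) :
  (forall i, polyfun (F i)) -> polyfun (fun t => \sum_(i <- r | P i) F i t).
Proof.
move=> /choice[p Fp]; exists (\sum_(i <- r | P i) p i) => t.
by rewrite horner_sum; apply: eq_bigr.
Qed.

Lemma polyfun_prod (I : Type) (r : seq I) (P : pred I) (F : I -> R -> R) :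
  (forall i, polyfun (F i)) -> polyfun (fun t => \prod_(i <- r | P i) F i t).
Proof.
move=> /choice[p Fp]; exists (\prod_(i <- r | P i) p i) => t.
by rewrite horner_prod; apply: eq_bigr.
Qed.

Lemma polyfunX f k : polyfun f -> polyfun (fun t => f t ^+ k).
Proof. by move=> [p fp]; exists (p ^+ k) => t; rewrite horner_exp fp. Qed.

End PolyFun.

Section SecondOrder.
Context {R : realType} {D n : nat} (B : {vspace tensor R D n}).
Local Notation V := (tensor R D n).
Local Notation cV := 'cV[R]_D.
Local Notation ip := (fdot_ip R D n).
Local Notation eip := (edot_ip R D).
Local Notation P := (orthoproj B).
Local Notation F := (Fproj B).
Implicit Types x y z v : cV.

Definition grad_form x v : R := 2 * fdot (P (tpow x)) (tmix 1 x v).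

(** Half of the second derivative of F in direction [z]: the coefficient of t^2 in F(x + t z). *)
Definition hess_form x z : R :=
  2 * fdot (P (tpow x)) (tmix 2 x z) + fdot (P (tmix 1 x z)) (P (tmix 1 x z)).

Lemma Fproj_line x v : exists p : {poly R},
  [/\ forall t, F (x + t *: v) = p.[t], p`_0 = F x, p`_1 = grad_form x v &
      p`_2 = hess_form x v].
Proof.
pose c k l : R := fdot (P (tmix k x v)) (tmix l x v).
have cC k l : c k l = c l k by rewrite /c fdot_projC fdotC.
pose p : {poly R} := \sum_(k < n.+1) \sum_(l < n.+1) c k l *: 'X^(k + l).
have tmix_big k : (n < k)%N -> tmix k x v = 0 :> V.
  move=> nk; rewrite /tmix big_pred0 // => A; apply/negbTE.
  by rewrite neq_ltn (leq_ltn_trans _ nk) // -[X in (_ <= X)%N]card_ord max_card.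
have c_big k l : (n < l)%N -> c k l = 0.
  by move=> nl; rewrite /c (tmix_big l) // (ip0r ip).
have pcoef m : p`_m = \sum_(k < m.+1) c k (m - k)%N.
  rewrite /p coef_sum.
  under eq_bigr => k _ do rewrite coef_sum.
  rewrite (eq_bigr (fun k : 'I_n.+1 => if (k < m.+1)%N then c k (m - k)%N else 0)).
    rewrite -big_mkcond /=.
    have [mn|nm] := leqP m n.
      by rewrite (big_ord_widen_cond n.+1 predT (fun k => c k (m - k)%N)) //= ltnS.
    rewrite [RHS](bigID (fun k : 'I_m.+1 => (k < n.+1)%N)) /= [X in _ = _ + X]big1.
      rewrite addr0 -(big_ord_widen_cond m.+1 predT (fun k => c k (m - k)%N)) ?ltnS 1?ltnW //.
      by apply: eq_bigl => k; rewrite (ltn_trans (ltn_ord k)) // !ltnS ltnW.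
    by move=> k; rewrite -leqNgt => nk; rewrite cC c_big.
  move=> k _; case: ltnP => [km|mk].
    under eq_bigr => l _ do rewrite coefZ coefXn.
    have [mkn|nmk] := leqP (m - k)%N n.
      rewrite (bigD1 (Ordinal (mkn : (m - k < n.+1)%N))) //= subnKC // eqxx mulr1.
      rewrite big1 ?addr0 // => l lmk; case: eqP => [ml|]; last by rewrite mulr0.
      by case/eqP: lmk; apply: val_inj => /=; rewrite ml addKn.
    rewrite c_big // big1 // => l _; case: eqP => [ml|]; last by rewrite mulr0.
    by move: nmk; rewrite ml addKn ltnNge -ltnS ltn_ord.
  apply: big1 => l _; rewrite coefZ coefXn; case: eqP => [ml|]; last by rewrite mulr0.
  by move: mk; rewrite ml; lia.
exists p; split.
- move=> t; rewrite FprojE tpow_line orthoproj_sum /p horner_sum (ip_suml ip).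
  apply: eq_bigr => k _; rewrite (ip_sumr ip) horner_sum; apply: eq_bigr => l _.
  by rewrite orthoprojZ (ipZl ip) (ipZr ip) hornerZ hornerXn exprD /c; ring.
- by rewrite pcoef big_ord1 /c !tmix0 FprojE.
- rewrite pcoef !big_ord_recl big_ord0 /= addr0 [c (bump 0 0) _]cC /c.
  by rewrite subn0 !tmix0 /grad_form /bump /=; ring.
- rewrite pcoef !big_ord_recl big_ord0 /= addr0 /bump /= !addn0 !add1n !subn0 subnn.
  by rewrite [c 2 _]cC /c !tmix0 subSS subn0 /hess_form -[fdot (P (tmix 1 x v)) (P _)]fdot_proj; ring.
Qed.

Lemma derive_Fproj x v : 'D_v F x = grad_form x v.
Proof.
by have [p [Fp _ <- _]] := Fproj_line x v; have [] := derive_on_line0 Fp.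
Qed.

Lemma grad_form_lin x a v w :
  grad_form x (a *: v + w) = a * grad_form x v + grad_form x w.
Proof. by rewrite /grad_form tmix1_lin (ipDr ip) (ipZr ip); ring. Qed.

Lemma grad_form0 x : grad_form x 0 = 0.
Proof.
by have := grad_form_lin x 1 0 0; rewrite scale1r addr0 mul1r; lra.
Qed.

Lemma grad_form_self x : grad_form x x = 2 * n%:R * F x.
Proof. by rewrite /grad_form tmix1_self (ipZr ip) FprojE mulrA. Qed.

Lemma grad_form_coord x v : grad_form x v = \sum_i v i 0 * grad_form x (delta_mx i 0).
Proof.
have {1}-> : v = \sum_i v i 0 *: (delta_mx i 0 : cV).
  by rewrite [LHS]matrix_sum_delta; apply: eq_bigr => i _; rewrite big_ord1.
apply: (big_rec2 (fun u s => grad_form x u = s)) => [|i u s _ <-].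
  exact: grad_form0.
exact: grad_form_lin.
Qed.

Lemma rgrad_coord x i :
  rgrad F x i 0 = grad_form x (delta_mx i 0) - 2 * n%:R * F x * x i 0.
Proof.
rewrite /rgrad /tproj !mxE derive_Fproj; congr (_ - _ * _).
rewrite -grad_form_self [RHS]grad_form_coord; apply: eq_bigr => j _.
by rewrite mxE derive_Fproj.
Qed.

Lemma edot_rgrad x z : edot z (rgrad F x) = grad_form x z - 2 * n%:R * F x * edot z x.
Proof.
rewrite [grad_form x z]grad_form_coord /edot mulr_sumr -sumrB.
by apply: eq_bigr => i _; rewrite rgrad_coord; ring.
Qed.

Lemma polyfun_rgrad x z i : polyfun (fun t => rgrad F (x + t *: z) i 0).
Proof.
have px j : polyfun (fun t => (x + t *: z) j 0).
  have [p pE] : polyfun (fun t : R => x j 0 + t * z j 0).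
    apply: polyfunD; first exact: polyfun_cst.
    by apply: polyfunM; [exact: polyfun_id | exact: polyfun_cst].
  by exists p => t; rewrite -pE !mxE.
have pF : polyfun (fun t => F (x + t *: z)).
  by have [p [Fp _ _ _]] := Fproj_line x z; exists p.
have pmix I : polyfun (fun t => (tmix 1 (x + t *: z) (delta_mx i 0) : V) I).
  have [p pE] : polyfun (fun t => \sum_(j < n) \prod_(l < n)
      (if l == j then delta_mx i 0 else x + t *: z : cV) (I l) 0).
    apply: polyfun_sum => j; apply: polyfun_prod => l.
    by case: (l == j) => //; apply: polyfun_cst.
  exists p => t; rewrite -pE tmix1E sum_ffunE; apply: eq_bigr => j _.
  by rewrite ffunE.
have pdot S : polyfun (fun t => fdot S (tmix 1 (x + t *: z) (delta_mx i 0) : V)).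
  by apply: polyfun_sum => I; apply: polyfunM => //; apply: polyfun_cst.
have [p pE] : polyfun (fun t => (\sum_(k < n.+1) t ^+ k *
      fdot (P (tmix k x z)) (tmix 1 (x + t *: z) (delta_mx i 0))) * 2
     + (-1) * (2 * n%:R * F (x + t *: z) * (x + t *: z) i 0)).
  apply: polyfunD; apply: polyfunM.
  - by apply: polyfun_sum => k; apply: polyfunM => //; apply/polyfunX/polyfun_id.
  - exact: polyfun_cst.
  - exact: polyfun_cst.
  - by apply: polyfunM => //; apply: polyfunM => //; apply: polyfun_cst.
exists p => t; rewrite -pE rgrad_coord mulN1r /grad_form mulrC; congr (_ * _ - _).
rewrite tpow_line orthoproj_sum (ip_suml ip); apply: eq_bigr => k _.
by rewrite orthoprojZ (ipZl ip).
Qed.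

(** The function <z, rgrad F(x + t z)> of t is a polynomial. It is written once through q(t) = F(x +
    t z), as q' - 2 n |z|^2 t q, and once through the coordinates of the gradient field; comparing
    the coefficients of t gives the Hessian. *)
Lemma edot_rhess x z : edot x z = 0 ->
  edot z (rhess F x z) = 2 * (hess_form x z - n%:R * F x * edot z z).
Proof.
move=> xz.
rewrite /rhess /tproj (ipBr eip) (ipZr eip) (ip_sym eip z x) xz mulr0 subr0.
have /choice[p pE] := polyfun_rgrad x z.
have dr i := @derive_on_line0 _ _ (fun y => rgrad F y i 0) x z (p i) (pE i).
have Dr : derivable (rgrad F) x z.
  by apply/derivable_mxP => i j; rewrite ord1; case: (dr i).
rewrite (derive_mx Dr) /edot.
under eq_bigr => i _ do rewrite !mxE (dr i).2.
have [q [Fq q0 q1 q2]] := Fproj_line x z.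
have Q t : edot z (rgrad F (x + t *: z)) =
    (q^`() - (2 * n%:R * edot z z) *: ('X * q)).[t].
  rewrite edot_rgrad -derive_Fproj (derive_on_line t Fq).2 Fq.
  rewrite (ipDr eip) (ipZr eip) (ip_sym eip z x) xz add0r.
  by rewrite !hornerE /=; ring.
have S t : edot z (rgrad F (x + t *: z)) = (\sum_i z i 0 *: p i).[t].
  by rewrite horner_sum; apply: eq_bigr => i _; rewrite hornerZ -pE.
have := (@derive_on_line0 _ _ (fun y => edot z (rgrad F y)) x z _ S).2.
rewrite (@derive_on_line0 _ _ (fun y => edot z (rgrad F y)) x z _ Q).2.
have -> : \sum_i z i 0 * (p i)`_1 = (\sum_i z i 0 *: p i)`_1.
  by rewrite coef_sum; apply: eq_bigr => i _; rewrite coefZ.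
move=> <-; rewrite coefB coef_deriv coefZ coefXM /= q0 q2 -/(edot z z).
by rewrite -mulr_natl; ring.
Qed.

Lemma second_order_criticalP x :
  second_order_critical F x <->
  sphere x /\ forall z, edot x z = 0 ->
    grad_form x z = 0 /\ hess_form x z <= n%:R * F x * edot z z.
Proof.
split=> [[sx gx hx]|[sx h]]; split=> //.
- move=> z xz; split.
    by have := edot_rgrad x z; rewrite gx (ip0r eip) (ip_sym eip z) xz; lra.
  by have := hx z xz; rewrite (edot_rhess xz); lra.
- have xr : edot x (rgrad F x) = 0.
    rewrite edot_rgrad grad_form_self.
    have -> : edot x x = 1 by rewrite -(ip_norm_sqr eip) -/(enorm x) sx expr1n.
    by rewrite mulr1 subrr.
  have := edot_rgrad x (rgrad F x); rewrite (h _ xr).1 (ip_sym eip _ x) xr mulr0 subr0.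
  exact: edot_eq0.
- by move=> z xz; rewrite (edot_rhess xz); have := (h z xz).2; lra.
Qed.

Lemma FprojZ a x : F (a *: x) = a ^+ (n + n) * F x.
Proof.
have -> : F (a *: x) = fdot (P (a ^+ n *: tpow x)) (a ^+ n *: tpow x).
  rewrite FprojE; suff -> : tpow (a *: x) = a ^+ n *: tpow x :> V by [].
  apply/ffunP => i; rewrite !ffunE; under eq_bigr do rewrite mxE.
  by rewrite big_split prodr_const card_ord.
by rewrite orthoprojZ (ipZl ip) (ipZr ip) mulrA -exprD FprojE.
Qed.

(** F is homogeneous of degree 2n, so maximality on the sphere near x becomes F(x) (1 + |z|^2 t^2)^n
    - F(x + t z) >= 0 for small t. The coefficients of t and t^2 of this polynomial are the two
    conditions. *)
Lemma local_max_second_order_critical x rho :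
  sphere x -> 0 < rho ->
  (forall y, sphere y -> 1 - rho <= edot x y -> F y <= F x) ->
  second_order_critical F x.
Proof.
move=> sx rho0 xmax; apply/second_order_criticalP; split=> // z xz.
have xx : edot x x = 1 by rewrite -(ip_norm_sqr eip) -/(enorm x) sx expr1n.
have [p [Fp p0 p1 p2]] := Fproj_line x z.
set c := edot z z in p2 *; have c0 : 0 <= c by exact: ip_ge0 eip _.
pose Q := F x *: (1 + c *: 'X^2) ^+ n - p.
have [N0 N1 N2] := coef_line_norm c n.
have Fx0 : 0 <= F x by rewrite /Fproj sqr_ge0.
(* If |t| <= 1 and |t| (c + 1) <= rho, then c t^2 <= rho, which keeps the normalised point x + t z
   in the region where x is maximal. *)
have := @poly_local_min_coef R Q (Num.min 1 (rho / (c + 1))).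
rewrite /Q !coefB !coefZ N0 N1 N2 p0 p1 p2.
move=> [||t|g h]; last by split; lra.
- by rewrite lt_min ltr01 divr_gt0// ltr_pwDr.
- by rewrite mulr1 subrr.
rewrite le_min => /andP[t1]; rewrite ler_pdivlMr ?ltr_pwDr// => trho.
rewrite hornerD hornerN hornerZ horner_exp hornerD hornerC hornerZ hornerXn.
rewrite -Fp subr_ge0.
pose s := 1 + c * t ^+ 2.
have s1 : 1 <= s by rewrite lerDl mulr_ge0 ?sqr_ge0.
have s0 : 0 < s by exact: lt_le_trans s1.
have sE : edot (x + t *: z) (x + t *: z) = s.
  rewrite !(ipDl eip, ipDr eip, ipZl eip, ipZr eip) (ip_sym eip z x) xz xx -/c.
  by rewrite /s; ring.
pose r := Num.sqrt s.
have r1 : 1 <= r by rewrite -sqrtr1 ler_wsqrtr.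
have r0 : 0 < r by exact: lt_le_trans r1.
have rr : r ^+ 2 = s by rewrite sqr_sqrtr// ltW.
have := xmax (r^-1 *: (x + t *: z)) _ _.
rewrite FprojZ exprVn => le_F.
rewrite -/s -rr -exprM mul2n -addnn -ler_pdivrMr ?exprn_gt0// mulrC.
apply: le_F.
  by rewrite /sphere /= /enorm (ip_normZ eip) sE -/r ger0_norm ?invr_ge0 1?ltW// mulVf ?gt_eqF.
rewrite (ipZr eip) (ipDr eip) (ipZr eip) xx xz mulr0 addr0 mulr1.
rewrite lerBlDr addrC -lerBlDr.
have r_le : r <= s by rewrite -rr expr2 ler_peMl// ltW.
have tc : c * t ^+ 2 <= rho.
  rewrite -real_normK ?num_real//.
  have := normr_ge0 t; nra.
have : (1 - r^-1) * r <= rho.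
  by rewrite mulrBl mul1r mulVf ?gt_eqF//; move: r_le; rewrite /s; lra.
have : 0 <= 1 - r^-1 by rewrite subr_ge0 invf_le1.
nra.
Qed.

End SecondOrder.

(** * Restricted isometry *)

Lemma edot_mulmx (R : realType) p q (M : 'M[R]_(p, q)) u v :
  edot (M *m u) v = edot u (M^T *m v).
Proof.
have E m (x y : 'cV[R]_m) : edot x y = (x^T *m y) 0 0.
  by rewrite mxE; apply: eq_bigr => i _; rewrite mxE.
by rewrite !E trmx_mul mulmxA.
Qed.

Section RestrictedIsometry.
Context {R : realType} {D K p : nat} {delta : R} {A : 'M[R]_(D, K)}.
Hypothesis ripA : RIP p delta A.
Local Notation cV := 'cV[R]_D.
Local Notation z j x := (edot (col j A) x).

(** RIP bounds |M c|^2 by (1 + delta) |c|^2; the bound for the transpose follows by duality, with c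
    = M^T v and |c|^2 = <M c, v> <= |M c| |v|. *)
Lemma RIP_increasing (f : 'I_p -> 'I_K) (v : cV) : {homo f : i j / (i < j)%N} ->
  \sum_k z (f k) v ^+ 2 <= (1 + delta) * edot v v.
Proof.
move=> fincr; have [_ /andP[d0 _] /(_ f fincr) spec] := ripA.
set M := colsub f A in spec; pose c := M^T *m v.
have cE : edot c c = \sum_k z (f k) v ^+ 2.
  rewrite /edot; apply: eq_bigr => k _; rewrite -expr2 mxE; congr (_ ^+ 2).
  by apply: eq_bigr => i _; rewrite !mxE.
have Mc : edot (M *m c) (M *m c) <= (1 + delta) * edot c c.
  rewrite edot_mulmx mulmxA -[M^T *m M](subrK 1%:M) mulmxDl mul1mx.
  rewrite (ipDr (edot_ip R p)) addrC mulrDl mul1r lerD2l.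
  rewrite (le_trans (ip_le_norm (edot_ip R p) _ _))//.
  rewrite -[X in _ <= _ * X](ip_norm_sqr (edot_ip R p)) expr2 [leRHS]mulrCA.
  rewrite ler_wpM2l ?sqrtr_ge0// (le_trans (enorm_le_specnorm _ _))//.
  by rewrite ler_wpM2r ?sqrtr_ge0.
have ccv : edot c c = edot (M *m c) v by rewrite edot_mulmx.
have : edot c c ^+ 2 <= (1 + delta) * edot c c * edot v v.
  rewrite {1}ccv (le_trans (ip_cauchy (edot_ip R D) _ _))//.
  by rewrite ler_wpM2r// (ip_ge0 (edot_ip R D)).
rewrite -cE; have := ip_ge0 (edot_ip R p) c; rewrite le_eqVlt => /predU1P[<- _|c0].
  by rewrite mulr_ge0 ?(ip_ge0 (edot_ip R D))// addr_ge0// ltW.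
by rewrite expr2 mulrAC ler_pM2r.
Qed.

(** RIP speaks of exactly p columns in increasing order. As p <= K, S can be padded to p indices and
    sorted; the added squares only increase the sum. *)
Lemma RIP_subset (S : {set 'I_K}) (v : cV) : (#|S| <= p)%N ->
  \sum_(j in S) z j v ^+ 2 <= (1 + delta) * edot v v.
Proof.
move=> Sp; have [/andP[p0 pK] _ _] := ripA.
pose s0 := take p (enum S ++ enum (~: S)).
have sz0 : size s0 = p.
  by rewrite size_take size_cat -!cardE cardsC card_ord; case: ltnP => // Kp; apply/eqP; rewrite eqn_leq Kp pK.
have u0 : uniq s0.
  rewrite take_uniq// cat_uniq !enum_uniq /= andbT.
  by apply/hasPn => j; rewrite !mem_enum inE.
pose s := sort (fun i j : 'I_K => (i <= j)%N) s0.
have szs : size s = p by rewrite size_sort.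
have us : uniq s by rewrite sort_uniq.
have ss : sorted (fun i j : 'I_K => (i < j)%N) s.
  rewrite -(@sorted_map _ _ val ltn) ltn_sorted_uniq_leq map_inj_uniq; last exact: val_inj.
  by rewrite us /= sorted_map sort_sorted// => i j; apply: leq_total.
have Ss j : j \in S -> j \in s.
  move=> jS; rewrite mem_sort /s0 take_cat -cardE.
  case: ltngtP Sp => // [_ _|<- _]; first by rewrite mem_cat mem_enum jS.
  by rewrite subnn take0 cats0 mem_enum.
pose t : p.-tuple 'I_K := Tuple (introT eqP szs).
have fincr : {homo tnth t : i j / (i < j)%N}.
  move=> i j ij; have i0 : 'I_K := tnth t i; rewrite !(tnth_nth i0) /=.
  apply: (sorted_ltn_nth _ i0 ss) => //; rewrite ?inE ?szs ?ltn_ord//.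
  by move=> a b c; apply: ltn_trans.
apply: le_trans (RIP_increasing v fincr).
rewrite -(big_tuple _ _ t predT (fun j => z j v ^+ 2)) big_uniq//=.
rewrite big_mkcond [leRHS]big_mkcond; apply: ler_sum => j _.
by case: ifP => [/Ss -> //|_]; case: ifP => //; rewrite sqr_ge0.
Qed.

(* With theta p >= 2 at most p correlations exceed theta, because p of them would
   already violate RIP. *)
Lemma RIP_threshold (theta : R) (x : cV) : delta <= 1 -> 2 <= theta * p%:R ->
  exists S : {set 'I_K}, (#|S| <= p)%N /\
    forall j, (j \in S) = (theta * edot x x < z j x ^+ 2).
Proof.
move=> d1 tp; pose S := finset (fun j : 'I_K => theta * edot x x < z j x ^+ 2).
exists S; split=> [|j]; last by rewrite inE.
rewrite leqNgt; apply/negP => pS.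
have [/andP[p0 pK] _ _] := ripA.
pose T := finset (fun j : 'I_K => j \in take p (enum S)).
have Tp : #|T| = p.
  rewrite cardsE (card_uniqP _) ?take_uniq ?enum_uniq// size_take -cardE.
  by rewrite pS.
have := RIP_subset x (eq_leq Tp); apply/negP; rewrite -ltNge.
have xx0 := ip_ge0 (edot_ip R D) x.
apply: (@le_lt_trans _ _ (theta * p%:R * edot x x)).
  by rewrite ler_wpM2r// (le_trans _ tp)//; lra.
rewrite mulrAC mulr_natr -Tp -sumr_const; apply: ltr_sum => [|j].
  apply/hasP; have : (0 < #|T|)%N by rewrite Tp.
  by case/card_gt0P => j jT; exists j; rewrite ?mem_index_enum.
by rewrite inE => /mem_take; rewrite mem_enum inE.
Qed.

End RestrictedIsometry.

(** * Landscape in a cap around a component *)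

Lemma expr_ge1Bn (R : realType) (c : R) k : 0 <= c <= 1 -> 1 - k%:R * (1 - c) <= c ^+ k.
Proof.
move=> /andP[c0 c1]; elim: k => [|k IH]; first by rewrite mul0r subr0.
rewrite exprS -natr1; have := ler_wpM2l c0 IH; have := mulr_ge0 (ler0n R k) (sqr_ge0 (1 - c)); lra.
Qed.

Section TensorTaylor.
Context {R : realType} {D n : nat}.
Local Notation V := (tensor R D n).
Local Notation cV := 'cV[R]_D.
Local Notation ip := (fdot_ip R D n).
Local Notation eip := (edot_ip R D).
Implicit Types x y d : cV.

Definition trest x d : V := \sum_(2 <= k < n.+1) tmix k x d.

Lemma tpow_taylor x d : (0 < n)%N -> tpow (x + d) = tpow x + tmix 1 x d + trest x d.
Proof.
move=> n0; rewrite -[d in LHS]scale1r tpow_line -(big_mkord predT (fun k => 1 ^+ k *: tmix k x d)).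
rewrite big_ltn// big_ltn ?ltnS// !expr1n !scale1r tmix0 addrA; congr (_ + _).
by apply: eq_bigr => k _; rewrite expr1n scale1r.
Qed.

Lemma bin_tail_le (M : R) : 0 <= M ->
  \sum_(2 <= k < n.+1) 'C(n, k)%:R * M <= 2 ^+ n * M.
Proof.
move=> M0; rewrite -mulr_suml ler_wpM2r//.
have -> : 2 ^+ n = \sum_(0 <= k < n.+1) 'C(n, k)%:R :> R.
  rewrite big_mkord (_ : 2 = 1 + 1)// exprDn.
  by apply: eq_bigr => k _; rewrite !expr1n mul1r.
case: n => [|m]; first by rewrite big_geq// sumr_ge0.
rewrite [leRHS](big_cat_nat _ (n := 2))//=.
by rewrite lerDr sumr_ge0.
Qed.

Lemma fnorm_trest x d : enorm x <= 1 -> enorm d <= 1 ->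
  fnorm (trest x d) <= 2 ^+ n * enorm d ^+ 2.
Proof.
move=> x1 d1; rewrite (le_trans (ip_norm_sum ip _ _ _))//.
apply: le_trans (bin_tail_le (sqr_ge0 _)).
apply: ler_sum_nat => k /andP[k2 _]; rewrite (le_trans (fnorm_tmix _ _ _))//.
rewrite ler_wpM2l// -[leRHS]mul1r.
have d0 : 0 <= enorm d by exact: sqrtr_ge0.
rewrite ler_pM ?exprn_ge0 ?exprn_ile1 ?sqrtr_ge0//.
by rewrite ler_wiXn2l.
Qed.

(** Against a power a^n the remainder is controlled by <a, d>^2 instead of |d|^2. This is a real
    gain in a cap, where d is nearly orthogonal to the centre. *)
Lemma fdot_trest a x d : `|edot a x| <= 1 -> `|edot a d| <= 1 ->
  `|fdot (tpow a) (trest x d)| <= 2 ^+ n * edot a d ^+ 2.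
Proof.
move=> x1 d1; rewrite (ip_sumr ip) (le_trans (ler_norm_sum _ _ _))//.
apply: le_trans (bin_tail_le (sqr_ge0 _)).
apply: ler_sum_nat => k /andP[k2 _]; rewrite fdot_tpow_mix.
rewrite normrM normr_nat ler_wpM2l// normrM !normrX -[leRHS]mul1r.
rewrite ler_pM ?exprn_ge0 ?exprn_ile1//.
by rewrite -[leRHS]real_normK ?num_real// ler_wiXn2l.
Qed.

(** With c = <x, y>, Bernoulli's inequality gives |x^n - y^n|^2 = 2 (1 - c^n) <= 2 n (1 - c) = n |x
    - y|^2. *)
Lemma fnorm_tpow_sub x y : sphere x -> sphere y ->
  0 <= edot x y -> fnorm (tpow x - tpow y : V) <= n%:R * enorm (x - y).
Proof.
move=> sx sy xy0.
have xx : edot x x = 1 by rewrite -(ip_norm_sqr eip) -/(enorm x) sx expr1n.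
have yy : edot y y = 1 by rewrite -(ip_norm_sqr eip) -/(enorm y) sy expr1n.
have xy1 : edot x y <= 1.
  by rewrite (le_trans (ip_le_norm eip _ _))// -/(enorm x) -/(enorm y) sx sy mulr1.
apply: le_of_sqr_le; first by rewrite mulr_ge0 ?sqrtr_ge0.
rewrite exprMn !(ip_norm_sqr ip) (ip_norm_sqr eip).
rewrite !(ipBl ip, ipBr ip, ipBl eip, ipBr eip) !fdot_tpow xx yy expr1n.
rewrite (ip_sym eip y x).
have b := @expr_ge1Bn R (edot x y) n; rewrite xy0 xy1 in b; have {b} := b isT.
case: n => [|m] h; first by rewrite !expr0; lra.
have : m.+1%:R * (1 - edot x y) <= m.+1%:R ^+ 2 * (1 - edot x y).
  by rewrite ler_wpM2r ?subr_ge0// expr2 ler_peMl// ler1n.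
lra.
Qed.

End TensorTaylor.

Section Continuity.
Context {R : realType} {D n : nat}.

(** Phrased on row vectors because [EVT_max_rV] is applied to them. *)
Lemma continuous_Fproj_trmx (B : {vspace tensor R D n}) :
  continuous (fun v : 'rV[R]_D => Fproj B v^T).
Proof.
pose e : {ffun 'I_n -> 'I_D} -> tensor R D n := delta_tensor.
pose tv (I : {ffun 'I_n -> 'I_D}) (v : 'rV[R]_D) : R := \prod_(k < n) v 0 (I k).
have tvE I v : (tpow v^T : tensor R D n) I = tv I v.
  by rewrite ffunE; apply: eq_bigr => k _; rewrite mxE.
have E : (fun v : 'rV[R]_D => Fproj B v^T) =
    (fun v => \sum_I \sum_J tv I v * (tv J v * fdot (orthoproj B (e I)) (e J))).
  apply/funext => v; rewrite FprojE [tpow _]tensor_sum_delta orthoproj_sum (ip_suml (fdot_ip R D n)).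
  apply: eq_bigr => I _; rewrite (ip_sumr (fdot_ip R D n)); apply: eq_bigr => J _.
  by rewrite orthoprojZ (ipZl (fdot_ip R D n)) (ipZr (fdot_ip R D n)) !tvE.
have tvc I : continuous (tv I).
  apply: continuous_big => [|k _]; first exact: mul_continuous.
  exact: coord_continuous.
rewrite E; apply: continuous_big => [|I _]; first exact: add_continuous.
apply: continuous_big => [|J _]; first exact: add_continuous.
by move=> v; apply: (cvgM (tvc I v) (cvgM (tvc J v) (cvg_cst _))).
Qed.

Lemma Fproj_cap_max (B : {vspace tensor R D n}) (b : 'cV[R]_D) (c : R) :
  sphere b -> c <= 1 -> exists x, [/\ sphere x, c <= edot b x &
    forall y, sphere y -> c <= edot b y -> Fproj B y <= Fproj B x].
Proof.
move=> sb c1; pose A := [set v : 'rV[R]_D | edot v^T v^T = 1 /\ c <= edot b v^T].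
have eE u v : edot u (v : 'rV[R]_D)^T = \sum_i u i 0 * v 0 i.
  by apply: eq_bigr => i _; rewrite !mxE.
have dot_c : continuous (fun v : 'rV[R]_D => edot b v^T).
  under eq_fun do rewrite eE.
  apply: continuous_big => [|i _]; first exact: add_continuous.
  by move=> v; apply: (cvgM (cvg_cst _) (@coord_continuous _ _ _ _ _ v)).
have sqr_c : continuous (fun v : 'rV[R]_D => edot v^T v^T).
  under eq_fun do rewrite eE.
  apply: continuous_big => [|i _]; first exact: add_continuous.
  have -> : (fun v : 'rV[R]_D => v^T i 0 * v 0 i) = (fun v => v 0 i * v 0 i).
    by apply/funext => v; rewrite mxE.
  by move=> v; apply: (cvgM (@coord_continuous _ _ _ _ _ v) (@coord_continuous _ _ _ _ _ v)).
have sphE (x : 'cV[R]_D) : sphere x <-> edot x x = 1.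
  rewrite -(ip_norm_sqr (edot_ip R D)) -/(enorm x) /sphere /=.
  split=> [->|/eqP]; first by rewrite expr1n.
  by rewrite sqrf_eq1 => /orP[/eqP|/eqP x1] //; have := sqrtr_ge0 (edot x x); rewrite -/(enorm x) x1; lra.
have Ac : closed A.
  rewrite (_ : A = (fun v : 'rV[R]_D => edot v^T v^T) @^-1` [set x | x = 1] `&`
                   (fun v : 'rV[R]_D => edot b v^T) @^-1` [set x | c <= x]) //.
  apply: closedI.
    by move/continuous_closedP: sqr_c; apply; exact: closed_eq.
  by move/continuous_closedP: dot_c; apply; exact: closed_ge.
have Ab : bounded_set A.
  exists 1; split; first exact: num_real.
  move=> M M1 v [vv _] /=; rewrite /Num.Def.normr /= mx_normrE.
  apply: bigmax_le => [|[k j] _ /=]; first by rewrite ltW// (lt_trans ltr01).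
  rewrite ord1 (le_trans _ (ltW M1))//; apply: le_of_sqr_le => //.
  rewrite expr1n real_normK ?num_real// -vv /edot (bigD1 j)//= mxE -expr2.
  by rewrite lerDl sumr_ge0// => i _; rewrite -expr2 sqr_ge0.
have A0 : A !=set0.
  by exists b^T; rewrite /A /= trmxK; move/sphE: sb => ->.
have [v vA vmax] := EVT_max_rV A0 (bounded_closed_compact Ab Ac)
  (continuous_subspaceT (@continuous_Fproj_trmx B)).
move: vA; rewrite inE => -[vv bv]; exists v^T; split=> //; first exact/sphE.
move=> y sy by_; rewrite -[y]trmxK; apply: vmax.
by rewrite inE /A /= trmxK; split=> //; apply/sphE.
Qed.

End Continuity.

(** Applied with q = 2^(n+1), k = n and w = sqrt c2. The summands on the left are nonnegative, so
    each is at most 1/8; the last two bounds use q >= 8 and then k >= 2. *)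
Fact radius_estimates (R : realType) (q k r w : R) :
  0 <= w -> 2 <= k -> 8 <= q -> 0 < r ->
  r * (q * (k + 5) + 8 * w * k) <= 8^-1 ->
  [/\ 8 * w * k * r <= 8^-1, q * (k + 5) * r <= 8^-1, k * r <= 64^-1 & r <= 128^-1].
Proof.
move=> w0 k2 q8 r0 h; have k0 : 0 <= k by lra.
have a0 := mulr_ge0 (mulr_ge0 w0 k0) (ltW r0).
have b0 := mulr_ge0 k0 (ltW r0).
have c0 : 0 <= (q - 8) * ((k + 5) * r).
  by apply: mulr_ge0; [lra | apply: mulr_ge0; lra].
have d0 : 0 <= (k - 2) * r by apply: mulr_ge0; lra.
by split; lra.
Qed.

Section Frame.
Context {R : realType} {D n K p : nat} {A : 'M[R]_(D, K)}.
Context {c1 c2 delta theta L Delta : R} {Ahat : {vspace tensor R D n}}.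
Context (i : 'I_K) (b : 'cV[R]_D) (r : R).
Hypotheses (n_ge2 : (2 <= n)%N) (c1_ge0 : 0 <= c1) (c2_ge0 : 0 <= c2).
Hypotheses (L_ge0 : 0 <= L) (theta_ge0 : 0 <= theta) (Delta_ge0 : 0 <= Delta).
Hypothesis (unitA : forall i, sphere (col i A)).
Hypothesis (ripA : RIP p delta A).
Hypotheses (delta_le1 : delta <= 1) (theta_p : 2 <= theta * p%:R).
Hypothesis (incoh : forall i j, i != j -> edot (col i A) (col j A) ^+ 2 <= c1 * L).
Hypotheses (Gunit : gram n A \in unitmx) (Gc2 : specnorm (invmx (gram n A)) <= c2).
Hypothesis (noise : forall T : tensor R D n,
  fnorm (orthoproj (power_span A) T - orthoproj Ahat T) <= Delta * fnorm T).

Local Notation V := (tensor R D n).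
Local Notation cV := 'cV[R]_D.
Local Notation ip := (fdot_ip R D n).
Local Notation eip := (edot_ip R D).
Local Notation P := (orthoproj (power_span A : {vspace V})).
Local Notation Ph := (orthoproj Ahat).
Local Notation Fh := (Fproj Ahat).
Local Notation F := (Fproj (power_span A : {vspace V})).
Local Notation z j x := (edot (col j A) x).
Implicit Types (x y d : cV) (S T : V).

Lemma noise_dot S T :
  `|fdot (Ph S) T - fdot (P S) T| <= Delta * (fnorm S * fnorm T).
Proof.
rewrite distrC -(ipBl ip) (le_trans (ip_cauchy_norm ip _ _))// mulrA.
by rewrite ler_wpM2r ?sqrtr_ge0//; apply: noise.
Qed.

Lemma noise_norm T : fnorm (Ph T) <= fnorm (P T) + Delta * fnorm T.
Proof.
have -> : Ph T = P T + - (P T - Ph T) by rewrite opprB addrC subrK.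
rewrite (le_trans (ip_normD ip _ _))// lerD2l.
by rewrite (ip_normN ip); apply: noise.
Qed.

Lemma sphere_edot x : sphere x -> edot x x = 1.
Proof. by move=> sx; rewrite -(ip_norm_sqr eip) -/(enorm x) sx expr1n. Qed.

Lemma fnorm_tpow x : sphere x -> fnorm (tpow x : V) = 1.
Proof. by move=> sx; rewrite /fnorm fdot_tpow sphere_edot// expr1n sqrtr1. Qed.

Lemma noise_F x : sphere x -> `|Fh x - F x| <= Delta.
Proof.
move=> sx; rewrite !FprojE (le_trans (noise_dot _ _))//.
by rewrite fnorm_tpow// !mulr1.
Qed.

(** An upper frame bound. Its constant 2 + K theta need not stay bounded, but it is used next to a
    factor theta^(n-1), and K theta^n = O(eps). *)
Lemma sum_z_sqr_le d : \sum_j z j d ^+ 2 <= (2 + K%:R * theta) * edot d d.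
Proof.
have [S [Sp SE]] := RIP_threshold ripA d delta_le1 theta_p.
have dd0 := ip_ge0 eip d.
rewrite (bigID (mem S)) /= mulrDl lerD//.
  rewrite (le_trans (RIP_subset ripA d Sp))// ler_wpM2r//; have := delta_le1; lra.
rewrite (@le_trans _ _ (\sum_(j : 'I_K) theta * edot d d))//; last first.
  by rewrite sumr_const card_ord -mulrA mulr_natl.
rewrite big_mkcond; apply: ler_sum => j _; rewrite SE.
by case: ltP => //= _; rewrite mulr_ge0.
Qed.

Section Near.
Hypotheses (b_sign : b = col i A \/ b = - col i A).
Hypotheses (r_gt0 : 0 < r).
(** The base of the first power bounds z_j(x)^2 for j other than i, and its factor 2 is the RIP
    constant; the second summand pays for the small correlations. For n = 2 and L near 0 the first
    summand is about 4 r^2, whence the budget 8 r^2. *)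
Hypothesis (near_small :
  2 * (2 * c1 * L + 2 * r ^+ 2) ^+ n.-1 + theta ^+ n.-1 * (2 + K%:R * theta)
  <= 8 * r ^+ 2).
Local Notation w := (Num.sqrt c2).
Hypothesis (r_small : r * (2 ^+ n.+1 * (n%:R + 5) + 8 * w * n%:R) <= 8^-1).
Hypothesis (Delta_small : 16 * Delta <= r ^+ 2).
Local Ltac clear_local := clear -n_ge2 c1_ge0 c2_ge0 L_ge0 theta_ge0 Delta_ge0 unitA
  ripA delta_le1 theta_p incoh Gunit Gc2 noise b_sign r_gt0 near_small r_small Delta_small.

Fact near_n_gt0 : (0 < n)%N. Proof. exact: leq_trans n_ge2. Qed.
Fact near_n_ge2R : 2 <= n%:R :> R. Proof. by rewrite ler_nat. Qed.
Fact near_w_ge0 : 0 <= w. Proof. exact: sqrtr_ge0. Qed.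
Fact near_pow2_ge : 8 <= 2 ^+ n.+1 :> R.
Proof.
rewrite (_ : 8 = 2 ^+ 3); last by ring.
by rewrite ler_eXn2l// ltr1n.
Qed.

Fact corr_center j : z j b ^+ 2 = z j (col i A) ^+ 2.
Proof. by case: b_sign => ->; rewrite ?(ipNr eip) ?sqrrN. Qed.

Fact corr_center_i x : z i x ^+ 2 = edot b x ^+ 2.
Proof. by case: b_sign => ->; rewrite ?(ipNl eip) ?sqrrN. Qed.

Lemma center_sphere : sphere b.
Proof.
rewrite /sphere /=; case: b_sign => ->; first exact: unitA.
by rewrite /enorm (ip_normN eip); apply: unitA.
Qed.
Fact center_edot : edot b b = 1. Proof. exact/sphere_edot/center_sphere. Qed.

Lemma center_proj : P (tpow b) = tpow b.
Proof.
have bE : exists s : R, b = s *: col i A.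
  by case: b_sign => ->; [exists 1; rewrite scale1r | exists (-1); rewrite scaleN1r].
have [s ->] := bE; apply: orthoproj_id.
have -> : tpow (s *: col i A) = s ^+ n *: tpow (col i A) :> V.
  apply/ffunP => I; rewrite !ffunE; under eq_bigr do rewrite mxE.
  by rewrite big_split prodr_const card_ord.
by rewrite memvZ// power_mem.
Qed.

(* RIP controls the sum over the large correlations with x, where |z_j|^(n-1) is
   small because x is close to b; for the other j, z_j^2 <= theta. *)
Lemma near_sum x d : edot x x <= 1 -> edot (x - b) (x - b) <= r ^+ 2 ->
  \sum_(j | j != i) (z j x ^+ n.-1 * z j d) ^+ 2 <= 8 * r ^+ 2 * edot d d.
Proof.
move=> xx xb; have [S [Sp SE]] := RIP_threshold ripA x delta_le1 theta_p.
have dd0 := ip_ge0 eip d.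
have small := near_small; set rho := 2 * c1 * L + 2 * r ^+ 2 in small.
have rho0 : 0 <= rho.
  by have := sqr_ge0 r; have := mulr_ge0 c1_ge0 L_ge0; rewrite /rho; lra.
have zx j : j != i -> z j x ^+ 2 <= rho.
  move=> ji; rewrite -(subrK b x) (ipDr eip).
  have h1 : z j b ^+ 2 <= c1 * L by rewrite corr_center incoh.
  have h2 : z j (x - b) ^+ 2 <= r ^+ 2.
    rewrite (le_trans (ip_cauchy eip _ _))// sphere_edot ?mul1r//; exact: unitA.
  rewrite /rho; have := sqr_ge0 (z j (x - b) - z j b); nra.
apply: le_trans (ler_wpM2r dd0 small); rewrite mulrDl.
apply: (@le_trans _ _ (\sum_(j in S) rho ^+ n.-1 * z j d ^+ 2 +
                       \sum_j theta ^+ n.-1 * z j d ^+ 2)).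
  rewrite big_mkcond [X in _ <= X + _]big_mkcond -big_split; apply: ler_sum => j _ /=.
  have t0 : 0 <= theta ^+ n.-1 * z j d ^+ 2 by apply: mulr_ge0; [exact: exprn_ge0 | exact: sqr_ge0].
  have r0 : 0 <= rho ^+ n.-1 * z j d ^+ 2 by apply: mulr_ge0; [exact: exprn_ge0 | exact: sqr_ge0].
  case: eqP => [_|/eqP ji] /=; first by case: ifP => _; rewrite ?add0r// addr_ge0.
  rewrite exprMn -!exprM mulnC exprM.
  case: ifP => jS.
    rewrite -[leLHS]addr0 lerD// ler_wpM2r ?sqr_ge0//.
    by rewrite lerXn2r ?nnegrE ?sqr_ge0// zx.
  rewrite add0r ler_wpM2r ?sqr_ge0// lerXn2r ?nnegrE ?sqr_ge0//.
  have := SE j; rewrite jS => /esym/negbT; rewrite -leNgt => /le_trans; apply.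
  by rewrite ler_piMr.
rewrite -!mulr_sumr lerD//.
  rewrite [X in _ <= X * _]mulrC -mulrA ler_wpM2l ?exprn_ge0//.
  rewrite (le_trans (RIP_subset ripA d Sp))// ler_wpM2r//; have := delta_le1; lra.
by rewrite -mulrA ler_wpM2l ?exprn_ge0// sum_z_sqr_le.
Qed.

(** The i-th correlation contributes <b, d>^2 and all others together O(r^2 |d|^2) by [near_sum]:
    after projection, the first-order variation almost vanishes in directions orthogonal to [b]. *)
Lemma near_proj_mix x d : edot x x <= 1 -> edot (x - b) (x - b) <= r ^+ 2 ->
  fdot (P (tmix 1 x d)) (P (tmix 1 x d)) <=
  c2 * n%:R ^+ 2 * (edot b d ^+ 2 + 8 * r ^+ 2 * edot d d).
Proof.
move=> xx xb; rewrite (le_trans (proj_power_span_le Gunit Gc2 _ c2_ge0))//.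
rewrite -mulrA ler_wpM2l//.
under eq_bigr => j _ do rewrite fdot_tpow_mix bin1 expr1 subn1 exprMn.
rewrite -mulr_sumr ler_wpM2l ?sqr_ge0// (bigD1 i)//= lerD ?near_sum//.
rewrite exprMn corr_center_i -[leRHS]mul1r ler_wpM2r ?sqr_ge0//.
rewrite -exprM mulnC exprM exprn_ile1 ?sqr_ge0//.
rewrite (le_trans (ip_cauchy eip _ _))//.
by rewrite sphere_edot ?mul1r//; apply: unitA.
Qed.

Fact radius_bounds : [/\ 8 * w * n%:R * r <= 8^-1, 2 ^+ n.+1 * (n%:R + 5) * r <= 8^-1,
  n%:R * r <= 64^-1 & r <= 128^-1].
Proof.
have n_gt0 := near_n_gt0; have w_ge0 := near_w_ge0.
by apply: radius_estimates r_small => //; [exact: near_n_ge2R | exact: near_pow2_ge].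
Qed.

(** On the sphere this says |x - b| <= r, as |x - b|^2 = 2 - 2 <b, x>. *)
Definition cap x := sphere x /\ 1 - r ^+ 2 / 2 <= edot b x.

Fact cap_facts x : cap x ->
  [/\ edot x x = 1, 0 <= edot b x <= 1, enorm (x - b) <= r,
      edot (x - b) (x - b) = 2 - 2 * edot b x &
      1 - n%:R * r ^+ 2 <= edot b x ^+ (n + n)].
Proof.
have n_gt0 := near_n_gt0; have w_ge0 := near_w_ge0.
case=> sx bx; have xx := sphere_edot sx.
have [_ _ h3 h4] := radius_bounds; have r0 := r_gt0; have hn := near_n_ge2R.
have bx1 : edot b x <= 1.
  by rewrite (le_trans (ip_le_norm eip _ _))// -/(enorm x) sx -/(enorm b) center_sphere mulr1.
have bx0 : 0 <= edot b x by nra.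
have xb : edot (x - b) (x - b) = 2 - 2 * edot b x.
  by rewrite !(ipBl eip, ipBr eip) xx center_edot (ip_sym eip x b); lra.
split=> //; first by rewrite bx0.
  apply: le_of_sqr_le; first exact: ltW.
  by rewrite (ip_norm_sqr eip) xb; lra.
have := @expr_ge1Bn R (edot b x) (n + n); rewrite bx0 bx1 natrD => /(_ isT).
nra.
Qed.

(** The component of P x^n along b^n alone contributes <b, x>^(2n) to F(x), and this is at least 1 -
    n r^2. *)
Fact near_Fh_ge x : cap x -> 2^-1 <= Fh x.
Proof.
have n_gt0 := near_n_gt0; have w_ge0 := near_w_ge0.
move=> cx; have [xx /andP[bx0 bx1] xb _ bxn] := cap_facts cx; have [sx _] := cx.
have [_ _ h3 h4] := radius_bounds; have r0 := r_gt0; have hn := near_n_ge2R; have hD := Delta_small.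
have := noise_F sx; rewrite ler_distlC => /andP[_ hF].
have : edot b x ^+ (n + n) <= F x.
  rewrite FprojE fdot_proj exprD -expr2.
  have -> : edot b x ^+ n = fdot (tpow b) (P (tpow x)).
    by rewrite -fdot_projC center_proj fdot_tpow.
  rewrite (le_trans (ip_cauchy ip _ _))// fdot_tpow center_edot expr1n mul1r.
  by [].
nra.
Qed.

(** Two kinds of base points are served: points of the cap, and the foot <b, y> b of a cap point y
    on the line of [b], about which [near_F_le] expands. The 3 r comes from e^2 + 8 r^2 <= (e + 3
    r)^2. *)
Fact fnorm_P_mix x d e : cap x \/ (exists2 y, cap y & x = edot b y *: b) ->
  0 <= e -> edot b d ^+ 2 <= (e * enorm d) ^+ 2 ->
  fnorm (P (tmix 1 x d)) <= w * n%:R * (e + 3 * r) * enorm d.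
Proof.
have n_gt0 := near_n_gt0; have w_ge0 := near_w_ge0.
move=> xP e0 bd; have r0 := ltW r_gt0.
have d0 : 0 <= enorm d by exact: sqrtr_ge0.
have [xx xb] : edot x x <= 1 /\ edot (x - b) (x - b) <= r ^+ 2.
  case: xP => [cx|[y cy ->]].
    have [-> _ h _ _] := cap_facts cx; split=> //.
    by rewrite -(ip_norm_sqr eip) ler_pXn2r ?nnegrE ?sqrtr_ge0.
  have [_ /andP[by0 by1] _ h _] := cap_facts cy; have [_ hy] := cy.
  have [_ _ _ h4] := radius_bounds; have rr := r_gt0.
  rewrite !(ipBl eip, ipBr eip, ipZl eip, ipZr eip) center_edot; split; nra.
apply: le_of_sqr_le; first by rewrite !mulr_ge0// addr_ge0// mulr_ge0.
rewrite (ip_norm_sqr ip) (le_trans (near_proj_mix d xx xb))//.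
rewrite !exprMn sqr_sqrtr// -[X in _ <= X]mulrA ler_wpM2l ?mulr_ge0 ?sqr_ge0//.
rewrite -(ip_norm_sqr eip) -/(enorm d).
rewrite exprMn in bd; rewrite (le_trans (lerD bd (lexx _)))// -mulrDl.
by rewrite ler_wpM2r ?sqr_ge0//; have := mulr_ge0 e0 r0; nra.
Qed.

(** Put q = |y - x| and let P be the projection onto [Ahat]. The expansion F(y) = F(x) + 2 <P x^n, M
    + E> + |P (M + E)|^2 is exact. Its part in M is at most -q^2 because n F(x) >= 1, its part in E
    at most q^2/8, and the square at most q^2/4. *)
Lemma near_strict_max x y : cap x -> cap y -> y != x ->
  (forall z, edot x z = 0 -> grad_form Ahat x z = 0) -> Fh y < Fh x.
Proof.
have n_gt0 := near_n_gt0; have w_ge0 := near_w_ge0.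
move=> cx cy yx gx; have [xx /andP[bx0 bx1] xb _ _] := cap_facts cx.
have [yy /andP[by0 by1] yb _ _] := cap_facts cy; have [sx _] := cx; have [sy _] := cy.
have [h1 h2 h3 h4] := radius_bounds; have r0 := r_gt0; have hn := near_n_ge2R; have hD := Delta_small.
have Fx := near_Fh_ge cx; have hw := near_w_ge0.
have [d yE] : exists d, y = x + d by exists (y - x); rewrite addrC subrK.
set q := enorm d; have q0 : 0 < q.
  rewrite lt_def sqrtr_ge0 andbT sqrtr_eq0 -ltNge lt_def (ip_ge0 eip) andbT.
  by apply: contraNneq yx => /edot_eq0 d0; rewrite yE d0 addr0.
have qr : q <= 2 * r.
  have -> : q = enorm ((y - b) + (- (x - b))).
    by congr enorm; rewrite opprB addrA subrK yE addrC addKr.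
  by rewrite (le_trans (ip_normD eip _ _))// (ip_normN eip) -!/(enorm _); lra.
have qq : edot d d = q ^+ 2 by rewrite (ip_norm_sqr eip).
have xd : edot x d = - (q ^+ 2 / 2).
  have : edot y y = 1 + 2 * edot x d + q ^+ 2.
    by rewrite yE !(ipDl eip, ipDr eip) (ip_sym eip d x) xx qq; lra.
  by rewrite yy; lra.
have bd : `|edot b d| <= 2 * r * q.
  have -> : edot b d = edot x d + edot (b - x) d by rewrite -(ipDl eip) addrC subrK.
  have e1 : `|edot (b - x) d| <= r * q.
    rewrite (le_trans (ip_cauchy_norm eip _ _))// -!/(enorm _) ler_wpM2r ?sqrtr_ge0//.
    by rewrite -opprB /enorm (ip_normN eip).
  rewrite (le_trans (ler_normD _ _))// xd normrN ger0_norm ?divr_ge0 ?sqr_ge0//.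
  have e2 := ler_wpM2r (ltW q0) qr; move: e1 e2; clear_local; lra.
have bd2 : edot b d ^+ 2 <= (2 * r * q) ^+ 2.
  by rewrite -[leLHS]real_normK ?num_real// lerXn2r ?nnegrE ?mulr_ge0// ltW.
have d1 : enorm d <= 1 by apply: (le_trans qr); move: h4; clear_local; lra.
have x1 : enorm x <= 1 by rewrite sx.
pose M : V := tmix 1 x d; pose E : V := trest x d.
have ty : tpow y = tpow x + (M + E) :> V by rewrite yE tpow_taylor// addrA.
have nE : fnorm E <= 2 ^+ n * q ^+ 2 by exact: fnorm_trest.
have nM : fnorm M <= n%:R * q.
  by rewrite (le_trans (fnorm_tmix _ _ _))// bin1 expr1 sx expr1n mul1r.
have nPM : fnorm (P M) <= w * n%:R * (5 * r) * q.
  have := @fnorm_P_mix x d (2 * r) (or_introl cx).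
  rewrite (_ : 2 * r + 3 * r = 5 * r); last by ring.
  by apply=> //; rewrite mulr_ge0// ltW.
set p2 := 2 ^+ n : R in nE.
have p4 : 4 <= p2.
  rewrite /p2 (_ : 4 = 2 ^+ 2); last by ring.
  by rewrite ler_eXn2l// ltr1n.
have p2E : 2 ^+ n.+1 = 2 * p2 :> R by rewrite exprS.
rewrite p2E in h2.
have nPhE : fnorm (Ph (M + E)) <= 2^-1 * q.
  rewrite orthoprojD (le_trans (ip_normD ip _ _))// -!/(fnorm _).
  have e1 := noise_norm M; have e2 := le_trans (fnorm_proj_le Ahat E) nE.
  have e3 := ler_wpM2l Delta_ge0 nM.
  have e4 : p2 * q ^+ 2 <= 8^-1 * q.
    rewrite expr2 mulrA ler_wpM2r ?ltW//.
    have e7 := ler_wpM2l (le_trans (ler0n R 4) p4) qr.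
    have e8 := mulr_ge0 (mulr_ge0 (le_trans (ler0n R 4) p4) (ler0n R n)) (ltW r0).
    have e9 := mulr_ge0 (le_trans (ler0n R 4) p4) (ltW r0).
    by move: h2 e7 e8 e9; clear_local; lra.
  have e5 : w * n%:R * (5 * r) * q <= 8^-1 * q.
    rewrite ler_wpM2r ?ltW//; have e7 : 0 <= w * n%:R * r by rewrite !mulr_ge0// ltW.
    by move: h1 e7; clear_local; lra.
  have e6 : Delta * (n%:R * q) <= 8^-1 * q.
    rewrite mulrA ler_wpM2r ?ltW//; have e7 := ler_wpM2r (ler0n R n) hD.
    have e8 := ler_wpM2r (ltW r0) h3.
    by move: e7 e8 h4; clear_local; lra.
  by move: e1 e2 e3 e4 e5 e6 nPM q0; clear_local; lra.
have nPhE2 : fdot (Ph (M + E)) (Ph (M + E)) <= 4^-1 * q ^+ 2.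
  rewrite -(ip_norm_sqr ip) -/(fnorm _).
  have : fnorm (Ph (M + E)) ^+ 2 <= (2^-1 * q) ^+ 2.
    by rewrite lerXn2r ?nnegrE ?sqrtr_ge0// mulr_ge0// ltW.
  by rewrite exprMn => /le_trans; apply; rewrite expr2; clear_local; lra.
(* Both x and y lie on the sphere, so <x, d> = -|d|^2/2: the first-order term
   provides the negative quadratic term that dominates all the others. *)
have gM : 2 * fdot (Ph (tpow x)) M = - (n%:R * Fh x * q ^+ 2).
  rewrite -/(grad_form Ahat x d).
  have -> : d = edot x d *: x + (d - edot x d *: x) by rewrite addrC subrK.
  rewrite grad_form_lin (gx (d - _)).
    by rewrite grad_form_self xd; clear_local; lra.
  by rewrite (ipBr eip) (ipZr eip) xx mulr1 subrr.
have gE : `|fdot (Ph (tpow x)) E| <= p2 * (n%:R + 5) * r * q ^+ 2.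
  (* Against b^n the remainder is of order <b, d>^2 = O(r^2 q^2), and P x^n differs from b^n by at
     most (n + 1) r. Both parts thus gain a factor r over the plain bound |E| = O(q^2). *)
  have -> : Ph (tpow x) = tpow b + (Ph (tpow x) - tpow b) by rewrite addrC subrK.
  rewrite (ipDl ip) (le_trans (ler_normD _ _))//.
  have e1 : `|fdot (tpow b) E| <= p2 * (4 * r ^+ 2 * q ^+ 2).
    have f1 : `|edot b x| <= 1 by rewrite ger0_norm.
    have f2 : `|edot b d| <= 1.
      have e1' := ler_wpM2l (ltW r0) qr; have e2' := ler_wpM2r (ltW r0) h4.
      by apply: (le_trans bd); move: e1' e2' h4; clear_local; lra.
    apply: le_trans (fdot_trest f1 f2) _.
    by rewrite ler_wpM2l ?exprn_ge0// (le_trans bd2)// le_eqVlt; apply/orP; left; apply/eqP; ring.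
  have e2 : fnorm (Ph (tpow x) - tpow b) <= (n%:R + 1) * r.
    have -> : Ph (tpow x) - tpow b = (P (tpow x - tpow b)) + (- (P (tpow x) - Ph (tpow x))).
      by rewrite orthoprojB center_proj opprB [RHS]addrC addrA subrK.
    rewrite (le_trans (ip_normD ip _ _))// (ip_normN ip) -!/(fnorm _).
    have f1 := noise (tpow x); rewrite fnorm_tpow// mulr1 in f1.
    have f2 : fnorm (P (tpow x - tpow b)) <= n%:R * r.
      rewrite (le_trans (fnorm_proj_le _ _))// (le_trans (fnorm_tpow_sub sx center_sphere _))//.
        by rewrite (ip_sym eip).
      by rewrite ler_wpM2l.
    have f3 := ler_wpM2r (ltW r0) h4.
    by move: f1 f2 f3 hD r0; clear_local; lra.
  have e3 : `|fdot (Ph (tpow x) - tpow b) E| <= (n%:R + 1) * r * (p2 * q ^+ 2).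
    by rewrite (le_trans (ip_cauchy_norm ip _ _))// ler_pM ?sqrtr_ge0.
  have e4 : p2 * (4 * r ^+ 2 * q ^+ 2) <= p2 * (4 * r * q ^+ 2).
    rewrite ler_wpM2l ?exprn_ge0// ler_wpM2r ?sqr_ge0//; have f3 := ler_wpM2r (ltW r0) h4; move: f3 r0; clear_local; lra.
  by move: e1 e3 e4; clear_local; lra.
rewrite [Fh y]FprojE ty orthoprojD.
rewrite !(ipDl ip (Ph (tpow x)), ipDr ip (tpow x)) -FprojE.
have -> : fdot (Ph (M + E)) (tpow x) = fdot (Ph (tpow x)) (M + E).
  by rewrite fdot_projC fdotC.
rewrite [fdot (Ph (M + E)) (M + E)]fdot_proj (ipDr ip M).
move: gE; rewrite ler_norml => /andP[_ gE].
have q2 : 0 < q ^+ 2 by rewrite exprn_gt0.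
have k1 : p2 * (n%:R + 5) * r * q ^+ 2 <= 16^-1 * q ^+ 2.
  by apply: ler_wpM2r; [exact: ltW | move: h2; clear_local; lra].
have k2 : 1 * q ^+ 2 <= n%:R * Fh x * q ^+ 2.
  by apply: ler_wpM2r; [exact: ltW | rewrite -[leLHS](_ : 2 * 2^-1 = 1) ?ler_pM// divff].
by move: k1 k2 gE gM nPhE2 q2; clear_local; lra.
Qed.

(** The argument first yields |z| <= 4 Delta, hence a squared distance of at most 32 Delta^2. The
    linear bound of the conclusion follows from 16 n Delta <= 1. *)
Lemma near_center_dist x : cap x ->
  (forall z, edot x z = 0 -> grad_form Ahat x z = 0) ->
  n%:R * edot (x - b) (x - b) <= 2 * Delta.
Proof.
have n_gt0 := near_n_gt0; have w_ge0 := near_w_ge0.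
move=> cx gx; have [xx /andP[bx0 bx1] xb xbE bxn] := cap_facts cx; have [sx bx] := cx.
have [h1 h2 h3 h4] := radius_bounds; have r0 := r_gt0; have hn := near_n_ge2R; have hw := near_w_ge0.
set c := edot b x in bx0 bx1 xbE bxn bx *.
pose z := b - c *: x; pose t := 1 - c ^+ 2; pose q := enorm z.
have xz : edot x z = 0 by rewrite (ipBr eip) (ipZr eip) xx (ip_sym eip) mulr1 subrr.
have bz : edot b z = t by rewrite (ipBr eip) (ipZr eip) center_edot -expr2.
have zz : edot z z = t.
  by rewrite {1}/z (ipBl eip) bz (ipZl eip) xz mulr0 subr0.
have q0 : 0 <= q by exact: sqrtr_ge0.
have qt : q ^+ 2 = t by rewrite (ip_norm_sqr eip) zz.
have t0 : 0 <= t by rewrite -qt sqr_ge0.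
have qr : q <= r.
  by apply: le_of_sqr_le; [exact: ltW | rewrite qt /t; have := sqr_ge0 (1 - c); move: bx; clear_local; lra].
pose M : V := tmix 1 x z.
have nM : fnorm M <= n%:R * q.
  by rewrite (le_trans (fnorm_tmix _ _ _))// bin1 expr1 sx expr1n mul1r.
(* P x^n splits into c^n b^n and P S, both factors of the error <P S, M> being of
   order q = sqrt t, so that Delta q dominates a multiple of t = q^2. *)
have nPM : fnorm (P M) <= w * n%:R * (4 * r) * q.
  have := @fnorm_P_mix x z r (or_introl cx) (ltW r_gt0).
  rewrite (_ : r + 3 * r = 4 * r); last by ring.
  apply; rewrite bz -qt -/q expr2 exprMn; have := ler_wpM2r (sqr_ge0 q) (_ : q ^+ 2 <= r ^+ 2).
  by apply; rewrite lerXn2r// nnegrE ltW.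
have g0 : fdot (Ph (tpow x)) M = 0.
  by have := gx z xz; rewrite /grad_form -/M; clear_local; lra.
have := noise_dot (tpow x) M; rewrite g0 sub0r normrN fnorm_tpow// mul1r.
have -> : tpow x = c ^+ n *: tpow b + (tpow x - c ^+ n *: tpow b) :> V.
  by rewrite addrC subrK.
set S : V := tpow x - _.
rewrite orthoprojD orthoprojZ center_proj (ipDl ip) (ipZl ip).
rewrite fdot_tpow_mix bin1 expr1 bz -/c.
have nS : fnorm S <= n%:R * q.
  apply: le_of_sqr_le; first by rewrite mulr_ge0.
  rewrite (ip_norm_sqr ip) !(ipBl ip, ipBr ip, ipZl ip, ipZr ip) !fdot_tpow xx center_edot.
  rewrite (ip_sym eip x b) -/c !expr1n -expr2 mulr1 exprMn qt.
  have := @expr_ge1Bn R (c ^+ 2) n; rewrite sqr_ge0 exprn_ile1// => /(_ isT).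
  rewrite -/t -!exprM mulnC exprM expr2 => hb.
  have : n%:R * t <= n%:R ^+ 2 * t by rewrite ler_wpM2r// expr2 ler_peMr// ler1n.
  by move: hb; clear_local; lra.
have PS : `|fdot (P S) M| <= n%:R * q * (w * n%:R * (4 * r) * q).
  by rewrite fdot_projC (le_trans (ip_cauchy_norm ip _ _))// ler_pM ?sqrtr_ge0.
have {}PS : `|fdot (P S) M| <= 2^-1 * (n%:R * t).
  apply: (le_trans PS); rewrite -qt.
  have -> : n%:R * q * (w * n%:R * (4 * r) * q) = (4 * w * n%:R * r) * (n%:R * q ^+ 2) by ring.
  apply: ler_wpM2r; first by rewrite mulr_ge0 ?sqr_ge0.
  by move: h1; clear_local; lra.
have cn : 3 / 4 <= c ^+ n * c ^+ (n - 1).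
  have nr2 : n%:R * r ^+ 2 <= 4^-1.
    by have := ler_wpM2r (ltW r0) h3; move: h4; clear_local; lra.
  rewrite -exprD; apply: (@le_trans _ _ (c ^+ (n + n))); first by move: nr2 bxn; clear_local; lra.
  by apply: ler_wiXn2l; rewrite ?bx0// leq_add2l leq_subr.
have {}cn : 3 / 4 * (n%:R * t) <= c ^+ n * (n%:R * (c ^+ (n - 1) * t)).
  have -> : c ^+ n * (n%:R * (c ^+ (n - 1) * t)) = (c ^+ n * c ^+ (n - 1)) * (n%:R * t) by ring.
  by apply: ler_wpM2r; first by rewrite mulr_ge0.
rewrite ler_norml => /andP[_ hu].
have hM := ler_wpM2l Delta_ge0 nM.
move: PS; rewrite ler_norml => /andP[PS _].
have : n%:R * (4^-1 * t) <= n%:R * (Delta * q).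
  by move: hu hM PS cn; clear_local; lra.
rewrite ler_pM2l; last by move: hn; clear_local; lra.
rewrite -qt => hq.
have q4 : q <= 4 * Delta.
  have [->|qn] := eqVneq q 0; first by rewrite mulr_ge0.
  have qp : 0 < q by rewrite lt_def qn.
  by rewrite -(ler_pM2r qp); move: hq; clear_local; lra.
rewrite xbE.
have tE : t = (1 - c) + (1 - c) * c by rewrite /t; ring.
have tc : 1 - c <= t by rewrite tE lerDl mulr_ge0 ?subr_ge0.
have q2 : q ^+ 2 <= 16 * Delta ^+ 2.
  have -> : 16 * Delta ^+ 2 = (4 * Delta) ^+ 2 by ring.
  by rewrite lerXn2r// nnegrE mulr_ge0.
have nD : n%:R * (16 * Delta) <= 1.
  have := ler_wpM2l (ler0n R n) Delta_small; rewrite expr2 mulrA => nD.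
  apply: (le_trans nD); have e7 := ler_wpM2r (ltW r0) h3; move: e7 h4; clear_local; lra.
apply: (@le_trans _ _ (n%:R * (2 * (16 * Delta ^+ 2)))).
  by rewrite ler_wpM2l//; move: q2 tc; rewrite qt; clear_local; lra.
by have := ler_wpM2r Delta_ge0 nD; rewrite expr2; clear_local; lra.
Qed.

(** Split x = c b + v with v orthogonal to b and expand about c b. Then x^n = c^n b^n + S with S
    orthogonal to b^n, so by Pythagoras F(x) = c^(2n) + |P S|^2 <= c^2 + (1 - c^2)/4. *)
Lemma near_F_le x : cap x -> F x <= 1 - (1 - edot b x ^+ 2) / 2.
Proof.
have n_gt0 := near_n_gt0; have w_ge0 := near_w_ge0.
move=> cx; have [xx /andP[bx0 bx1] xb xbE bxn] := cap_facts cx; have [sx bx] := cx.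
have [h1 h2 h3 h4] := radius_bounds; have r0 := r_gt0; have hn := near_n_ge2R; have hw := near_w_ge0.
pose c := edot b x; rewrite -/c in bx0 bx1 xbE bxn bx *.
pose v := x - c *: b; pose t := 1 - c ^+ 2; pose q := enorm v.
have bv : edot b v = 0 by rewrite (ipBr eip) (ipZr eip) center_edot -/c mulr1 subrr.
have vv : edot v v = t.
  rewrite {1}/v (ipBl eip) (ipZl eip) bv mulr0 subr0 (ipBr eip) (ipZr eip) xx.
  by rewrite (ip_sym eip x b) -/c -expr2.
have q0 : 0 <= q by exact: sqrtr_ge0.
have qt : q ^+ 2 = t by rewrite (ip_norm_sqr eip) vv.
have t0 : 0 <= t by rewrite -qt sqr_ge0.
have qr : q <= r.
  by apply: le_of_sqr_le; [exact: ltW | rewrite qt /t; have := sqr_ge0 (1 - c); move: bx; clear_local; lra].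
have q1 : enorm v <= 1 by apply: (le_trans qr); move: h4; clear_local; lra.
have cb1 : enorm (c *: b) <= 1.
  by rewrite /enorm (ip_normZ eip) -/(enorm b) center_sphere mulr1 ger0_norm.
pose S : V := tmix 1 (c *: b) v + trest (c *: b) v.
have xE : tpow x = c ^+ n *: tpow b + S :> V.
  have -> : c ^+ n *: tpow b = tpow (c *: b) :> V.
    apply/ffunP => I; rewrite !ffunE; under [RHS]eq_bigr do rewrite mxE.
    by rewrite big_split prodr_const card_ord.
  by rewrite /S addrA -tpow_taylor// addrC subrK.
have bS : fdot (tpow b) S = 0.
  have : fdot (tpow b) (tpow x : V) = c ^+ n by rewrite fdot_tpow.
  by rewrite xE (ipDr ip) (ipZr ip) fdot_tpow center_edot expr1n; clear_local; lra.
have FE : F x = c ^+ (n + n) + fdot (P S) (P S).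
  rewrite FprojE fdot_proj xE orthoprojD orthoprojZ center_proj.
  rewrite !(ipDl ip, ipDr ip, ipZl ip, ipZr ip) fdot_tpow center_edot expr1n exprD.
  rewrite (fdotC (P S)) -fdot_projC center_proj bS; ring.
have nPS : fnorm (P S) <= 2^-1 * q.
  rewrite orthoprojD (le_trans (ip_normD ip _ _))// -!/(fnorm _).
  have e1 : fnorm (P (tmix 1 (c *: b) v)) <= w * n%:R * (0 + 3 * r) * q.
    apply: fnorm_P_mix => //; first by right; exists x.
    by rewrite bv mul0r.
  have e2 : fnorm (P (trest (c *: b) v)) <= 2 ^+ n * q ^+ 2.
    by rewrite (le_trans (fnorm_proj_le _ _))// fnorm_trest.
  have p2E : 2 ^+ n.+1 = 2 * 2 ^+ n :> R by rewrite exprS.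
  rewrite p2E in h2; have p0 : 0 <= 2 ^+ n :> R by rewrite exprn_ge0.
  have e3 : 2 ^+ n * q ^+ 2 <= 8^-1 * q.
    rewrite expr2 mulrA; apply: ler_wpM2r => //.
    have e4 := ler_wpM2l p0 qr; have := mulr_ge0 p0 (ltW r0).
    have e6 := mulr_ge0 (mulr_ge0 p0 (ler0n R n)) (ltW r0).
    move: e4 e6 h2; move: (2 ^+ n) => p2; clear_local; lra.
  have e5 : w * n%:R * (0 + 3 * r) * q <= 8^-1 * q.
    apply: ler_wpM2r => //; have e6 := mulr_ge0 (mulr_ge0 hw (ler0n R n)) (ltW r0).
    by move: e6 h1; clear_local; lra.
  by move: e1 e2 e3 e5 q0; clear_local; lra.
have : fnorm (P S) ^+ 2 <= (2^-1 * q) ^+ 2.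
  by rewrite lerXn2r ?nnegrE ?sqrtr_ge0// mulr_ge0.
rewrite (ip_norm_sqr ip) exprMn qt => PS2.
have cn : c ^+ (n + n) <= c ^+ 2.
  by apply: ler_wiXn2l; rewrite ?bx0// (leq_trans n_ge2)// leq_addr.
rewrite FE; apply: (le_trans (lerD cn PS2)); rewrite /t; move: t0; rewrite /t; clear_local; lra.
Qed.

(** On the rim of the cap [near_F_le] puts F about r^2/2 below 1, whereas the noisy value at the
    centre is at least 1 - Delta; as 16 Delta <= r^2, the maximiser over the cap is not on the
    rim. *)
Lemma near_exists : exists x, [/\ cap x, second_order_critical Fh x & 1 - Delta <= Fh x].
Proof.
have n_gt0 := near_n_gt0; have w_ge0 := near_w_ge0.
have h := Delta_small; have r0 := r_gt0; have [_ _ h3 h4] := radius_bounds.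
pose c0 := 1 - r ^+ 2 / 2.
have c01 : c0 <= 1 by rewrite /c0; have := sqr_ge0 r; lra.
have [x [sx bx xmax]] := Fproj_cap_max Ahat center_sphere c01.
have cx : cap x by [].
have [xx /andP[bx0 bx1] xb xbE bxn] := cap_facts cx.
have Fb : 1 - Delta <= Fh b.
  have := noise_F center_sphere.
  have -> : F b = 1 by rewrite FprojE center_proj fdot_tpow center_edot expr1n.
  by rewrite ler_distlC => /andP[]; lra.
have Fx : Fh b <= Fh x by apply: xmax; rewrite ?center_edot//; exact: center_sphere.
exists x; split=> //; last by lra.
have bx_gt : c0 < edot b x.
  rewrite lt_neqAle bx andbT; apply/eqP => bE.
  have := near_F_le cx; have := noise_F sx; rewrite ler_distlC => /andP[hF _].
  have r2 : 0 < r ^+ 2 by rewrite exprn_gt0.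
  have r4 : r ^+ 2 * r ^+ 2 <= r ^+ 2.
    rewrite ler_piMr ?sqr_ge0// exprn_ile1//; first exact: ltW.
    by apply: (le_trans h4); clear_local; lra.
  rewrite -bE /c0 => hx; move: hx hF Fb Fx h r2 r4; clear_local; lra.
pose g := edot b x - c0; have g0 : 0 < g by rewrite subr_gt0.
(* If <x, y> >= 1 - g^2/2, then |y - x| <= g, and <b, y> can drop below <b, x> by no more than g, so
   y stays in the cap. *)
apply: (@local_max_second_order_critical _ _ _ _ _ (g ^+ 2 / 2)) => //.
  by rewrite divr_gt0// exprn_gt0.
move=> y sy xy; apply: xmax => //.
have yy := sphere_edot sy.
have yx : enorm (y - x) <= g.
  apply: le_of_sqr_le; first exact: ltW.
  rewrite (ip_norm_sqr eip) !(ipBl eip, ipBr eip) (ip_sym eip y x) xx yy; lra.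
have -> : edot b y = edot b x + edot b (y - x) by rewrite -(ipDr eip) addrC subrK.
have : - edot b (y - x) <= g.
  rewrite -(ipNr eip) (le_trans (ip_le_norm eip _ _))// (ip_normN eip).
  by rewrite -/(enorm b) center_sphere mul1r.
by rewrite /g; lra.
Qed.

End Near.
End Frame.

(** * Critical points at a high level *)

Fact double_predn n : (2 <= n)%N -> (2 * n.-1 = n + (n - 2))%N.
Proof. lia. Qed.

Section Global.
Context {R : realType} {D n K p : nat} {A : 'M[R]_(D, K)}.
Context {c1 c2 delta theta L Delta : R} {Ahat : {vspace tensor R D n}}.
Hypotheses (n_ge2 : (2 <= n)%N) (c1_ge0 : 0 <= c1) (c2_ge0 : 0 <= c2).
Hypotheses (L_ge0 : 0 <= L) (theta_ge0 : 0 <= theta) (Delta_ge0 : 0 <= Delta).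
Hypothesis (unitA : forall i, sphere (col i A)).
Hypothesis (ripA : RIP p delta A).
Hypotheses (delta_le1 : delta <= 1) (theta_p : 2 <= theta * p%:R).
Hypothesis (incoh : forall i j, i != j -> edot (col i A) (col j A) ^+ 2 <= c1 * L).
Hypotheses (Gunit : gram n A \in unitmx) (Gc2 : specnorm (invmx (gram n A)) <= c2).
Hypothesis (noise : forall T : tensor R D n,
  fnorm (orthoproj (power_span A) T - orthoproj Ahat T) <= Delta * fnorm T).

Local Notation V := (tensor R D n).
Local Notation cV := 'cV[R]_D.
Local Notation ip := (fdot_ip R D n).
Local Notation eip := (edot_ip R D).
Local Notation kip := (edot_ip R K).
Local Notation P := (orthoproj (power_span A : {vspace V})).
Local Notation Ph := (orthoproj Ahat).
Local Notation Fh := (Fproj Ahat).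
Local Notation F := (Fproj (power_span A : {vspace V})).
Local Notation g i j := (edot (col i A) (col j A)).

Context (x : cV) (sx : sphere x).
Local Notation z j := (edot (col j A) x).
Local Notation Y2 := (\sum_j (z j ^+ 2) ^+ n).

Local Ltac clear_local := clear -n_ge2 c1_ge0 c2_ge0 L_ge0 theta_ge0 Delta_ge0 unitA
  ripA delta_le1 theta_p incoh Gunit Gc2 noise sx.

Fact point_edot : edot x x = 1. Proof. exact: sphere_edot. Qed.
Fact power_gt0 : (0 < n)%N. Proof. exact: leq_trans n_ge2. Qed.

Lemma corr_sqr_le1 j : 0 <= z j ^+ 2 <= 1.
Proof.
rewrite sqr_ge0 (le_trans (ip_cauchy eip _ _))//.
by rewrite point_edot (sphere_edot (unitA j)) mulr1.
Qed.

Definition large_corr (S : {set 'I_K}) : Prop := (#|S| <= p)%N /\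
  forall j, (j \in S) = (theta < z j ^+ 2).

Lemma large_corr_exists : exists S, large_corr S.
Proof.
have [S [Sp SE]] := RIP_threshold ripA x delta_le1 theta_p.
by exists S; split=> // j; rewrite SE point_edot mulr1.
Qed.

Lemma sum_large_le S : large_corr S -> \sum_(j in S) z j ^+ 2 <= 1 + delta.
Proof. by case=> Sp _; have := RIP_subset ripA x Sp; rewrite point_edot mulr1. Qed.

Lemma sum_small_le S k : large_corr S ->
  \sum_(j | j \notin S) (z j ^+ 2) ^+ k <= K%:R * theta ^+ k.
Proof.
case=> _ SE; apply: (@le_trans _ _ (\sum_(j : 'I_K) theta ^+ k)); last first.
  by rewrite sumr_const card_ord mulr_natl.
rewrite big_mkcond; apply: ler_sum => j _; rewrite SE -leNgt.
case: ifP => zt; last exact: exprn_ge0.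
by rewrite lerXn2r ?nnegrE ?sqr_ge0.
Qed.

(* On the large correlations the vector (z_j^n) has l^1-norm at most 2 by RIP, so
   that the off-diagonal entries of the Gram matrix, of size (c1 L)^(n/2), move it
   by at most 2 sqrt (K (c1 L)^n) in l^2. *)
Lemma proj_coord : exists s : 'I_K -> R,
  [/\ P (tpow x) = \sum_j s j *: tpow (col j A),
      forall j, \sum_k s k * g j k ^+ n = z j ^+ n,
      \sum_j s j ^+ 2 <= c2 ^+ 2 * Y2 &
      \sum_j (s j - z j ^+ n) ^+ 2 <=
        2 * (4 * c2 ^+ 2 * (K%:R * (c1 * L) ^+ n) + (c2 + 1) ^+ 2 * (K%:R * theta ^+ n))].
Proof.
have [s [Ps Gs s2]] := power_span_coord Gunit Gc2 (tpow x : V).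
exists s; split=> //.
- by move=> j; rewrite Gs fdot_tpow.
- rewrite (le_trans s2)// ler_wpM2l ?sqr_ge0//.
  by apply: ler_sum => j _; rewrite fdot_tpow -!exprM mulnC.
have [S HS] := large_corr_exists; have [Sp SE] := HS.
pose sv : 'cV[R]_K := \col_j s j; pose y : 'cV[R]_K := \col_j z j ^+ n.
pose y1 : 'cV[R]_K := \col_j (if j \in S then z j ^+ n else 0).
pose y2 : 'cV[R]_K := \col_j (if j \in S then 0 else z j ^+ n).
pose G := gram n A.
have yE : y = y1 + y2.
  by apply/colP => j; rewrite !mxE; case: ifP; rewrite ?addr0 ?add0r.
have Gsv : G *m sv = y.
  apply/colP => j; rewrite !mxE -(fdot_tpow (n := n)) -Gs; apply: eq_bigr => k _.
  by rewrite !mxE mulrC.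
(* On the large part [y1] only the off-diagonal entries of G act, which are tiny; the small part
   [y2] is simply paid for with the factor c2 + 1. *)
have dE : sv - y = invmx G *m (y1 - G *m y1) + (invmx G *m y2 - y2).
  rewrite mulmxBr mulKmx // -[X in X - _](mulKmx Gunit) Gsv yE mulmxDr opprD.
  by rewrite addrACA.
have c2n v : enorm (invmx G *m v) <= c2 * enorm v.
  by rewrite (le_trans (enorm_le_specnorm _ _))// ler_wpM2r ?sqrtr_ge0.
have n1 : enorm (y1 - G *m y1) ^+ 2 <= 4 * (K%:R * (c1 * L) ^+ n).
  rewrite (ip_norm_sqr kip); pose gam := Num.sqrt ((c1 * L) ^+ n).
  have cL : 0 <= (c1 * L) ^+ n by rewrite exprn_ge0// mulr_ge0.
  have gam0 : 0 <= gam by exact: sqrtr_ge0.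
  have s1 : \sum_(j in S) `|z j ^+ n| <= 2.
    apply: (@le_trans _ _ (\sum_(j in S) z j ^+ 2)); last first.
      by apply: (le_trans (sum_large_le HS)); have := delta_le1; lra.
    apply: ler_sum => j _; rewrite normrX -[leRHS]real_normK ?num_real//.
    rewrite ler_wiXn2l//.
    have /andP[_] := corr_sqr_le1 j.
    by rewrite -real_normK ?num_real// expr_le1.
  apply: (@le_trans _ _ (\sum_(j : 'I_K) 4 * (c1 * L) ^+ n)); last first.
    by rewrite sumr_const card_ord -mulr_natl; lra.
  apply: ler_sum => i _; rewrite -expr2 -real_normK ?num_real//.
  have -> : 4 * (c1 * L) ^+ n = (gam * 2) ^+ 2.
    by rewrite [RHS]exprMn /gam sqr_sqrtr//; ring.
  rewrite lerXn2r ?nnegrE ?mulr_ge0//.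
  have -> : (y1 - G *m y1) i 0 = - \sum_(j | j != i) g i j ^+ n * y1 j 0.
    rewrite !mxE (bigD1 i)//= !mxE (sphere_edot (unitA i)) expr1n mul1r.
    rewrite opprD addrA subrr add0r; congr (- _).
    by apply: eq_bigr => j _; rewrite !mxE.
  rewrite normrN (le_trans (ler_norm_sum _ _ _))//.
  apply: le_trans (ler_wpM2l gam0 s1); rewrite mulr_sumr big_mkcond [leRHS]big_mkcond.
  apply: ler_sum => j _; rewrite !mxE; case: eqP => [_|/eqP ji] /=.
    by case: ifP => // _; rewrite mulr_ge0.
  case: ifP => _; last by rewrite mulr0 normr0.
  rewrite normrM ler_wpM2r//; apply: le_of_sqr_le => //.
  rewrite real_normK ?num_real// /gam sqr_sqrtr// -exprM mulnC exprM.
  by rewrite lerXn2r ?nnegrE ?sqr_ge0 ?mulr_ge0//; apply: incoh; rewrite eq_sym.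
have n2 : enorm y2 ^+ 2 <= K%:R * theta ^+ n.
  rewrite (ip_norm_sqr kip) (le_trans _ (sum_small_le n HS))//.
  rewrite /edot [leRHS]big_mkcond; apply: ler_sum => j _; rewrite !mxE.
  by case: ifP => _ /=; rewrite ?mulr0// -expr2 -!exprM mulnC.
have -> : \sum_j (s j - z j ^+ n) ^+ 2 = enorm (sv - y) ^+ 2.
  by rewrite (ip_norm_sqr kip); apply: eq_bigr => j _; rewrite !mxE expr2.
have e0 (v : 'cV[R]_K) : 0 <= enorm v by exact: sqrtr_ge0.
have : enorm (sv - y) <= c2 * enorm (y1 - G *m y1) + (c2 + 1) * enorm y2.
  rewrite dE (le_trans (ip_normD kip _ _))// -!/(enorm _) lerD//.
  rewrite (le_trans (ip_normD kip _ _))// (ip_normN kip) -!/(enorm _) mulrDl mul1r.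
  by rewrite lerD2r.
set a := enorm (y1 - _) in n1 *; set b := enorm y2 in n2 *; set e := enorm _ => eab.
have e_ge0 : 0 <= e := e0 _.
have ab0 : 0 <= c2 * a + (c2 + 1) * b by exact: le_trans eab.
apply: (@le_trans _ _ ((c2 * a + (c2 + 1) * b) ^+ 2)); first by rewrite lerXn2r ?nnegrE.
have m1 := ler_wpM2l (sqr_ge0 c2) n1; have m2 := ler_wpM2l (sqr_ge0 (c2 + 1)) n2.
have := sqr_ge0 (c2 * a - (c2 + 1) * b); move: m1 m2; clear_local; lra.
Qed.

Section Coordinates.
Context (s : 'I_K -> R) (B : R).
Hypothesis (Ps : P (tpow x) = \sum_j s j *: tpow (col j A)).
Hypothesis (Gs : forall j, \sum_k s k * g j k ^+ n = z j ^+ n).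
Hypothesis (s2 : \sum_j s j ^+ 2 <= c2 ^+ 2 * Y2).
Hypothesis (eB : \sum_j (s j - z j ^+ n) ^+ 2 <= B).

Lemma F_coord : F x = \sum_j s j * z j ^+ n.
Proof.
rewrite FprojE Ps (ip_suml ip); apply: eq_bigr => j _.
by rewrite (ipZl ip) fdot_tpow.
Qed.

Lemma F_le_c2 : F x <= c2 * Y2.
Proof.
rewrite FprojE fdot_proj (le_trans (proj_power_span_le Gunit Gc2 _ c2_ge0))//.
by rewrite ler_wpM2l//; apply: ler_sum => j _; rewrite fdot_tpow -!exprM mulnC.
Qed.

Lemma sum_pow_sqr : \sum_j (z j ^+ n) ^+ 2 = Y2.
Proof. by apply: eq_bigr => j _; rewrite -!exprM mulnC. Qed.

(** F(x) - Y2 is the inner product of the coordinate error with the vector (z_j^n). *)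
Lemma F_sub_sqr : (F x - Y2) ^+ 2 <= B * Y2.
Proof.
have -> : F x - Y2 = \sum_j (s j - z j ^+ n) * z j ^+ n.
  rewrite F_coord -sum_pow_sqr -sumrB; apply: eq_bigr => j _; ring.
rewrite (le_trans (sum_cauchy _ _ _))// sum_pow_sqr ler_wpM2r//.
by apply: sumr_ge0 => j _; rewrite exprn_ge0 ?sqr_ge0.
Qed.

(** Read off from row i of G s = (z_j^n). The l^2 bound [eB] would only give an error O(sqrt eps);
    here the norm of s contributes a further factor Y2, so that the error becomes small relative to
    mu and not just to sqrt mu. *)
Lemma coord_err i : (s i - z i ^+ n) ^+ 2 <= c2 ^+ 2 * Y2 * (K%:R * (c1 * L) ^+ n).
Proof.
have -> : s i - z i ^+ n = - \sum_(k | k != i) s k * g i k ^+ n.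
  rewrite -Gs (bigD1 i)//= (sphere_edot (unitA i)) expr1n mulr1.
  by rewrite opprD addrA subrr add0r.
rewrite sqrrN (le_trans (sum_cauchy _ _ _))// ler_pM ?sumr_ge0// => [k _|k _||].
- exact: sqr_ge0.
- exact: sqr_ge0.
- apply: le_trans s2; rewrite big_mkcond; apply: ler_sum => k _.
  by case: ifP => // _; rewrite sqr_ge0.
apply: (@le_trans _ _ (\sum_(k : 'I_K) (c1 * L) ^+ n)).
  have cL : 0 <= (c1 * L) ^+ n by rewrite exprn_ge0// mulr_ge0.
  rewrite big_mkcond; apply: ler_sum => k _; case: ifP => // ki.
  rewrite -exprM mulnC exprM lerXn2r ?nnegrE ?sqr_ge0 ?mulr_ge0//.
  by apply: incoh; rewrite eq_sym.
by rewrite sumr_const card_ord mulr_natl.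
Qed.

Section Critical.
Context (i : 'I_K).
Hypothesis (imax : forall j, z j ^+ 2 <= z i ^+ 2).
Local Ltac clear_crit := clear -n_ge2 c1_ge0 c2_ge0 L_ge0 theta_ge0 Delta_ge0 unitA
  ripA delta_le1 theta_p incoh Gunit Gc2 noise sx Ps Gs s2 eB imax.

Local Notation m := (z i ^+ 2).
Local Notation t := (1 - m).
Local Notation u j := (g j i - z i * z j).
Local Notation e := (fun j => s j - z j ^+ n).

(** The tangential part of a_i at x, the direction of steepest ascent of <a_i, .> on the sphere; its
    squared norm is t. *)
Local Notation d := (col i A - z i *: x).
Fact corr_dir j : edot (col j A) d = u j.
Proof. by rewrite (ipBr eip) (ipZr eip). Qed.
Fact corr_dir_self : u i = t.
Proof. by rewrite (sphere_edot (unitA i)) expr2. Qed.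
Fact edot_dir0 : edot x d = 0.
Proof. by rewrite (ipBr eip) (ipZr eip) point_edot (ip_sym eip) mulr1 subrr. Qed.
Fact dir_sqr : edot d d = t.
Proof. by rewrite (ipBl eip) (ipZl eip) edot_dir0 mulr0 subr0 corr_dir corr_dir_self. Qed.
Fact gap_bounds : 0 <= t <= 1.
Proof. by have /andP[h1 h2] := corr_sqr_le1 i; apply/andP; split; lra. Qed.
Fact enorm_dir_le1 : enorm d <= 1.
Proof. by apply: le_of_sqr_le => //; rewrite (ip_norm_sqr eip) dir_sqr expr1n; case/andP: gap_bounds. Qed.

(** The Hessian condition divided by n. Of |P M1|^2 only the component along a_i^n is kept, which
    gives the term in t^2. Replacing the noisy projections costs n^2, n (n - 1) and n times Delta t,
    in total 2 n^2 Delta t. *)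
Lemma hessian_ineq : hess_form Ahat x d <= n%:R * Fh x * edot d d ->
  n%:R * m ^+ n.-1 * t ^+ 2 + (n%:R - 1) * \sum_j s j * z j ^+ (n - 2) * u j ^+ 2
  <= t * (F x + 2 * n%:R * Delta).
Proof.
rewrite dir_sqr /hess_form => h.
have [t0 t1] := andP gap_bounds.
pose M1 : V := tmix 1 x d; pose M2 : V := tmix 2 x d.
have nM1 : fnorm M1 ^+ 2 <= n%:R ^+ 2 * t.
  rewrite -dir_sqr -(ip_norm_sqr eip) -exprMn lerXn2r ?nnegrE ?mulr_ge0 ?sqrtr_ge0//.
  by rewrite (le_trans (fnorm_tmix _ _ _))// bin1 expr1 sx expr1n mul1r.
have nM2 : fnorm M2 <= 'C(n, 2)%:R * t.
  rewrite (le_trans (fnorm_tmix _ _ _))// sx expr1n mul1r.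
  by rewrite (ip_norm_sqr eip) dir_sqr.
have binE : 'C(n, 2)%:R = n%:R * (n%:R - 1) / 2 :> R.
  have := mul_bin_diag n 1; rewrite bin1 => /(congr1 (fun k => k%:R : R)).
  by rewrite !natrM -subn1 natrB ?power_gt0// => ->; field.
have a1 : fdot (P M1) (P M1) - Delta * (n%:R ^+ 2 * t) <= fdot (Ph M1) (Ph M1).
  rewrite -!fdot_proj; have := noise_dot noise M1 M1; rewrite ler_norml => /andP[+ _].
  have := ler_wpM2l Delta_ge0 nM1; rewrite expr2; move: (fdot _ _) (fdot _ _) => f1 f2.
  by clear_crit; lra.
have a2 : n%:R ^+ 2 * (m ^+ n.-1 * t ^+ 2) <= fdot (P M1) (P M1).
  have -> : n%:R ^+ 2 * (m ^+ n.-1 * t ^+ 2) = fdot (tpow (col i A)) (P M1) ^+ 2.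
    rewrite -fdot_projC orthoproj_id ?power_mem// fdot_tpow_mix bin1 expr1 corr_dir corr_dir_self.
    by rewrite subn1 [RHS]exprMn [in RHS]exprMn -!exprM [(2 * _)%N]mulnC.
  rewrite (le_trans (ip_cauchy ip _ _))// fdot_tpow (sphere_edot (unitA i)) expr1n mul1r.
  by [].
have a3 : fdot (P (tpow x)) M2 - Delta * ('C(n, 2)%:R * t) <= fdot (Ph (tpow x)) M2.
  have := noise_dot noise (tpow x) M2; rewrite fnorm_tpow// mul1r ler_norml => /andP[+ _].
  have := ler_wpM2l Delta_ge0 nM2; move: (fdot _ _) (fdot _ _) => f1 f2.
  by clear_crit; lra.
have a4 : fdot (P (tpow x)) M2 =
    'C(n, 2)%:R * \sum_j s j * z j ^+ (n - 2) * u j ^+ 2.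
  rewrite Ps (ip_suml ip) mulr_sumr; apply: eq_bigr => j _.
  by rewrite (ipZl ip) fdot_tpow_mix corr_dir; ring.
have a5 : Fh x <= F x + Delta.
  by have := noise_F noise sx; rewrite ler_distlC => /andP[]; clear_crit; lra.
have N2 : 2 <= n%:R :> R by rewrite ler_nat.
have {}a5 := ler_wpM2l (mulr_ge0 (le_trans (ler0n R 2) N2) t0) a5.
rewrite -(ler_pM2l (lt_le_trans (ltr0n R 2) N2)).
move: h a1 a2 a3 a5; rewrite a4 binE -/M1 -/M2.
move: (\sum_j _) (fdot _ _) (fdot _ _) (fdot _ _) (n%:R) (m ^+ n.-1) => S f1 f2 f3 N mu.
by clear_crit; lra.
Qed.

Lemma gradient_ineq : grad_form Ahat x d = 0 ->
  `|\sum_j s j * z j ^+ n.-1 * u j| <= Delta.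
Proof.
rewrite /grad_form => g0.
pose M1 : V := tmix 1 x d.
have nM1 : fnorm M1 <= n%:R.
  rewrite (le_trans (fnorm_tmix _ _ _))// bin1 expr1 sx expr1n mul1r.
  by rewrite ler_piMr// enorm_dir_le1.
have N0 : 0 < n%:R :> R by rewrite ltr0n power_gt0.
have := noise_dot noise (tpow x) M1.
have -> : fdot (Ph (tpow x)) M1 = 0.
  by move: g0; rewrite -/M1; move: (fdot _ _) => f1; clear_crit; lra.
rewrite sub0r normrN fnorm_tpow// mul1r => /le_trans/(_ (ler_wpM2l Delta_ge0 nM1)).
have -> : fdot (P (tpow x)) M1 = n%:R * \sum_j s j * z j ^+ n.-1 * u j.
  rewrite Ps (ip_suml ip) mulr_sumr; apply: eq_bigr => j _.
  by rewrite (ipZl ip) fdot_tpow_mix corr_dir bin1 subn1 expr1; ring.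
by rewrite normrM normr_nat mulrC ler_pM2r.
Qed.

(** Replacing s_j by z_j^n turns every summand into a nonnegative one, and those with j different
    from i are dropped. In the errors, u_j^2 <= 2 c1 L + 2 z_j^2 splits the sum into two parts that
    Cauchy-Schwarz bounds by a1 and a2; a0 is the error at i. *)
Lemma psi_lower (a0 a1 a2 : R) : 0 <= a0 -> 0 <= a1 -> 0 <= a2 ->
  (s i - z i ^+ n) ^+ 2 <= a0 ^+ 2 ->
  B * \sum_j L ^+ 2 * (z j ^+ 2) ^+ (n - 2) <= a1 ^+ 2 -> B * Y2 <= a2 ^+ 2 ->
  m ^+ n.-1 * t ^+ 2 - a0 - 2 * c1 * a1 - 2 * a2 <=
  \sum_j s j * z j ^+ (n - 2) * u j ^+ 2.
Proof.
move=> a00 a10 a20 h0 h1 h2.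
have [t0 t1] := andP gap_bounds; have /andP[m0 m1] := corr_sqr_le1 i.
have z1 j : `|z j| <= 1.
  by have /andP[_] := corr_sqr_le1 j; rewrite -real_normK ?num_real// expr_le1.
rewrite (bigD1 i)//= corr_dir_self.
have ti : m ^+ n.-1 * t ^+ 2 - a0 <= s i * z i ^+ (n - 2) * t ^+ 2.
  have -> : s i * z i ^+ (n - 2) * t ^+ 2 =
      m ^+ n.-1 * t ^+ 2 + e i * z i ^+ (n - 2) * t ^+ 2.
    have -> : m ^+ n.-1 = z i ^+ n * z i ^+ (n - 2).
      by rewrite -exprM -exprD double_predn.
    by ring.
  rewrite lerD2l; apply: lerNnormlW; rewrite normrM -[leRHS]mulr1.
  rewrite ler_pM//; last by rewrite normrX exprn_ile1// ger0_norm.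
  rewrite normrM -[leRHS]mulr1 ler_pM//; last by rewrite normrX exprn_ile1.
  by apply: le_of_sqr_le => //; rewrite real_normK ?num_real.
pose f j := `|e j| * (L * `|z j| ^+ (n - 2)); pose h j := `|e j| * `|z j ^+ n|.
have sf : \sum_j f j <= a1.
  apply: le_of_sqr_le => //; apply: le_trans h1; rewrite (le_trans (sum_cauchy _ _ _))//.
  apply: ler_pM; try by apply: sumr_ge0 => j _; apply: sqr_ge0.
    apply: le_trans eB; apply: ler_sum => j _; by rewrite real_normK ?num_real.
  apply: ler_sum => j _; rewrite exprMn -!exprM mulnC exprM.
  by rewrite real_normK ?num_real// -exprM.
have sh : \sum_j h j <= a2.
  apply: le_of_sqr_le => //; apply: le_trans h2; rewrite (le_trans (sum_cauchy _ _ _))//.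
  apply: ler_pM; try by apply: sumr_ge0 => j _; apply: sqr_ge0.
    apply: le_trans eB; apply: ler_sum => j _; by rewrite real_normK ?num_real.
  apply: ler_sum => j _; rewrite real_normK ?num_real//.
  by rewrite -!exprM mulnC.
have : - (2 * c1 * \sum_j f j + 2 * \sum_j h j) <=
    \sum_(j | j != i) s j * z j ^+ (n - 2) * u j ^+ 2.
  rewrite !mulr_sumr -big_split -sumrN [leRHS]big_mkcond; apply: ler_sum => j _ /=.
  have f0 : 0 <= f j by rewrite !mulr_ge0// exprn_ge0.
  have h0' : 0 <= h j by rewrite mulr_ge0.
  case: ifP => ji; last first.
    by rewrite oppr_le0 addr_ge0// !mulr_ge0.
  have uj : u j ^+ 2 <= 2 * c1 * L + 2 * z j ^+ 2.
    have g2 := incoh ji.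
    have mz : (z i * z j) ^+ 2 <= z j ^+ 2 by rewrite exprMn ler_piMl ?sqr_ge0.
    have := sqr_ge0 (g j i + z i * z j); move: g2 mz.
    move: (g j i) (z i * z j) (z j) => a b c; clear_crit; lra.
  have -> : s j * z j ^+ (n - 2) * u j ^+ 2 =
      (z j ^+ 2) ^+ n.-1 * u j ^+ 2 + e j * z j ^+ (n - 2) * u j ^+ 2.
    have -> : (z j ^+ 2) ^+ n.-1 = z j ^+ n * z j ^+ (n - 2).
      by rewrite -exprM -exprD double_predn.
    by ring.
  rewrite -[leLHS]add0r; apply: lerD.
    by apply: mulr_ge0; [apply/exprn_ge0/sqr_ge0 | exact: sqr_ge0].
  apply: lerNnormlW; rewrite normrM [`|e j * _|]normrM [`|u j ^+ 2|]ger0_norm ?sqr_ge0// normrX.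
  apply: (@le_trans _ _ (`|e j| * `|z j| ^+ (n - 2) * (2 * c1 * L + 2 * z j ^+ 2))).
    by rewrite ler_wpM2l// mulr_ge0// exprn_ge0.
  rewrite /f /h normrX.
  have -> : `|z j| ^+ n = `|z j| ^+ (n - 2) * z j ^+ 2.
    by rewrite -[z j ^+ 2]real_normK ?num_real// -exprD subnK.
  by rewrite le_eqVlt; apply/orP; left; apply/eqP; ring.
move: ti sf sh (ler_wpM2l c1_ge0 sf).
move: (\sum_j f j) (\sum_j h j) (\sum_(j | _) _) (s i * _ * _) (m ^+ _ * _) => X Y Z W U.
by clear_crit; lra.
Qed.

Lemma power_sum_le S : large_corr S -> Y2 <= m ^+ n.-1 * (1 + delta) + K%:R * theta ^+ n.
Proof.
move=> HS; rewrite (bigID (mem S)) /= lerD ?(sum_small_le n HS)//.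
have m0 : 0 <= m ^+ n.-1 by rewrite exprn_ge0 ?sqr_ge0.
apply: le_trans (ler_wpM2l m0 (sum_large_le HS)); rewrite mulr_sumr.
apply: ler_sum => j _; rewrite -[in leLHS](prednK power_gt0) exprSr.
by rewrite ler_wpM2r ?sqr_ge0// lerXn2r ?nnegrE ?sqr_ge0.
Qed.

(** Once i is a large correlation, RIP leaves at most 1 + delta - m = t + delta for the sum of z_j^2
    over the other large ones. *)
Lemma power_sum_le_gap S : large_corr S -> i \in S ->
  Y2 <= m ^+ n + (t + delta) ^+ n + K%:R * theta ^+ n.
Proof.
move=> HS iS; rewrite (bigID (mem S)) /= lerD ?(sum_small_le n HS)//.
rewrite (bigD1 i)//= lerD2l.
have gap : \sum_(j in S | j != i) z j ^+ 2 <= t + delta.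
  by have := sum_large_le HS; rewrite (bigD1 i)//=; move: (\sum_(j in S | _) _) => X; clear_crit; lra.
have gap0 : 0 <= t + delta by apply: le_trans gap; apply: sumr_ge0 => j _; apply: sqr_ge0.
rewrite -[in leRHS](prednK power_gt0) exprSr.
apply: le_trans (ler_wpM2l (exprn_ge0 _ gap0) gap); rewrite mulr_sumr.
apply: ler_sum => j jS; rewrite -[in leLHS](prednK power_gt0) exprSr.
rewrite ler_wpM2r ?sqr_ge0// lerXn2r ?nnegrE ?sqr_ge0//.
apply: le_trans gap; rewrite (bigD1 j)//= lerDl.
by apply: sumr_ge0 => k _; apply: sqr_ge0.
Qed.

(** On the large correlations L <= Gam theta <= Gam z_j^2, so one factor L can be traded for z_j^2,
    whose sum RIP controls. *)
Lemma mixed_sum_le S Gam : large_corr S -> 0 <= Gam -> L <= Gam * theta ->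
  \sum_j L ^+ 2 * (z j ^+ 2) ^+ (n - 2) <=
  Gam * L * m ^+ (n - 2) * (1 + delta) + L ^+ 2 * (K%:R * theta ^+ (n - 2)).
Proof.
move=> HS G0 LG; rewrite (bigID (mem S)) /= lerD//; last first.
  by rewrite -mulr_sumr ler_wpM2l ?sqr_ge0// (sum_small_le _ HS).
have m0 : 0 <= Gam * L * m ^+ (n - 2) by rewrite !mulr_ge0// exprn_ge0 ?sqr_ge0.
apply: le_trans (ler_wpM2l m0 (sum_large_le HS)); rewrite mulr_sumr.
have [Sp SE] := HS; apply: ler_sum => j; rewrite SE => /ltW zt.
have Lz : L <= Gam * z j ^+ 2 by apply: (le_trans LG); rewrite ler_wpM2l.
have -> : Gam * L * m ^+ (n - 2) * z j ^+ 2 = L * (Gam * z j ^+ 2) * m ^+ (n - 2) by ring.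
apply: ler_pM; [exact: sqr_ge0 | exact/exprn_ge0/sqr_ge0 | |].
  by rewrite expr2 ler_wpM2l.
by rewrite lerXn2r ?nnegrE ?sqr_ge0.
Qed.

(** Multiplying the gradient identity by z_i gives s_i z_i^n - m F(x) up to cross terms containing
    <a_j, a_i>, which incoherence and Cauchy-Schwarz bound by a3. *)
Lemma coord_gap (a3 : R) : 0 <= a3 -> grad_form Ahat x d = 0 ->
  c2 ^+ 2 * Y2 * (c1 * L * \sum_j (z j ^+ 2) ^+ n.-1) <= a3 ^+ 2 ->
  s i * z i ^+ n <= m * F x + Delta + a3.
Proof.
move=> a30 /gradient_ineq gd h3; have /andP[m0 m1] := corr_sqr_le1 i.
have z1 : `|z i| <= 1.
  by have /andP[_] := corr_sqr_le1 i; rewrite -real_normK ?num_real// expr_le1.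
have zpow j : z j ^+ n = z j ^+ n.-1 * z j by rewrite -exprSr prednK ?power_gt0.
pose T := \sum_(j | j != i) s j * (z j ^+ n.-1 * g j i).
have E : z i * (\sum_j s j * z j ^+ n.-1 * u j) = s i * z i ^+ n + z i * T - m * F x.
  rewrite (eq_bigr (fun j => s j * (z j ^+ n.-1 * g j i) - z i * (s j * z j ^+ n))).
    rewrite sumrB -mulr_sumr -F_coord (bigD1 i)//= (sphere_edot (unitA i)) -/T zpow.
    by ring.
  by move=> j _; rewrite zpow; ring.
have T3 : `|T| <= a3.
  apply: le_of_sqr_le => //; rewrite real_normK ?num_real// (le_trans _ h3)//.
  rewrite (le_trans (sum_cauchy _ _ _))// ler_pM ?sumr_ge0// => [j _|j _||].
  - exact: sqr_ge0.
  - exact: sqr_ge0.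
  - apply: le_trans s2; rewrite big_mkcond; apply: ler_sum => k _.
    by case: ifP => // _; rewrite sqr_ge0.
  rewrite mulr_sumr big_mkcond; apply: ler_sum => j _; case: ifP => ji; last first.
    by apply: mulr_ge0; [exact: mulr_ge0 | exact/exprn_ge0/sqr_ge0].
  rewrite exprMn mulrC -!exprM mulnC exprM; apply: ler_wpM2r; last exact: incoh.
  by rewrite exprn_ge0 ?sqr_ge0.
have h1 : `|z i * (\sum_j s j * z j ^+ n.-1 * u j)| <= Delta.
  by rewrite normrM (le_trans _ gd)// ler_piMl.
have h2 : `|z i * T| <= a3 by rewrite normrM (le_trans _ T3)// ler_piMl.
move: h1 h2; rewrite E !ler_norml => /andP[_ h1] /andP[h2 _].
by move: h1 h2; move: (s i * _) (z i * T) (m * F x) => X Y Z; clear_crit; lra.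
Qed.

End Critical.
End Coordinates.
End Global.

(** * Scalar inequalities behind the gap *)

Section ScalarEstimates.
Context {R : realType}.
Implicit Types N mu t F Delta a C eps : R.

(** The level gives C eps <= c2 Y2, hence eps is at most a small multiple of Y2, and then of mu. The
    factor 10000 = 100^2 makes (F - Y2)^2 <= (Y2/100)^2. *)
Fact level_estimates C eps Delta Fh F Y2 c2 B0 Gam mu delta :
  0 < C -> 0 < eps -> 0 <= Delta -> 0 <= c2 -> 0 <= B0 -> 0 <= Gam -> 0 <= mu ->
  0 <= Y2 -> delta <= 100^-1 ->
  C * eps + 5 * Delta <= Fh -> Fh <= F + Delta -> F <= c2 * Y2 ->
  (F - Y2) ^+ 2 <= B0 * eps * Y2 -> Y2 <= mu * (1 + delta) + Gam * eps ->
  10000 * B0 * c2 <= C -> 100 * Gam * c2 <= C ->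
  [/\ 4 * Delta <= F, F <= 11 / 10 * mu, Y2 <= 2 * mu, C * eps <= 2 * c2 * mu & 0 < mu].
Proof.
move=> C0 e0 D0 c20 B00 G0 mu0 Y0 d1 h1 h2 h3 h4 h5 h6 h7.
have Ce : 0 < C * eps by rewrite mulr_gt0.
have F1 : C * eps + 4 * Delta <= F by move: h1 h2; clear; lra.
have CY : C * eps <= c2 * Y2 by move: F1 h3 D0; clear; lra.
have FY : F - Y2 <= Y2 / 100.
  apply: le_of_sqr_le; first by rewrite divr_ge0.
  rewrite -(ler_pM2l C0); apply: (le_trans (ler_wpM2l (ltW C0) h4)).
  have e1 := ler_wpM2l (mulr_ge0 B00 Y0) CY.
  have e2 := ler_wpM2r (sqr_ge0 Y2) h6.
  by move: e1 e2; clear; rewrite !expr2; lra.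
have GY : Gam * eps <= Y2 / 100.
  rewrite -(ler_pM2l C0); have e1 := ler_wpM2l G0 CY; have e2 := ler_wpM2r Y0 h7.
  by move: e1 e2; clear; lra.
have md := ler_wpM2l mu0 d1.
have Y2mu : 99 / 100 * Y2 <= 101 / 100 * mu by move: md h5 GY; clear; lra.
have F2 : F <= 11 / 10 * mu by move: FY Y2mu mu0; clear; lra.
have Y2m : Y2 <= 2 * mu by move: Y2mu mu0; clear; lra.
split=> //; first by move: F1 Ce; clear; lra.
  by have := ler_wpM2l c20 Y2m; move: CY; clear; lra.
by move: F2 F1 Ce D0; clear; lra.
Qed.

(** After division by mu the inequality reads (2 N - 1) t^2 <= 1.1 t + 0.55 N t + 0.01, the noise
    being absorbed through Delta <= F/4. The case N = 2 is the tightest; its root is just below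
    3/4. *)
Fact gap_first N S mu t F Delta a : 2 <= N -> 0 < mu -> 0 <= t <= 1 ->
  N * mu * t ^+ 2 + (N - 1) * S <= t * (F + 2 * N * Delta) ->
  mu * t ^+ 2 - a <= S -> 100 * N * a <= mu -> 0 <= a ->
  F <= 11 / 10 * mu -> 4 * Delta <= F -> t < 3 / 4.
Proof.
move=> N2 mu0 /andP[t0 t1] h1 h2 h3 a0 h4 h5; rewrite ltNge; apply/negP => t34.
have e1 : (N - 1) * (mu * t ^+ 2 - a) <= (N - 1) * S by apply: ler_wpM2l; move: N2 h2; clear; lra.
have tN : 0 <= t * N by apply: mulr_ge0 => //; move: N2; clear; lra.
have e2 : t * (F + 2 * N * Delta) <= t * F + t * N * F / 2.
  by have := ler_wpM2l tN h5; clear; lra.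
have e3 := ler_wpM2l t0 h4; have e4 := ler_wpM2l tN h4.
have e5 : (2 * N - 1) * mu * t ^+ 2 <=
    11 / 10 * mu * t + 11 / 20 * mu * (t * N) + mu / 100.
  by move: h1 h3 a0 e1 e2 e3 e4; clear; lra.
have : mu * ((2 * N - 1) * t ^+ 2) <= mu * (11 / 10 * t + 11 / 20 * (t * N) + 100^-1).
  by move: e5; clear; lra.
rewrite ler_pM2l// => e6.
have f1 : 0 <= (N - 2) * (t * (2 * t - 11 / 20)).
  by move: N2 t34; clear=> N2 t34; apply: mulr_ge0; [lra | apply: mulr_ge0; lra].
have f2 : 0 <= (t - 3 / 4) * (3 * t + 1 / 20).
  by move: t34; clear=> t34; apply: mulr_ge0; lra.
by move: e6 f1 f2 t34; clear; rewrite !expr2; lra.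
Qed.

(** Same inequality with Delta negligible against mu: now (2 N - 1) t^2 <= 1.11 t + 0.01, whose root
    for N = 2 is just below 2/5. *)
Fact gap_second N S mu t F Delta a : 2 <= N -> 0 < mu -> 0 <= t <= 1 ->
  N * mu * t ^+ 2 + (N - 1) * S <= t * (F + 2 * N * Delta) ->
  mu * t ^+ 2 - a <= S -> 100 * N * a <= mu -> 0 <= a ->
  F <= 11 / 10 * mu -> 200 * N * Delta <= mu -> t < 2 / 5.
Proof.
move=> N2 mu0 /andP[t0 t1] h1 h2 h3 a0 h4 h5; rewrite ltNge; apply/negP => t25.
have e1 : (N - 1) * (mu * t ^+ 2 - a) <= (N - 1) * S by apply: ler_wpM2l; move: N2 h2; clear; lra.
have e3 := ler_wpM2l t0 h4; have e4 := ler_wpM2l t0 h5.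
have e5 : mu * ((2 * N - 1) * t ^+ 2) <= mu * (111 / 100 * t + 100^-1).
  by move: h1 h3 a0 e1 e3 e4; clear; lra.
rewrite ler_pM2l// in e5.
have f1 : 0 <= (N - 2) * t ^+ 2 by apply: mulr_ge0; [move: N2; clear; lra | exact: sqr_ge0].
have f2 : 0 <= (t - 2 / 5) * (3 * t + 9 / 100).
  by move: t25; clear=> t25; apply: mulr_ge0; lra.
by move: e5 f1 f2 t25; clear; rewrite !expr2; lra.
Qed.

(** Chaining the hypotheses gives m^n (1 - m) <= m (t + delta)^n + 5 kap, hence m^(n-1) t <= (t +
    delta)^n + 9 kap as m > 3/5. Since t + delta <= 3/5 <= m, a factor (3/5)^(n-2) comes out on both
    sides, and m t - (t + delta)^2 >= t/5 - 3 delta because t < 2/5. Multiplying by 5 gives 15 and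
    45; 2^n bounds (5/3)^(n-2). *)
Fact gap_third n m F Y2 Delta delta kap sy t : (2 <= n)%N ->
  t = 1 - m -> 0 <= t -> t < 2 / 5 -> 0 < delta -> delta <= 100^-1 -> 0 <= kap ->
  m ^+ n - kap <= sy -> sy <= m * F + Delta + kap -> F <= Y2 + kap ->
  Y2 <= m ^+ n + (t + delta) ^+ n + kap -> Delta <= kap ->
  t <= 15 * delta + 45 * (kap * 2 ^+ n).
Proof.
move=> n2 tE t0 t25 d0 d1 k0 h1 h2 h3 h4 h5.
have m35 : 3 / 5 < m by move: tE t25; clear; lra.
have m0 : 0 < m by move: m35; clear; lra.
have m1 : m <= 1 by move: tE t0; clear; lra.
have mE : m ^+ n = m * m ^+ n.-1 by rewrite -exprS prednK// (leq_trans _ n2).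
have e1 : m ^+ n - 2 * kap - Delta <= m * (m ^+ n + (t + delta) ^+ n + 2 * kap).
  have := ler_wpM2l (ltW m0) (le_trans h3 (lerD h4 (lexx kap))).
  by move: h1 h2; clear; lra.
have e2 : m ^+ n * t <= m * (t + delta) ^+ n + 5 * kap.
  have := ler_wpM2r k0 m1; move: e1 h5; rewrite tE; clear; lra.
have e3 : m ^+ n.-1 * t <= (t + delta) ^+ n + 9 * kap.
  rewrite -(ler_pM2l m0); have := ler_wpM2r k0 (ltW m35); move: e2 k0; rewrite mE; clear; lra.
have [s0|s0] := lerP (t / 5 - 3 * delta) 0.
  by have := mulr_ge0 k0 (exprn_ge0 n (ler0n R 2)); move: s0; clear; lra.
have [k nk] : exists k, n = k.+2 by exists n.-2; case: n n2 {h1 h4 mE e1 e2 e3} => [|[]].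
rewrite nk /= in e3 *; have td : 0 <= t + delta <= 3 / 5 by move: t0 t25 d0 d1; clear; lra.
have {td}/andP[td0 td1] := td.
have q0 : 0 <= (3 / 5) ^+ k :> R by apply: exprn_ge0; clear; lra.
have p35 : 0 <= 3 / 5 :> R by clear; lra.
have mk : (3 / 5) ^+ k <= m ^+ k.
  by rewrite lerXn2r ?nnegrE//; exact: ltW.
have tk : (t + delta) ^+ k <= (3 / 5) ^+ k by rewrite lerXn2r ?nnegrE.
have e4 : (3 / 5) ^+ k * (m * t) <= m ^+ k.+1 * t.
  by rewrite exprSr -mulrA ler_wpM2r// mulr_ge0// ltW.
have e5 : (t + delta) ^+ k.+2 <= (3 / 5) ^+ k * (t + delta) ^+ 2.
  by rewrite -addn2 exprD ler_wpM2r// sqr_ge0.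
have e6 : (3 / 5) ^+ k * (t / 5 - 3 * delta) <= 9 * kap.
  have f : t / 5 - 3 * delta <= m * t - (t + delta) ^+ 2.
    have f1 : 0 <= t * (2 / 5 - t) by apply: mulr_ge0 => //; move: t25; clear; lra.
    have f2 : 0 <= delta * (2 / 5 - t).
      by apply: mulr_ge0; [exact: ltW | move: t25; clear; lra].
    have f3 : 0 <= delta * (100^-1 - delta).
      by apply: mulr_ge0; [exact: ltW | move: d1; clear; lra].
    by move: f1 f2 f3 d0; rewrite tE expr2; clear; lra.
  by have := ler_wpM2l q0 f; move: e3 e4 e5; clear; lra.
have e7 : 1 <= 2 ^+ k.+2 * (3 / 5) ^+ k :> R.
  have -> : 2 ^+ k.+2 * (3 / 5) ^+ k = 4 * (6 / 5) ^+ k :> R.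
    have -> : 6 / 5 = 2 * (3 / 5) :> R by field.
    by rewrite [in RHS]exprMn !exprS; move: (2 ^+ k) ((3 / 5) ^+ k) => X Y; ring.
  have : 1 <= (6 / 5) ^+ k :> R by apply: exprn_ege1; clear; lra.
  by clear; lra.
have e8 := ler_wpM2r (ltW s0) e7.
have e9 := ler_wpM2l (exprn_ge0 k.+2 (ler0n R 2)) e6.
by move: e8 e9; clear; lra.
Qed.

End ScalarEstimates.

Fact le_of_expr_le (R : realType) (a b : R) k : (0 < k)%N -> 0 <= b -> a ^+ k <= b ^+ k -> a <= b.
Proof.
move=> k0 b0; have [a0|a0 _] := lerP 0 a; last by rewrite (le_trans (ltW a0)).
by rewrite ler_pXn2r.
Qed.

(** [Gam] bounds the error sums in units of eps. The Hessian tests work relative to mu = m^(n-1): q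
    bounds eps/mu, sl bounds L/m, and kap the errors over mu. [kap2] is the absolute error allowed
    in the gradient test, after t < 2/5 is known. *)
Lemma critical_gap (R : realType) (D n K p : nat) (A : 'M[R]_(D, K))
    (c1 c2 delta theta L Delta : R) (Ahat : {vspace tensor R D n})
    (Gam eps C q sl kap kap2 : R) (B0 := 2 * (4 * c2 ^+ 2 + (c2 + 1) ^+ 2) * Gam)
    (n_ge2 : (2 <= n)%N) (c1_ge0 : 0 <= c1) (c2_ge0 : 0 <= c2)
    (L_ge0 : 0 <= L) (theta_ge0 : 0 <= theta) (Delta_ge0 : 0 <= Delta)
    (unitA : forall i, sphere (col i A)) (ripA : RIP p delta A)
    (delta_small : delta <= 100^-1) (theta_p : 2 <= theta * p%:R)
    (incoh : forall i j, i != j -> edot (col i A) (col j A) ^+ 2 <= c1 * L)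
    (Gunit : gram n A \in unitmx) (Gc2 : specnorm (invmx (gram n A)) <= c2)
    (noise : forall T : tensor R D n,
      fnorm (orthoproj (power_span A) T - orthoproj Ahat T) <= Delta * fnorm T)
    (Gam_ge0 : 0 <= Gam) (eps_gt0 : 0 < eps) (C_gt0 : 0 < C)
    (Gam_incoh : K%:R * (c1 * L) ^+ n <= Gam * eps)
    (Gam_n : K%:R * theta ^+ n <= Gam * eps)
    (Gam_n2 : L ^+ 2 * (K%:R * theta ^+ (n - 2)) <= Gam * eps)
    (Gam_n1 : L * (K%:R * theta ^+ n.-1) <= Gam * eps)
    (Gam_L : L ^+ n.-1 <= Gam * eps) (Gam_theta : L <= Gam * theta)
    (C_B0 : 10000 * B0 * c2 <= C) (C_Gam : 100 * Gam * c2 <= C)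
    (C_q : 2 * c2 <= q * C)
    (q_ge0 : 0 <= q) (sl_ge0 : 0 <= sl) (kap_ge0 : 0 <= kap) (kap2_ge0 : 0 <= kap2)
    (q_sl : Gam * q <= sl ^+ n.-1) (q_kap0 : 2 * Gam * q * c2 ^+ 2 <= kap ^+ 2)
    (q_kap1 : B0 * q * (2 * Gam * sl + Gam * q) <= kap ^+ 2)
    (q_kap2 : 2 * B0 * q <= kap ^+ 2)
    (kap_n : 100 * n%:R * ((3 + 2 * c1) * kap) <= 1)
    (Delta_n : 200 * n%:R * Delta <= (4 ^+ n)^-1) (Delta_kap2 : Delta <= kap2)
    (eps_kap2a : 2 * Gam * c2 ^+ 2 * eps <= kap2 ^+ 2)
    (eps_kap2b : 2 * B0 * eps <= kap2 ^+ 2) (eps_kap2c : Gam * eps <= kap2)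
    (eps_kap2d : 2 * c2 ^+ 2 * c1 * (2 * L + Gam * eps) <= kap2 ^+ 2)
    (theta_small : theta < 3 / 5) (x : 'cV[R]_D) :
  second_order_critical (Fproj Ahat) x -> C * eps + 5 * Delta <= Fproj Ahat x ->
  exists i, 1 - edot (col i A) x ^+ 2 <= 15 * delta + 45 * (kap2 * 2 ^+ n).
Proof.
move=> /second_order_criticalP[sx crit] level.
have delta1 : delta <= 1 by apply: (le_trans delta_small); rewrite invf_le1// ler1n.
have [/andP[p0 pK] /andP[d0 _] _] := ripA.
have [i _ imax] : exists2 i : 'I_K, true &
    forall j, edot (col j A) x ^+ 2 <= edot (col i A) x ^+ 2.
  pose i0 : 'I_K := Ordinal (leq_trans p0 pK).
  have [i _ imax] := @arg_maxP _ _ _ i0 xpredT (fun j => edot (col j A) x ^+ 2) isT.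
  by exists i => // j; exact: imax.
exists i; have [s [Ps Gs s2 eB0]] := proj_coord n_ge2 c1_ge0 L_ge0 theta_ge0 unitA ripA
  delta1 theta_p incoh Gunit Gc2 sx.
have B00 : 0 <= B0.
  by rewrite !mulr_ge0// addr_ge0 ?sqr_ge0// mulr_ge0 ?sqr_ge0.
have eB : \sum_j (s j - edot (col j A) x ^+ n) ^+ 2 <= B0 * eps.
  apply: (le_trans eB0).
  have f1 := ler_wpM2l (sqr_ge0 c2) Gam_incoh.
  have f2 := ler_wpM2l (sqr_ge0 (c2 + 1)) Gam_n.
  by rewrite /B0; move: f1 f2; clear; lra.
have [S HS] := large_corr_exists ripA delta1 theta_p sx.
have xd := edot_dir0 (A := A) sx i; have [gd hd] := crit _ xd.
have zle1 := corr_sqr_le1 unitA sx.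
have err := coord_err c1_ge0 L_ge0 unitA incoh Gs s2 i.
have FY := F_sub_sqr Ps eB.
have hY := power_sum_le n_ge2 theta_ge0 ripA sx imax HS.
have hW := mixed_sum_le (n := n) L_ge0 theta_ge0 ripA sx imax HS Gam_ge0 Gam_theta.
have Fh_le : Fproj Ahat x <= Fproj (power_span A : {vspace tensor R D n}) x + Delta.
  by have := noise_F noise sx; rewrite ler_distlC => /andP[]; clear; lra.
have F_c2 := F_le_c2 c2_ge0 Gunit Gc2 x.
have hess := hessian_ineq n_ge2 Delta_ge0 unitA noise sx Ps hd.
have psi := fun a0 a1 a2 => psi_lower n_ge2 c1_ge0 L_ge0 unitA incoh sx eB (i := i)
  (a0 := a0) (a1 := a1) (a2 := a2).
have gap := fun a3 a30 => coord_gap n_ge2 c1_ge0 L_ge0 Delta_ge0 unitA incoh noise sx Ps s2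
  (i := i) (a3 := a3) a30 gd.
have hYg := power_sum_le_gap n_ge2 theta_ge0 ripA sx HS (i := i).
have /andP[m0 m1] := zle1 i.
have iS : (i \in S) = (theta < edot (col i A) x ^+ 2) by case: HS => _ ->.
have sum_n1 : \sum_j (edot (col j A) x ^+ 2) ^+ n.-1 <= 2 + K%:R * theta ^+ n.-1.
  rewrite (bigID (mem S)) /= lerD ?(sum_small_le theta_ge0 _ HS)//.
  apply: (@le_trans _ _ (\sum_(j in S) edot (col j A) x ^+ 2)).
    apply: ler_sum => j _; have /andP[z0 z1] := zle1 j.
    by rewrite -[leRHS]expr1 ler_wiXn2l ?z0// -ltnS prednK// (leq_trans _ n_ge2).
  apply: (le_trans (sum_large_le ripA sx HS)).
  by move: delta1; clear; lra.
rewrite iS in hYg.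
have Y0 : 0 <= \sum_j (edot (col j A) x ^+ 2) ^+ n.
  by apply: sumr_ge0 => j _; exact/exprn_ge0/sqr_ge0.
clear zle1 imax HS iS crit hd gd Ps Gs s2 eB0 eB.
move: hess psi gap hYg err FY hY hW Fh_le F_c2 m0 m1 sum_n1 Y0 level.
set Psi := \sum_j s j * _ * _; set W := \sum_j L ^+ 2 * _.
set Y2 := \sum_j (edot (col j A) x ^+ 2) ^+ n.
set Fx := Fproj _ x; set Fhx := Fproj Ahat x.
set zi := edot (col i A) x.
set m := zi ^+ 2; set t := 1 - m; set mu := m ^+ n.-1.
set X := \sum_j (edot (col j A) x ^+ 2) ^+ n.-1.
move=> hess psi gap hYg err FY hY hW Fh_le F_c2 m0 m1 sum_n1 Y0 level.
have mu0 : 0 <= mu by exact: exprn_ge0.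
have hY' : Y2 <= mu * (1 + delta) + Gam * eps by rewrite (le_trans hY)// lerD2l.
have [D4 F11 Y2mu Cmu mu_gt0] := level_estimates C_gt0 eps_gt0 Delta_ge0 c2_ge0 B00 Gam_ge0
  mu0 Y0 delta_small level Fh_le F_c2 FY hY' C_B0 C_Gam.
(* What the level buys: C eps <= 2 c2 mu, and [C_q] makes 2 c2/C at most q. *)
have epsq : eps <= q * mu.
  rewrite -(ler_pM2l C_gt0); have := ler_wpM2r mu0 C_q; move: Cmu; clear; lra.
(* L^(n-1) <= Gam eps <= Gam q mu <= (sl m)^(n-1); take roots. *)
have Lm : L <= sl * m.
  have n1 : (0 < n.-1)%N by rewrite -ltnS prednK// (leq_trans _ n_ge2).
  apply: (le_of_expr_le n1 (mulr_ge0 sl_ge0 m0)); rewrite exprMn -/mu; apply: (le_trans Gam_L).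
  have := ler_wpM2l Gam_ge0 epsq; have := ler_wpM2r mu0 q_sl; clear; lra.
have muE : mu = m * m ^+ (n - 2).
  by rewrite /mu -exprS; congr (_ ^+ _); move: n_ge2; clear; lia.
have mp0 : 0 <= m ^+ (n - 2) by exact: exprn_ge0.
have W_mu : W <= (2 * Gam * sl + Gam * q) * mu.
  apply: (le_trans hW); have f1 := le_trans Gam_n2 (ler_wpM2l Gam_ge0 epsq).
  have f2 : Gam * L * m ^+ (n - 2) * (1 + delta) <= Gam * (sl * m) * m ^+ (n - 2) * 2.
    apply: ler_pM; rewrite ?mulr_ge0// ?addr_ge0// ?(ltW d0)//.
      by rewrite ler_wpM2r// ler_wpM2l.
    by move: delta1; clear; lra.
  by rewrite mulrDl; move: f1 f2; rewrite {2}muE; clear; lra.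
have kmu : 0 <= kap * mu by exact: mulr_ge0.
have a0_le : (s i - zi ^+ n) ^+ 2 <= (kap * mu) ^+ 2.
  have Ge := ler_wpM2l Gam_ge0 epsq.
  have f1 : c2 ^+ 2 * Y2 * (K%:R * (c1 * L) ^+ n) <= c2 ^+ 2 * (2 * mu) * (Gam * (q * mu)).
    apply: ler_pM.
    - by rewrite mulr_ge0 ?sqr_ge0.
    - by rewrite mulr_ge0 ?exprn_ge0 ?mulr_ge0.
    - by rewrite ler_wpM2l ?sqr_ge0.
    - exact: le_trans Gam_incoh Ge.
  have := ler_wpM2r (sqr_ge0 mu) q_kap0; move: err f1; rewrite exprMn; clear; lra.
have a1_le : B0 * eps * W <= (kap * mu) ^+ 2.
  have W0 : 0 <= W.
    by apply: sumr_ge0 => j _; apply: mulr_ge0; [exact: sqr_ge0 | exact/exprn_ge0/sqr_ge0].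
  have f1 : B0 * eps * W <= (B0 * (q * mu)) * ((2 * Gam * sl + Gam * q) * mu).
    apply: ler_pM => //; first by rewrite mulr_ge0// ltW.
    by rewrite ler_wpM2l.
  have := ler_wpM2r (sqr_ge0 mu) q_kap1; move: f1; rewrite exprMn; clear; lra.
have a2_le : B0 * eps * Y2 <= (kap * mu) ^+ 2.
  have f1 : B0 * eps * Y2 <= (B0 * (q * mu)) * (2 * mu).
    by apply: ler_pM => //; [rewrite mulr_ge0// ltW | rewrite ler_wpM2l].
  have := ler_wpM2r (sqr_ge0 mu) q_kap2; move: f1; rewrite exprMn; clear; lra.
have psi_mu := psi _ _ _ kmu kmu kmu a0_le a1_le a2_le.
have N2 : 2 <= n%:R :> R by rewrite ler_nat.
have t01 : 0 <= t <= 1 by apply/andP; split; move: m0 m1; rewrite /t; clear; lra.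
pose a := (3 + 2 * c1) * kap * mu.
have a_ge0 : 0 <= a by rewrite !mulr_ge0// addr_ge0// mulr_ge0.
have psi_a : mu * t ^+ 2 - a <= Psi by move: psi_mu; rewrite /a; clear; lra.
have a_small : 100 * n%:R * a <= mu.
  by rewrite /a; have := ler_wpM2r mu0 kap_n; clear; lra.
have t34 := gap_first N2 mu_gt0 t01 hess psi_a a_small a_ge0 F11 D4.
(* As m > 1/4, mu is bounded below by a constant, so the absolute bound [Delta_n] turns into 200 n
   Delta <= mu. *)
have mu4 : (4 ^+ n)^-1 <= mu.
  have m4 : 4^-1 <= m by move: t34; rewrite /t; clear; lra.
  apply: (@le_trans _ _ (4^-1 ^+ n.-1)).
    rewrite -exprVn ler_wiXn2l ?leq_pred//; first by clear; lra.
  by rewrite /mu lerXn2r ?nnegrE//; clear; lra.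
have t25 := gap_second N2 mu_gt0 t01 hess psi_a a_small a_ge0 F11 (le_trans Delta_n mu4).
have /andP[t0 t1] := t01.
have mu1 : mu <= 1 by exact: exprn_ile1.
have Y22 : Y2 <= 2 by move: Y2mu mu1; clear; lra.
have sy_ge : m ^+ n - kap2 <= s i * zi ^+ n.
  have zn1 : `|zi ^+ n| <= 1.
    rewrite normrX exprn_ile1//; move: m1; rewrite /m -real_normK ?num_real//.
    by rewrite expr_le1.
  have e2 : `|s i - zi ^+ n| <= kap2.
    apply: le_of_sqr_le => //; rewrite real_normK ?num_real// (le_trans err)//.
    apply: (le_trans _ eps_kap2a).
    have : c2 ^+ 2 * Y2 * (K%:R * (c1 * L) ^+ n) <= c2 ^+ 2 * 2 * (Gam * eps).
      apply: ler_pM => //.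
      - by rewrite mulr_ge0 ?sqr_ge0.
      - by rewrite mulr_ge0 ?exprn_ge0 ?mulr_ge0.
      - by rewrite ler_wpM2l ?sqr_ge0.
    by clear; lra.
  have -> : m ^+ n = zi ^+ n * zi ^+ n by rewrite /m -exprM -exprD mul2n addnn.
  have -> : s i * zi ^+ n = zi ^+ n * zi ^+ n + (s i - zi ^+ n) * zi ^+ n by ring.
  rewrite lerD2l; apply: lerNnormlW; rewrite normrM -[leRHS]mulr1.
  exact: ler_pM.
have F_le : Fx <= Y2 + kap2.
  rewrite -lerBlDl; apply: le_of_sqr_le => //; apply: (le_trans FY).
  apply: (le_trans _ eps_kap2b).
  have := ler_wpM2l (mulr_ge0 B00 (ltW eps_gt0)) Y22; clear; lra.
have Y2_gap : Y2 <= m ^+ n + (t + delta) ^+ n + kap2.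
  (* theta < 3/5 < m puts i among the large correlations, as [hYg] demands. *)
  have : theta < m by apply: (lt_trans theta_small); move: t25; rewrite /t; clear; lra.
  by move=> /hYg/le_trans; apply; rewrite lerD2l (le_trans Gam_n).
have X_ge0 : 0 <= X by apply: sumr_ge0 => j _; exact/exprn_ge0/sqr_ge0.
have sy_le : s i * zi ^+ n <= m * Fx + Delta + kap2.
  apply: gap => //; apply: (le_trans _ eps_kap2d).
  have LX : L * X <= 2 * L + Gam * eps.
    have := ler_wpM2l L_ge0 sum_n1; move: Gam_n1; clear; lra.
  have : c2 ^+ 2 * Y2 * (c1 * L * X) <= c2 ^+ 2 * 2 * (c1 * (2 * L + Gam * eps)).
    apply: ler_pM.
    - by rewrite mulr_ge0 ?sqr_ge0.
    - by rewrite !mulr_ge0.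
    - by rewrite ler_wpM2l ?sqr_ge0.
    - by rewrite -mulrA ler_wpM2l.
  by clear; lra.
exact: (gap_third n_ge2 erefl t0 t25 d0 delta_small kap2_ge0 sy_ge sy_le F_le Y2_gap Delta_kap2).
Qed.

(** * Counting the critical points *)

Lemma continuous_edot (R : realType) D (b : 'cV[R]_D) : continuous (fun y : 'cV[R]_D => edot b y).
Proof.
apply: continuous_big => [|i _]; first exact: add_continuous.
by move=> y; apply: (cvgM (cvg_cst _) (@coord_continuous _ _ _ _ _ y)).
Qed.

Lemma Fproj_le1 (R : realType) D n (B : {vspace tensor R D n}) x : sphere x -> Fproj B x <= 1.
Proof.
move=> sx; rewrite /Fproj (ip_norm_sqr (fdot_ip R D n)) (le_trans (orthoproj_le _ _))//.
by rewrite fdot_tpow sphere_edot// expr1n.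
Qed.

Section Landscape.
Context {R : realType} {D n K : nat} {A : 'M[R]_(D, K)} {Ahat : {vspace tensor R D n}}.
Context (r Delta lev : R).
Local Notation F := (Fproj Ahat).
Definition signed_col (p : 'I_K * bool) : 'cV[R]_D := (-1) ^+ p.2 *: col p.1 A.
Local Notation b := signed_col.

Hypotheses (n_ge2 : (2 <= n)%N) (K_gt0 : (0 < K)%N) (r_gt0 : 0 < r) (r_le : r <= 8^-1).
Hypotheses (Delta_ge0 : 0 <= Delta) (Delta_small : 16 * Delta <= r ^+ 2).
Hypothesis (unitA : forall i, sphere (col i A)).
Hypothesis (incoh : forall i j, i != j -> edot (col i A) (col j A) ^+ 2 <= 4^-1).
Hypothesis (lev_le : lev <= 1 - Delta).
Hypothesis (strict : forall p x y, cap (b p) r x -> cap (b p) r y -> y != x ->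
  (forall z, edot x z = 0 -> grad_form Ahat x z = 0) -> F y < F x).
Hypothesis (dist : forall p x, cap (b p) r x ->
  (forall z, edot x z = 0 -> grad_form Ahat x z = 0) ->
  n%:R * edot (x - b p) (x - b p) <= 2 * Delta).
Hypothesis (exist : forall p, exists x,
  [/\ cap (b p) r x, second_order_critical F x & 1 - Delta <= F x]).
Hypothesis (gap : forall x, second_order_critical F x -> lev <= F x ->
  exists i, 1 - edot (col i A) x ^+ 2 <= r ^+ 2 / 2).

Local Notation eip := (edot_ip R D).
Local Notation crit := [set x | second_order_critical F x /\ lev <= F x].

Local Ltac clear_local := clear -n_ge2 r_gt0 r_le Delta_ge0 Delta_small unitA incoh
  lev_le strict dist exist gap K_gt0.

Lemma signed_col_sphere p : sphere (b p).
Proof.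
rewrite /sphere /= /enorm (ip_normZ eip) -/(enorm _) unitA mulr1.
by rewrite normrX normrN1 expr1n.
Qed.

Lemma soc_grad x : second_order_critical F x ->
  forall z, edot x z = 0 -> grad_form Ahat x z = 0.
Proof. by move=> /second_order_criticalP[_ h] z /h[]. Qed.

(** From |z| <= 1 one gets |z| >= z^2 >= 1 - r^2/2; the sign of z selects a_i or -a_i. *)
Lemma crit_cap x : crit x -> exists p, cap (b p) r x.
Proof.
move=> [socx /(gap socx)[i gapi]]; have [sx _ _] := socx.
have z1 : `|edot (col i A) x| <= 1.
  by rewrite (le_trans (ip_cauchy_norm eip _ _))// -!/(enorm _) unitA sx mulr1.
have zz : 1 - r ^+ 2 / 2 <= `|edot (col i A) x|.
  apply: (@le_trans _ _ (`|edot (col i A) x| ^+ 2)).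
    by rewrite real_normK ?num_real//; move: gapi; clear_local; lra.
  by rewrite expr2 ler_piMl.
exists (i, edot (col i A) x < 0); split=> //.
by rewrite /b /= (ipZl eip) -normrEsign.
Qed.

Lemma close_le p x : cap (b p) r x -> second_order_critical F x ->
  enorm (x - b p) ^+ 2 <= 2 * Delta / n%:R.
Proof.
move=> cx /soc_grad g; rewrite (ip_norm_sqr eip) ler_pdivlMr ?ltr0n ?(leq_trans _ n_ge2)//.
by rewrite mulrC dist.
Qed.

Lemma close_Delta : 2 * Delta / n%:R <= Delta.
Proof.
rewrite ler_pdivrMr ?ltr0n ?(leq_trans _ n_ge2)// mulrC ler_wpM2l//.
by rewrite ler_nat.
Qed.

(** Distinct signed components have inner product at most 1/2, hence squared distance at least 1,
    while two of them close to the same x would be within 4 Delta. *)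
Lemma close_inj p p' x : enorm (x - b p) ^+ 2 <= 2 * Delta / n%:R ->
  enorm (x - b p') ^+ 2 <= 2 * Delta / n%:R -> p = p'.
Proof.
move=> /le_trans/(_ close_Delta) h /le_trans/(_ close_Delta) h'.
apply/eqP/negPn/negP => pp'.
have le12 : edot (b p) (b p') <= 2^-1.
  rewrite (ipZl eip) (ipZr eip) mulrA -exprD.
  have [e|ne] := eqVneq p.1 p'.1.
    rewrite e (sphere_edot (unitA _)) mulr1.
    have -> : (-1) ^+ (p.2 + p'.2) = -1 :> R.
      move: pp' e; case: p p' {h h'} => [i s] [j s'] /=; rewrite xpair_eqE => + ij.
      by rewrite ij eqxx /=; case: s; case: s'; rewrite ?expr1 ?expr0.
    by clear_local; lra.
  rewrite (le_trans (ler_norm _))// normrM normrX normrN1 expr1n mul1r.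
  apply: le_of_sqr_le; first by clear_local; lra.
  rewrite real_normK ?num_real// (le_trans (incoh ne))//; clear_local; lra.
have : edot (b p - b p') (b p - b p') <= 4 * Delta.
  have -> : b p - b p' = (x - b p') - (x - b p) by rewrite opprB [RHS]addrC addrA subrK.
  move: h h'; rewrite !(ip_norm_sqr eip); move: (x - b p) (x - b p') => v u h h'.
  have := ip_ge0 eip (v + u).
  by rewrite !(ipBl eip, ipBr eip, ipDl eip, ipDr eip) (ip_sym eip v u); move: h h'; clear_local; lra.
rewrite !(ipBl eip, ipBr eip) !(sphere_edot (signed_col_sphere _)) (ip_sym eip (b p')).
have r2 : r ^+ 2 <= 8^-1 ^+ 2 by rewrite lerXn2r ?nnegrE ?(ltW r_gt0)//; clear_local; lra.
by move: r2 le12 Delta_small; lra.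
Qed.

(** Choosing one critical point per cap gives a map f from the 2K signed components to [crit]. It is
    onto because [gap] places a critical point in some cap and [strict] identifies it with the
    chosen one, and injective by [close_inj]. *)
Lemma landscape :
  [/\ (crit #= `I_(2 * K))%card,
      forall x, crit x -> strict_local_max F x,
      forall x, crit x -> exists! p : 'I_K * bool,
        enorm (x - (-1) ^+ p.2 *: col p.1 A) ^+ 2 <= 2 * Delta / n%:R &
      Delta = 0 ->
        crit = [set x | exists (i : 'I_K) (s : bool), x = (-1) ^+ s *: col i A] /\
        crit = [set x | global_max F x]].
Proof.
have [f fP] := choice exist.
have fcrit p : crit (f p) by have [_ h1 h2] := fP p; split=> //; apply: le_trans h2.
have fclose p : enorm (f p - b p) ^+ 2 <= 2 * Delta / n%:R.
  by have [h1 h2 _] := fP p; apply: close_le.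
have critE x : crit x -> exists2 p, x = f p & cap (b p) r x.
  move=> cx; have [p capx] := crit_cap cx; exists p => //.
  have [capf socf _] := fP p; have [socx _] := cx.
  apply/eqP/negPn/negP => xf.
  have h1 := strict capf capx xf (soc_grad socf).
  rewrite eq_sym in xf; have h2 := strict capx capf xf (soc_grad socx).
  by have := lt_trans h1 h2; rewrite ltxx.
have crit_close x : crit x -> exists p, enorm (x - b p) ^+ 2 <= 2 * Delta / n%:R.
  by move=> /critE[p -> _]; exists p.
split.
- pose g (k : 'I_#|{: 'I_K * bool}|) := f (enum_val k).
  have -> : crit = g @` [set: _].
    apply/seteqP; split => [x /critE[p -> _]|_ [k _ <-]]; last exact: fcrit.
    by exists (enum_rank p); rewrite // /g enum_rankK.
  have ginj : {in [set: _] &, injective g}.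
    move=> k l _ _ gkl; apply: enum_val_inj; apply: (@close_inj _ _ (g k)).
      exact: fclose.
    by rewrite gkl; apply: fclose.
  rewrite (card_eql (inj_card_eq ginj)) card_eq_sym.
  rewrite -(_ : #|{: 'I_K * bool}| = 2 * K)%N; first exact: card_II.
  by rewrite card_prod card_ord card_bool mulnC.
- move=> x /[dup] cx /critE[p _ capx]; have [socx _] := cx; have [sx bx] := capx.
  split=> //.
  (* The distance bound beats the radius of the cap, so x is interior and the cap contains a
     neighbourhood of x in the sphere. *)
  have bx_gt : 1 - r ^+ 2 / 2 < edot (b p) x.
    have := le_trans (close_le capx socx) close_Delta.
    rewrite (ip_norm_sqr eip) !(ipBl eip, ipBr eip) !sphere_edot//; last exact: signed_col_sphere.
    rewrite (ip_sym eip x (b p)); have r2 : 0 < r ^+ 2 by rewrite exprn_gt0.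
    by move: r2 Delta_small; lra.
  have : \forall y \near x, 1 - r ^+ 2 / 2 < edot (b p) y.
    exact: (cvgr_gt _ (@continuous_edot _ _ (b p) x)).
  apply: filterS => y by_ sy yx; apply: (strict capx) => //; last exact: soc_grad.
  by split=> //; exact: ltW.
- move=> x /crit_close[p hp]; exists p; split=> // p' hp'.
  exact: close_inj hp hp'.
- move=> D0.
  (* Without noise the distance bound is 0. As F <= 1 on the sphere and F is at least 1 at each
     signed component, these are global maximizers. *)
  have fb p : f p = b p.
    apply/eqP; rewrite -subr_eq0; apply/eqP/edot_eq0/eqP; rewrite eq_le (ip_ge0 eip) andbT.
    by rewrite -(ip_norm_sqr eip) (le_trans (fclose p))// D0 mulr0 mul0r.
  have Fb p : 1 <= F (b p) by rewrite -fb; have [_ _] := fP p; rewrite D0 subr0.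
  split; apply/seteqP; split=> x.
  + by move=> /critE[p -> _]; exists p.1, p.2; rewrite fb.
  + by move=> [i [s ->]]; have := fcrit (i, s); rewrite fb.
  + move=> /[dup] -[[sx _ _] _] /critE[p xf _]; split=> // y sy.
    by rewrite (le_trans (Fproj_le1 _ sy))// xf fb.
  + move=> [sx xmax].
    have Fx : 1 <= F x.
      have p0 : 'I_K * bool := (Ordinal K_gt0, false).
      exact: le_trans (Fb p0) (xmax _ (signed_col_sphere p0)).
    split; last by rewrite (le_trans lev_le)// D0 subr0.
    by apply: (local_max_second_order_critical sx ltr01) => y sy _; apply: xmax.
Qed.

End Landscape.

(** * Choice of the constants *)

Fact near_small_bound (R : realType) n (u theta r k : R) : (2 <= n)%N ->
  0 <= u <= 1 -> 2 * u + 2 * theta ^+ n.-1 + k * theta ^+ n <= 8 * r ^+ 2 ->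
  2 * u ^+ n.-1 + theta ^+ n.-1 * (2 + k * theta) <= 8 * r ^+ 2.
Proof.
move=> n2 /andP[u0 u1] h.
have un : u ^+ n.-1 <= u by rewrite -[leRHS]expr1 ler_wiXn2l ?u0//; case: n n2 {h} => [|[]].
have -> : theta ^+ n.-1 * (2 + k * theta) = 2 * theta ^+ n.-1 + k * theta ^+ n.
  by rewrite -[in RHS](prednK (leq_trans _ n2))// exprSr; ring.
by move: un h; clear; lra.
Qed.

(** [Gam] is a sum with one summand per estimate: powers of the constants in c1 L and theta = (2/cd)
    L, then 1/cd for L^(n-1) <= eps/cd, and cd for L = (cd/2) theta. *)
Fact scaled_eps_bounds (R : realType) n (c1 cd k L Gam : R) : (2 <= n)%N ->
  0 <= c1 -> 0 < cd -> 0 <= k -> 0 <= L -> cd <= k * L ->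
  Gam = c1 ^+ n + (2 / cd) ^+ n + (2 / cd) ^+ (n - 2) + (2 / cd) ^+ n.-1 + cd^-1 + cd ->
  let eps := k * L ^+ n in let theta := 2 / cd * L in
  [/\ k * (c1 * L) ^+ n <= Gam * eps, k * theta ^+ n <= Gam * eps,
      L ^+ 2 * (k * theta ^+ (n - 2)) <= Gam * eps, L * (k * theta ^+ n.-1) <= Gam * eps &
      L ^+ n.-1 <= Gam * eps /\ L <= Gam * theta].
Proof.
move=> n2 c10 cd0 k0 L0 kL GE eps theta.
have e0 : 0 <= eps by rewrite mulr_ge0// exprn_ge0.
have i0 : 0 <= cd^-1 by rewrite invr_ge0 ltW.
have a0 : 0 <= 2 / cd by rewrite mulr_ge0.
have t1 : 0 <= c1 ^+ n by exact: exprn_ge0.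
have t2 : 0 <= (2 / cd) ^+ n by exact: exprn_ge0.
have t3 : 0 <= (2 / cd) ^+ (n - 2) by exact: exprn_ge0.
have t4 : 0 <= (2 / cd) ^+ n.-1 by exact: exprn_ge0.
have G1 a : a <= Gam -> a * eps <= Gam * eps by move=> aG; rewrite ler_wpM2r.
have LE : L ^+ n = L * L ^+ n.-1 by rewrite -exprS prednK// (leq_trans _ n2).
have LE2 : L ^+ n = L ^+ 2 * L ^+ (n - 2) by rewrite -exprD subnKC.
have cdG : cd <= Gam by rewrite GE; move: t1 t2 t3 t4 i0; clear; lra.
split.
- have -> : k * (c1 * L) ^+ n = c1 ^+ n * eps by rewrite exprMn /eps; ring.
  by apply: G1; rewrite GE; move: t2 t3 t4 i0 cd0; clear; lra.
- have -> : k * theta ^+ n = (2 / cd) ^+ n * eps by rewrite exprMn /eps; ring.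
  by apply: G1; rewrite GE; move: t1 t3 t4 i0 cd0; clear; lra.
- have -> : L ^+ 2 * (k * theta ^+ (n - 2)) = (2 / cd) ^+ (n - 2) * eps.
    by rewrite exprMn /eps LE2; ring.
  by apply: G1; rewrite GE; move: t1 t2 t4 i0 cd0; clear; lra.
- have -> : L * (k * theta ^+ n.-1) = (2 / cd) ^+ n.-1 * eps.
    by rewrite exprMn /eps LE; ring.
  by apply: G1; rewrite GE; move: t1 t2 t3 i0 cd0; clear; lra.
split.
  apply: (@le_trans _ _ (cd^-1 * eps)).
    rewrite mulrC ler_pdivlMr// /eps LE mulrC mulrA.
    by rewrite ler_wpM2r// exprn_ge0.
  by apply: G1; rewrite GE; move: t1 t2 t3 t4 cd0; clear; lra.
have -> : L = cd / 2 * theta by rewrite /theta; field; exact: lt0r_neq0.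
rewrite ler_wpM2r ?mulr_ge0//.
by move: cdG cd0; clear; lra.
Qed.

Fact scale_le (R : realType) (sig MM c y : R) :
  0 <= c -> c <= MM -> 0 < MM -> y <= sig / MM -> 0 <= y -> c * y <= sig.
Proof.
move=> c0 cM MM0 yl y0; apply: le_trans (ler_wpM2r y0 cM) _.
by rewrite mulrC -ler_pdivlMr.
Qed.

Theorem theorem16 (R : realType) (n : nat) (c1 c2 : R)
    (hn : (2 <= n)%N) (hc1 : 0 < c1) (hc2 : 0 < c2) :
  exists2 delta0 : R, 0 < delta0 &
  forall cdelta : R, 0 < cdelta ->
  exists Delta0 C : R, [/\ 0 < Delta0, 0 < C &
  forall K : nat -> nat, (forall D, (2 <= K D)%N) ->
    eps n K D @[D --> \oo] --> (0 : R) ->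
  exists2 D0 : nat, (0 < D0)%N &
  forall delta : R, 0 < delta < 1 -> delta < delta0 ->
  forall (D : nat) (A : 'M[R]_(D, K D)) (Ahat : {vspace tensor R D n}),
    (D0 < D)%N ->
    (forall i, sphere (col i A)) ->
    RIP `|Num.ceil (cdelta * D%:R / ln (K D)%:R)|%N delta A ->
    (forall i j, i != j ->
       edot (col i A) (col j A) ^+ 2 <= c1 * ln (K D)%:R / D%:R) ->
    gram n A \in unitmx ->
    specnorm (invmx (gram n A)) <= c2 ->
    (forall T, T \in Ahat -> symmetric_tensor T) ->
  let Delta := opnorm (orthoproj (power_span A) - orthoproj Ahat) in
    Delta <= Delta0 ->
  let F := Fproj Ahat in
  let crit := [set x | second_order_critical F x /\
                       C * eps n K D + 5 * Delta <= F x] in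
  [/\ (crit #= `I_(2 * K D))%card,
      forall x, crit x -> strict_local_max F x,
      forall x, crit x -> exists! p : 'I_(K D) * bool,
        enorm (x - (-1) ^+ p.2 *: col p.1 A) ^+ 2 <= 2 * Delta / n%:R &
      Delta = 0 ->
        crit = [set x | exists (i : 'I_(K D)) (s : bool),
                          x = (-1) ^+ s *: col i A] /\
        crit = [set x | global_max F x]]].
Proof.
have c1_ge0 := ltW hc1; have c2_ge0 := ltW hc2.
pose N : R := n%:R; have N2 : 2 <= N by rewrite ler_nat.
have N0 : 0 < N by apply: lt_le_trans N2.
pose w := Num.sqrt c2; have w0 : 0 <= w by exact: sqrtr_ge0.
pose M := 2 ^+ n.+1 * (N + 5) + 8 * w * N.
have M1 : 1 <= M.
  have p1 : 1 <= 2 ^+ n.+1 :> R by apply: exprn_ege1; rewrite ler1n.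
  have wN : 0 <= w * N by rewrite mulr_ge0// ltW.
  have : 1 * (N + 5) <= 2 ^+ n.+1 * (N + 5) by rewrite ler_wpM2r// addr_ge0// ltW.
  by move: N2 wN; rewrite /M; clear; lra.
have M0 : 0 < M by apply: lt_le_trans M1.
pose r := (8 * M)^-1.
have r0 : 0 < r by rewrite invr_gt0 mulr_gt0.
have rM : r * M <= 8^-1 by rewrite /r invfM -mulrA mulVf ?mulr1// gt_eqF.
have r8 : r <= 8^-1 by apply: le_trans rM; rewrite ler_peMr// ltW.
have r2 : 0 < r ^+ 2 by rewrite exprn_gt0.
(* 1/100 is the margin in the scalar estimates; r^2/60 makes 15 delta at most r^2/4, half of the
   admissible gap. The other half is left to [kap2]. *)
exists (Num.min 100^-1 (r ^+ 2 / 60)).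
  by rewrite lt_min invr_gt0 ltr0n divr_gt0.
move=> cd cd0.
pose Gam := c1 ^+ n + (2 / cd) ^+ n + (2 / cd) ^+ (n - 2) + (2 / cd) ^+ n.-1 + cd^-1 + cd.
have a0 : 0 <= 2 / cd by rewrite mulr_ge0// invr_ge0 ltW.
have Gam0 : 0 < Gam.
  by rewrite ltr_wpDl// !addr_ge0 ?exprn_ge0// invr_ge0 ltW.
pose B0 := 2 * (4 * c2 ^+ 2 + (c2 + 1) ^+ 2) * Gam.
have B00 : 0 <= B0.
  by rewrite !mulr_ge0 ?(ltW Gam0)// addr_ge0 ?sqr_ge0// mulr_ge0 ?sqr_ge0.
pose kap := (100 * N * (3 + 2 * c1))^-1.
have kd : 1 <= 100 * N * (3 + 2 * c1).
  have := mulr_ge0 (ltW N0) c1_ge0; move: N2; clear; lra.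
have kd0 : 0 < 100 * N * (3 + 2 * c1) by apply: lt_le_trans kd.
have kap0 : 0 < kap by rewrite invr_gt0.
have kap1 : kap ^+ 2 <= 1 by rewrite exprn_ile1 ?(ltW kap0)// invf_le1.
have kap_n : 100 * n%:R * ((3 + 2 * c1) * kap) <= 1.
  by rewrite mulrA -/N /kap mulfV// gt_eqF.
(* Q dominates every coefficient c for which q c <= kap^2 will be required, so the single choice q =
   kap^2/Q serves them all. *)
pose Q := 1 + Gam + 2 * Gam * c2 ^+ 2 + 3 * Gam * B0 + 2 * B0.
have g1 : 0 <= Gam * c2 ^+ 2 by rewrite mulr_ge0 ?sqr_ge0// ltW.
have g2 : 0 <= Gam * B0 by rewrite mulr_ge0// ltW.
have Q1 : 1 <= Q by move: Gam0 g1 g2 B00; rewrite /Q; clear; lra.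
have Q0 : 0 < Q by apply: lt_le_trans Q1.
pose q := kap ^+ 2 / Q.
have q0 : 0 < q by rewrite divr_gt0// exprn_gt0.
have qQ c : c <= Q -> q * c <= kap ^+ 2.
  move=> cQ; apply: le_trans (ler_wpM2l (ltW q0) cQ) _.
  by rewrite /q divfK// gt_eqF.
have q1 : q <= 1 by apply: le_trans kap1; rewrite -[leLHS]mulr1 qQ.
(* One summand per lower bound on [C]; the third makes q C >= 2 c2. *)
pose C := 10000 * B0 * c2 + 100 * Gam * c2 + 2 * c2 / q + 1.
have C1 : 0 <= B0 * c2 by rewrite mulr_ge0.
have C2 : 0 <= Gam * c2 by rewrite mulr_ge0// ltW.
have C3 : 0 <= c2 / q by rewrite divr_ge0// ltW.
have C0 : 0 < C by move: C1 C2 C3; rewrite /C; clear; lra.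
have C_q : 2 * c2 <= q * C.
  have qc : q * (2 * c2 / q) = 2 * c2 by rewrite mulrC divfK// gt_eqF.
  have := mulr_ge0 (ltW q0) C1; have := mulr_ge0 (ltW q0) C2.
  by move: qc (ltW q0); rewrite /C; clear; lra.
pose kap2 := r ^+ 2 / (180 * 2 ^+ n).
have p2 : 0 < 2 ^+ n :> R by rewrite exprn_gt0.
have kap20 : 0 < kap2 by rewrite divr_gt0// mulr_gt0.
have kap2E : 45 * (kap2 * 2 ^+ n) = r ^+ 2 / 4.
  by rewrite /kap2; field; exact: lt0r_neq0.
have p4 : 0 < 4 ^+ n :> R by rewrite exprn_gt0.
(* In order: for the estimates in the caps, for 200 n Delta <= 4^(-n) in the second Hessian pass,
   for the gradient test, and for a level of at most 1 - Delta. *)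
pose Delta0 := Num.min (Num.min (r ^+ 2 / 16) (200 * N * 4 ^+ n)^-1) (Num.min kap2 100^-1).
exists Delta0, C; split=> //.
  have f1 : 0 < r ^+ 2 / 16 by rewrite divr_gt0.
  have f2 : 0 < (200 * N * 4 ^+ n)^-1 by rewrite invr_gt0 !mulr_gt0.
  by rewrite !lt_min f1 f2 kap20 invr_gt0 ltr0n.
move=> K K2 lim.
pose sig := Num.min (Num.min (kap2 ^+ 2 / 2) kap2) (Num.min 4^-1 (2 * r ^+ 2)).
have sig0 : 0 < sig.
  by rewrite !lt_min kap20 divr_gt0 ?exprn_gt0//= invr_gt0 ltr0n mulr_gt0.
have [sig1 sig2 sig3 sig4] : [/\ sig <= kap2 ^+ 2 / 2, sig <= kap2, sig <= 4^-1 & sig <= 2 * r ^+ 2].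
  by split; rewrite !ge_min lexx ?orbT.
(* MM dominates all coefficients of eps and of L below; with eps and L at most sig/MM each such
   product is at most sig. *)
pose MM := 1 + 2 * Gam * c2 ^+ 2 + 2 * B0 + Gam + 2 * c2 ^+ 2 * c1 * Gam + C +
  (2 * (2 / cd) ^+ n.-1 + 1) * Gam + 4 * c2 ^+ 2 * c1 + 2 / cd + 5 * c1.
have h1 : 0 <= c2 ^+ 2 * c1 by rewrite mulr_ge0 ?sqr_ge0.
have h2 : 0 <= c2 ^+ 2 * c1 * Gam by rewrite mulr_ge0// ltW.
have h3 : 0 <= (2 / cd) ^+ n.-1 * Gam by rewrite mulr_ge0 ?exprn_ge0// ltW.
have MM0 : 0 < MM.
  by move: g1 B00 Gam0 h2 C0 h3 h1 a0 hc1; rewrite /MM; clearbody C B0 Gam; clear; lra.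
pose l0 := sig / MM; have l00 : 0 < l0 by rewrite divr_gt0.
(* Smallness of eps also controls L: the second entry and L^(n-1) <= Gam eps give L <= l0. *)
pose e0 := Num.min l0 (l0 ^+ n.-1 / Gam).
have e00 : 0 < e0 by rewrite lt_min l00 divr_gt0// exprn_gt0.
have [D0 _ hD0] : \forall D \near \oo, eps n K D < e0 by exact: (cvgr_lt _ lim).
exists D0.+1 => // delta /andP[d0 d1] ddelta0 D A Ahat DD0 unitA ripA incoh Gunit Gc2 _ Delta
  DeltaD0 F crit.
have Dpos : 0 < D%:R :> R by rewrite ltr0n (leq_trans _ DD0).
have lnK : 0 < ln (K D)%:R :> R by rewrite ln_gt0// ltr1n.
pose L := ln (K D)%:R / D%:R : R; have L0 : 0 < L by rewrite divr_gt0.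
have epsE : eps n K D = (K D)%:R * L ^+ n :> R.
  by rewrite /eps /L expr_div_n mulrA.
have eps_lt : eps n K D < e0 by apply: hD0; rewrite /= ltnW// ltnW.
have K0 : 0 < (K D)%:R :> R by rewrite ltr0n (leq_trans _ (K2 D)).
have eps0 : 0 < eps n K D :> R by rewrite epsE mulr_gt0// exprn_gt0.
set p := `|_|%N in ripA.
have pL : cd <= L * p%:R.
  have : cd * D%:R / ln (K D)%:R <= p%:R.
    rewrite /p natr_absz (le_trans (real_ceil_ge (num_real _)))// ler_int.
    exact: ler_norm.
  rewrite ler_pdivrMr// => h; rewrite /L mulrAC ler_pdivlMr// mulrC [_ * p%:R]mulrC.
  by rewrite mulrC.
(* RIP with p <= K excludes small K: it gives K L >= cd, hence L^(n-1) <= eps / cd. *)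
have pK : (p <= K D)%N by have [/andP[]] := ripA.
have cdKL : cd <= (K D)%:R * L.
  by apply: (le_trans pL); rewrite mulrC ler_wpM2r ?(ltW L0)// ler_nat.
pose theta := 2 / cd * L; have theta0 : 0 <= theta by rewrite mulr_ge0// ltW.
have theta_p : 2 <= theta * p%:R.
  have : 2 / cd * cd <= 2 / cd * (L * p%:R) by rewrite ler_wpM2l.
  by rewrite divfK ?gt_eqF// /theta mulrA.
have [G1 G2 G3 G4 [G5 G6]] :=
  scaled_eps_bounds hn c1_ge0 cd0 (ltW K0) (ltW L0) cdKL (erefl Gam).
rewrite -epsE -/theta in G1 G2 G3 G4 G5 G6.
have eps_l0 : eps n K D <= l0 by apply: (le_trans (ltW eps_lt)); rewrite ge_min lexx.
have L_l0 : L <= l0.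
  have n1 : (0 < n.-1)%N by rewrite -ltnS prednK// (leq_trans _ hn).
  apply: (le_of_expr_le n1 (ltW l00)); apply: (le_trans G5).
  rewrite mulrC -ler_pdivlMr// (le_trans (ltW eps_lt))//.
  by rewrite ge_min lexx orbT.
have sE c : 0 <= c -> c <= MM -> c * eps n K D <= sig.
  by move=> c0 cM; apply: (scale_le c0 cM MM0 eps_l0); exact: ltW.
have sL c : 0 <= c -> c <= MM -> c * L <= sig.
  by move=> c0 cM; apply: (scale_le c0 cM MM0 L_l0); exact: ltW.
have E1 : 2 * Gam * c2 ^+ 2 * eps n K D <= sig.
  by apply: sE; move: g1 B00 Gam0 h2 C0 h3 h1 a0 hc1; rewrite /MM; clearbody C B0 Gam; clear; lra.
have E2 : 2 * B0 * eps n K D <= sig.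
  by apply: sE; move: g1 B00 Gam0 h2 C0 h3 h1 a0 hc1; rewrite /MM; clearbody C B0 Gam; clear; lra.
have E3 : Gam * eps n K D <= sig.
  by apply: sE; move: g1 B00 Gam0 h2 C0 h3 h1 a0 hc1; rewrite /MM; clearbody C B0 Gam; clear; lra.
have E4 : 2 * c2 ^+ 2 * c1 * Gam * eps n K D <= sig.
  by apply: sE; move: g1 B00 Gam0 h2 C0 h3 h1 a0 hc1; rewrite /MM; clearbody C B0 Gam; clear; lra.
have E5 : C * eps n K D <= sig.
  by apply: sE; move: g1 B00 Gam0 h2 C0 h3 h1 a0 hc1; rewrite /MM; clearbody C B0 Gam; clear; lra.
have E6 : (2 * (2 / cd) ^+ n.-1 + 1) * Gam * eps n K D <= sig.
  by apply: sE; move: g1 B00 Gam0 h2 C0 h3 h1 a0 hc1; rewrite /MM; clearbody C B0 Gam; clear; lra.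
have E7 : 4 * c2 ^+ 2 * c1 * L <= sig.
  by apply: sL; move: g1 B00 Gam0 h2 C0 h3 h1 a0 hc1; rewrite /MM; clearbody C B0 Gam; clear; lra.
have E8 : 2 / cd * L <= sig.
  by apply: sL; move: g1 B00 Gam0 h2 C0 h3 h1 a0 hc1; rewrite /MM; clearbody C B0 Gam; clear; lra.
have E9 : 5 * c1 * L <= sig.
  by apply: sL; move: g1 B00 Gam0 h2 C0 h3 h1 a0 hc1; rewrite /MM; clearbody C B0 Gam; clear; lra.
have c1L0 : 0 <= c1 * L by rewrite mulr_ge0// ltW.
have noise T : fnorm (orthoproj (power_span A) T - orthoproj Ahat T) <= Delta * fnorm T.
  have := fnorm_le_opnorm (orthoproj (power_span A) - orthoproj Ahat) T.
  by rewrite add_lfunE opp_lfunE.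
(* [Delta] is a supremum; its sign is read off from [noise] at a unit tensor, for which a column is
   needed. *)
have Delta_ge0 : 0 <= Delta.
  have i0 : 'I_(K D) := Ordinal (leq_trans (isT : (0 < 2)%N) (K2 D)).
  have := noise (tpow (col i0 A)); rewrite fnorm_tpow// mulr1.
  by apply: le_trans; exact: sqrtr_ge0.
move: DeltaD0; rewrite !le_min => /andP[/andP[D1 D2] /andP[D3 D4]].
have Delta16 : 16 * Delta <= r ^+ 2 by move: D1; clear; lra.
have Delta_n : 200 * n%:R * Delta <= (4 ^+ n)^-1.
  have N200 : 0 < 200 * N by rewrite mulr_gt0.
  by have := ler_wpM2l (ltW N200) D2; rewrite invfM mulrA mulfV ?mul1r// gt_eqF.
have incoh' i j : i != j -> edot (col i A) (col j A) ^+ 2 <= c1 * L.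
  by move=> /incoh; rewrite /L mulrA.
have delta_small : delta <= 100^-1.
  by rewrite ltW// (lt_le_trans ddelta0)// ge_min lexx.
have delta_r : 15 * delta <= r ^+ 2 / 4.
  have : delta <= r ^+ 2 / 60 by rewrite ltW// (lt_le_trans ddelta0)// ge_min lexx orbT.
  by clear; lra.
have near_small : 2 * (2 * c1 * L + 2 * r ^+ 2) ^+ n.-1 +
    theta ^+ n.-1 * (2 + (K D)%:R * theta) <= 8 * r ^+ 2.
  have r1 : r ^+ 2 <= 8^-1 ^+ 2 by rewrite lerXn2r ?nnegrE ?(ltW r0)//; clear; lra.
  apply: near_small_bound => //.
    by apply/andP; split; move: E9 sig4 sig3 c1L0 r2 r1; clear; lra.
  have f1 : theta ^+ n.-1 <= (2 / cd) ^+ n.-1 * (Gam * eps n K D).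
    by rewrite exprMn ler_wpM2l// exprn_ge0.
  by move: f1 G2 E6 E9 sig4 c1L0; clear; lra.
have bE s : signed_col (A := A) s = col s.1 A \/ signed_col (A := A) s = - col s.1 A.
  by case: s => i [] /=; [right | left]; rewrite /signed_col /= ?expr1 ?expr0 ?scaleN1r ?scale1r.
have delta_le1 : delta <= 1 by exact: ltW.
apply: (landscape (r := r)) => //.
- exact: leq_trans (K2 D).
- by move=> i j /incoh'/le_trans; apply; move: E9 sig3 c1L0; clear; lra.
- by move: E5 sig3 D4; clear; lra.
- move=> s x y; apply: (near_strict_max hn c1_ge0 c2_ge0 (ltW L0) theta0 Delta_ge0 unitA ripA
    delta_le1 theta_p incoh' Gunit Gc2 noise (bE s) r0 near_small rM Delta16).
- move=> s x; apply: (near_center_dist hn c1_ge0 c2_ge0 (ltW L0) theta0 Delta_ge0 unitA ripA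
    delta_le1 theta_p incoh' Gunit Gc2 noise (bE s) r0 near_small rM Delta16).
- move=> s; exact: (near_exists hn c1_ge0 c2_ge0 (ltW L0) theta0 unitA ripA
    delta_le1 theta_p incoh' Gunit Gc2 noise (bE s) r0 near_small rM Delta16).
move=> x socx level.
have [i hi] : exists i, 1 - edot (col i A) x ^+ 2 <= 15 * delta + 45 * (kap2 * 2 ^+ n).
  (* With sl = 1 the condition [q_sl] is Gam q <= 1, which holds since q Gam <= kap^2 <= 1. *)
  apply: (critical_gap hn c1_ge0 c2_ge0 (ltW L0) theta0 Delta_ge0 unitA ripA delta_small
    theta_p incoh' Gunit Gc2 noise (ltW Gam0) eps0 C0 G1 G2 G3 G4 G5 G6 (q := q) (sl := 1)
    (kap := kap)) => //.
  - by rewrite -/B0 /C; move: C2 C3; clear; lra.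
  - by move: C1 C3; rewrite /C; clear; lra.
  - exact: ltW.
  - exact: ltW.
  - exact: ltW.
  - rewrite expr1n (le_trans _ kap1)// mulrC qQ// /Q.
    by move: g1 g2 B00; clear; lra.
  - have := qQ (2 * Gam * c2 ^+ 2); rewrite /Q => h.
    have {}h : q * (2 * Gam * c2 ^+ 2) <= kap ^+ 2.
      by apply: h; move: Gam0 g2 B00; clear; lra.
    by move: h; clear; lra.
  - have h : q * (3 * Gam * B0) <= kap ^+ 2.
      by apply: qQ; rewrite /Q; move: Gam0 g1 B00; clear; lra.
    have f : 0 <= B0 * q * Gam * (1 - q).
      apply: mulr_ge0; last by rewrite subr_ge0.
      exact: (mulr_ge0 (mulr_ge0 B00 (ltW q0)) (ltW Gam0)).
    by move: h f; rewrite -/B0; clear; lra.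
  - have h : q * (2 * B0) <= kap ^+ 2.
      by apply: qQ; rewrite /Q; move: Gam0 g1 g2; clear; lra.
    by move: h; rewrite -/B0; clear; lra.
  - by move: E1 sig1 (sqr_ge0 kap2); clear; lra.
  - by move: E2 sig1 (sqr_ge0 kap2); rewrite -/B0; clear; lra.
  - by move: E3 sig2; clear; lra.
  - by move: E4 E7 sig1; clear; lra.
  - by move: E8 sig3; rewrite -/theta; clear; lra.
by exists i; apply: (le_trans hi); rewrite kap2E; move: delta_r; clear; lra.
Qed.
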